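(* There exists an arc $X$ in $\mathbb{C}^4$ (a subspace homeomorphic to $[0,1]$) such that $\widehat{X}\setminus X\neq\emptyset$, $\widehat{X}$ contains no analytic discs, and $P(X)$ has dense invertibles. The same statement holds with ''arc'' replaced by ''simple closed curve'' (a subspace homeomorphic to the unit circle).
   Context: For a compact set $X\subset\mathbb{C}^N$, the polynomial hull is $\widehat{X}=\{z\in\mathbb{C}^N: |p(z)|\le \max_{x\in X}|p(x)| \text{ for all polynomials } p\}$. An analytic disc in $\mathbb{C}^N$ is an injective holomorphic map $\sigma:D\to\mathbb{C}^N$ ($D$ the open unit disc); a set contains no analytic discs if no analytic disc has image in it. $P(X)$ is the uniform closure on $X$ of the polynomials in the coordinate functions. A uniform algebra has dense invertibles if its invertible elements are dense in it. *)

(* Defs.v *)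
From Stdlib Require Import Reals.
Open Scope R_scope.

Record C := mkC { Re : R; Im : R }.
Definition C0 : C := mkC 0 0.
Definition C1 : C := mkC 1 0.
Definition Cadd (z w : C) : C := mkC (Re z + Re w) (Im z + Im w).
Definition Copp (z : C) : C := mkC (- Re z) (- Im z).
Definition Csub (z w : C) : C := Cadd z (Copp w).
Definition Cmul (z w : C) : C :=
  mkC (Re z * Re w - Im z * Im w) (Re z * Im w + Im z * Re w).
Definition Cnorm (z : C) : R := sqrt (Re z * Re z + Im z * Im z).

Record C4 := mkC4 { c1 : C; c2 : C; c3 : C; c4 : C }.
Definition C4add (z w : C4) : C4 :=
  mkC4 (Cadd (c1 z) (c1 w)) (Cadd (c2 z) (c2 w)) (Cadd (c3 z) (c3 w)) (Cadd (c4 z) (c4 w)).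
Definition C4sub (z w : C4) : C4 :=
  mkC4 (Csub (c1 z) (c1 w)) (Csub (c2 z) (c2 w)) (Csub (c3 z) (c3 w)) (Csub (c4 z) (c4 w)).
Definition C4scal (a : C) (z : C4) : C4 :=
  mkC4 (Cmul a (c1 z)) (Cmul a (c2 z)) (Cmul a (c3 z)) (Cmul a (c4 z)).
Definition C4norm (z : C4) : R :=
  sqrt (Rsqr (Cnorm (c1 z)) + Rsqr (Cnorm (c2 z)) + Rsqr (Cnorm (c3 z)) + Rsqr (Cnorm (c4 z))).
Definition C4dist (z w : C4) : R := C4norm (C4sub z w).
Definition Cdist (z w : C) : R := Cnorm (Csub z w).

Inductive var4 := V1 | V2 | V3 | V4.
Inductive poly4 :=
| Pconst : C -> poly4
| Pvar : var4 -> poly4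
| Padd : poly4 -> poly4 -> poly4
| Pmul : poly4 -> poly4 -> poly4.

Definition coord (v : var4) (z : C4) : C :=
  match v with V1 => c1 z | V2 => c2 z | V3 => c3 z | V4 => c4 z end.

Fixpoint peval (p : poly4) (z : C4) : C :=
  match p with
  | Pconst a => a
  | Pvar v => coord v z
  | Padd p q => Cadd (peval p z) (peval q z)
  | Pmul p q => Cmul (peval p z) (peval q z)
  end.

Definition continuous_on {U V : Type} (dU : U -> U -> R) (dV : V -> V -> R)
  (A : U -> Prop) (f : U -> V) : Prop :=
  forall x, A x -> forall eps, eps > 0 -> exists delta, delta > 0 /\
    forall y, A y -> dU x y < delta -> dV (f x) (f y) < eps.

Definition homeomorphic {U V : Type} (dU : U -> U -> R) (dV : V -> V -> R)
  (A : U -> Prop) (B : V -> Prop) : Prop :=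
  exists (f : U -> V) (g : V -> U),
    (forall x, A x -> B (f x)) /\ (forall y, B y -> A (g y)) /\
    (forall x, A x -> g (f x) = x) /\ (forall y, B y -> f (g y) = y) /\
    continuous_on dU dV A f /\ continuous_on dV dU B g.

Definition Rdist (x y : R) : R := Rabs (x - y).
Definition unit_interval (t : R) : Prop := 0 <= t <= 1.
Definition unit_circle (z : C) : Prop := Cnorm z = 1.

Definition is_arc (X : C4 -> Prop) : Prop :=
  homeomorphic Rdist C4dist unit_interval X.
Definition is_simple_closed_curve (X : C4 -> Prop) : Prop :=
  homeomorphic Cdist C4dist unit_circle X.

(* |p(z)| <= max_X |p|, written as: every bound for |p| on X bounds |p(z)| *)
Definition poly_hull (X : C4 -> Prop) (z : C4) : Prop :=
  forall (p : poly4) (M : R),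
    (forall x, X x -> Cnorm (peval p x) <= M) -> Cnorm (peval p z) <= M.

Definition open_unit_disc (w : C) : Prop := Cnorm w < 1.

Definition C_differentiable_at (sigma : C -> C4) (w : C) : Prop :=
  exists L : C4, forall eps, eps > 0 -> exists delta, delta > 0 /\
    forall h : C, 0 < Cnorm h < delta ->
      C4norm (C4sub (C4sub (sigma (Cadd w h)) (sigma w)) (C4scal h L))
        <= eps * Cnorm h.

Definition holomorphic_on_disc (sigma : C -> C4) : Prop :=
  forall w, open_unit_disc w -> C_differentiable_at sigma w.

Definition analytic_disc (sigma : C -> C4) : Prop :=
  holomorphic_on_disc sigma /\
  (forall w1 w2, open_unit_disc w1 -> open_unit_disc w2 ->
     sigma w1 = sigma w2 -> w1 = w2).

Definition contains_no_analytic_disc (Y : C4 -> Prop) : Prop :=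
  ~ exists sigma, analytic_disc sigma /\
      (forall w, open_unit_disc w -> Y (sigma w)).

(* functions are represented as C4 -> C, only their values on X matter *)
Definition in_PX (X : C4 -> Prop) (f : C4 -> C) : Prop :=
  forall eps, eps > 0 -> exists p : poly4,
    forall x, X x -> Cnorm (Csub (f x) (peval p x)) < eps.

Definition invertible_in_PX (X : C4 -> Prop) (g : C4 -> C) : Prop :=
  in_PX X g /\ exists h, in_PX X h /\ forall x, X x -> Cmul (g x) (h x) = C1.

Definition PX_dense_invertibles (X : C4 -> Prop) : Prop :=
  forall f, in_PX X f -> forall eps, eps > 0 -> exists g,
    invertible_in_PX X g /\ forall x, X x -> Cnorm (Csub (f x) (g x)) < eps.

(* Main.v *)
Require Import Defs.
From Stdlib Require Import Reals ZArith Cantor Lra Lia Psatz List Bool Classical ClassicalEpsilon.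
From mathcomp Require all_boot all_algebra complex Rstruct.
(* Reals also defines a constant C (binomial coefficients). *)
Import Defs.
Open Scope R_scope.

(** In C^3 let rho(z) = Re z3 + |z1|^2 + |z2|^2.  On the complex tangent plane
    at w of a level set, rho grows by exactly |z' - w'|^2.  Hence, by the
    maximum principle on plane algebraic curves, if p(w) = 0 one can move inside
    {p = 0} by a prescribed increment of rho without decreasing |q|, for any
    polynomial q.  Starting at the origin and letting each increment encode the
    cell of a fine grid containing the current point, one obtains a Cantor set
    S on which rho is injective and such that every p with p(0) = 0 has a zero z
    in S with |q(z)| >= |q(0)|.  Apply this to products q = P_n of high powers of
    a dense sequence of polynomials p_n, normalised at 0: the part X of S where
    all |P_n| >= 1/2 still meets every surface p = 0 through 0, but no surface
    p_n = 0.  So 0 lies in the rationally convex hull of X.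

    Since rho is injective on X, interpolation on the gaps of rho(X) gives an arc
    through X, and a return branch gives a closed curve.  Generic constants make
    a dense family of polynomials P_k zero-free on the curve.  With
    f = sum_j e_j / (P_0 ... P_j), e_j decreasing fast, all 1/P_k are uniform limits on
    the graph of f of polynomials in (z, f); thus invertibles are dense, and
    (0, f(0)) is in the hull of the graph because the value at 0 of every
    rational function without poles on the curve is attained on the curve.

    Finally an analytic disc in the hull would have a coordinate with nonzero
    derivative somewhere; an invertible element close to that coordinate would be
    a zero-free map of a square close to the identity. *)

(* Two demands pull against each other: a dense family of polynomials must be zero-free on the
   curve, while a nontrivial hull forces zeros there. They are reconciled by forcing zeros only for
   polynomials that vanish at one point, the origin: a dense family can avoid that condition by
   small constants. The clause on |q| in the maximum principle is what allows countably many zero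
   sets to be removed at once, since it carries the size of P_n from the origin to a zero of p.
   Three coordinates are used because the tangent plane of a level set of rho is then a copy of C^2,
   in which a surface cuts out a plane curve. The function rho does double duty: it orders X like a
   compact subset of the line, so that an arc can be threaded through it, and it is positive on the
   whole curve but 0 at the origin, so that the hull point lies off the curve. The fourth coordinate
   converts rational approximation into polynomial approximation; the origin survives in the hull
   because rational functions take no new values there. Complex analysis is kept finite throughout:
   averages over roots of unity stand for contour integrals. *)
Declare Scope C_scope.
Delimit Scope C_scope with C.
Bind Scope C_scope with C.
Infix "+" := Cadd : C_scope.
Infix "-" := Csub : C_scope.
Infix "*" := Cmul : C_scope.
Notation "- z" := (Copp z) : C_scope.

(** * Complex arithmetic and the modulus *)

Definition RtoC (x : R) : C := mkC x 0.
Definition Cconj (z : C) : C := mkC (Re z) (- Im z).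
Definition Cinv (z : C) : C :=
  mkC (Re z / (Re z * Re z + Im z * Im z)) (- Im z / (Re z * Re z + Im z * Im z)).
Definition Cdiv (z w : C) : C := Cmul z (Cinv w).
Infix "/" := Cdiv : C_scope.
Fixpoint Cpow (z : C) (n : nat) : C :=
  match n with O => C1 | S k => Cmul z (Cpow z k) end.
Infix "^" := Cpow : C_scope.

Lemma C_ext (z w : C) : Re z = Re w -> Im z = Im w -> z = w.
Proof. destruct z, w; simpl; intros; subst; reflexivity. Qed.

Ltac Cext := apply C_ext; simpl.

Lemma C_ring_theory : ring_theory C0 C1 Cadd Cmul Csub Copp eq.
Proof. constructor; intros; Cext; ring. Qed.

Lemma C1_neq_C0 : C1 <> C0.
Proof. intro H; apply (f_equal Re) in H; simpl in H; lra. Qed.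

Lemma Csq_pos (z : C) : z <> C0 -> 0 < Re z * Re z + Im z * Im z.
Proof.
  intro Hz.
  destruct (Req_dec (Re z) 0) as [H1|H1]; destruct (Req_dec (Im z) 0) as [H2|H2]; try nra.
  exfalso; apply Hz; Cext; assumption.
Qed.

Lemma C_field_theory : field_theory C0 C1 Cadd Cmul Csub Copp Cdiv Cinv eq.
Proof.
  constructor.
  - apply C_ring_theory.
  - apply C1_neq_C0.
  - reflexivity.
  - intros z Hz; apply Csq_pos in Hz; Cext; field; lra.
Qed.


Add Field C_field : C_field_theory.

Definition sqn (z : C) : R := Re z * Re z + Im z * Im z.

Lemma sqn_ge0 (z : C) : 0 <= sqn z.
Proof. unfold sqn; nra. Qed.

Lemma Cnorm_sqr (z : C) : Cnorm z * Cnorm z = sqn z.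
Proof. apply sqrt_sqrt, sqn_ge0. Qed.

Lemma Cnorm_ge0 (z : C) : 0 <= Cnorm z.
Proof. apply sqrt_pos. Qed.

Lemma sqr_le_inv (a b : R) : 0 <= b -> a * a <= b * b -> a <= b.
Proof. intros; nra. Qed.

Lemma sqr_eq_inv (a b : R) : 0 <= a -> 0 <= b -> a * a = b * b -> a = b.
Proof. intros; nra. Qed.

Lemma Cnorm_mul (z w : C) : Cnorm (z * w) = Cnorm z * Cnorm w.
Proof.
  apply sqr_eq_inv.
  - apply Cnorm_ge0.
  - apply Rmult_le_pos; apply Cnorm_ge0.
  - replace (Cnorm z * Cnorm w * (Cnorm z * Cnorm w))
      with ((Cnorm z * Cnorm z) * (Cnorm w * Cnorm w)) by ring.
    rewrite !Cnorm_sqr; unfold sqn; simpl; ring.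
Qed.

Lemma Re_le_Cnorm (z : C) : Rabs (Re z) <= Cnorm z.
Proof.
  apply sqr_le_inv; [apply Cnorm_ge0|].
  rewrite Cnorm_sqr; unfold sqn.
  rewrite <- Rabs_mult, Rabs_right; nra.
Qed.

Lemma Im_le_Cnorm (z : C) : Rabs (Im z) <= Cnorm z.
Proof.
  apply sqr_le_inv; [apply Cnorm_ge0|].
  rewrite Cnorm_sqr; unfold sqn.
  rewrite <- Rabs_mult, Rabs_right; nra.
Qed.

Lemma Cnorm_le_parts (z : C) : Cnorm z <= Rabs (Re z) + Rabs (Im z).
Proof.
  pose proof (Rabs_pos (Re z)); pose proof (Rabs_pos (Im z)).
  apply sqr_le_inv; [lra|].
  rewrite Cnorm_sqr; unfold sqn.
  assert (forall x, x * x = Rabs x * Rabs x) as E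
    by (intro x; rewrite <- Rabs_mult, Rabs_right; nra).
  rewrite (E (Re z)), (E (Im z)); nra.
Qed.

Lemma Cnorm_triang (z w : C) : Cnorm (z + w) <= Cnorm z + Cnorm w.
Proof.
  pose proof (Cnorm_ge0 z); pose proof (Cnorm_ge0 w).
  apply sqr_le_inv; [lra|].
  replace ((Cnorm z + Cnorm w) * (Cnorm z + Cnorm w))
    with (Cnorm z * Cnorm z + Cnorm w * Cnorm w + 2 * (Cnorm z * Cnorm w)) by ring.
  rewrite !Cnorm_sqr.
  enough (Re z * Re w + Im z * Im w <= Cnorm z * Cnorm w) by (unfold sqn; simpl; nra).
  apply sqr_le_inv; [nra|].
  replace (Cnorm z * Cnorm w * (Cnorm z * Cnorm w))
    with ((Cnorm z * Cnorm z) * (Cnorm w * Cnorm w)) by ring.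
  rewrite !Cnorm_sqr; unfold sqn.
  pose proof (Rle_0_sqr (Re z * Im w - Im z * Re w)) as S; unfold Rsqr in S; nra.
Qed.

Lemma Cnorm_0 : Cnorm C0 = 0.
Proof. unfold Cnorm; simpl; replace (0 * 0 + 0 * 0) with 0 by ring; apply sqrt_0. Qed.

Lemma Cnorm_1 : Cnorm C1 = 1.
Proof. unfold Cnorm; simpl; replace (1 * 1 + 0 * 0) with 1 by ring; apply sqrt_1. Qed.

Lemma Cnorm_eq0 (z : C) : Cnorm z = 0 -> z = C0.
Proof.
  intro H; pose proof (Cnorm_sqr z) as E; rewrite H in E; unfold sqn in E.
  Cext; nra.
Qed.

Lemma Cnorm_pos (z : C) : z <> C0 -> 0 < Cnorm z.
Proof.
  intro Hz; destruct (Cnorm_ge0 z) as [H|H]; [exact H|].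
  exfalso; apply Hz, Cnorm_eq0; symmetry; exact H.
Qed.

Lemma Cnorm_neq0 (z : C) : 0 < Cnorm z -> z <> C0.
Proof. intros H E; rewrite E, Cnorm_0 in H; lra. Qed.

Lemma Cnorm_opp (z : C) : Cnorm (- z) = Cnorm z.
Proof. unfold Cnorm; simpl; f_equal; ring. Qed.

Lemma Cnorm_sub_sym (z w : C) : Cnorm (z - w) = Cnorm (w - z).
Proof. rewrite <- Cnorm_opp; f_equal; ring. Qed.

Lemma Cnorm_sub_triang (z w u : C) : Cnorm (z - u) <= Cnorm (z - w) + Cnorm (w - u).
Proof. replace (z - u)%C with ((z - w) + (w - u))%C by ring; apply Cnorm_triang. Qed.

Lemma Cnorm_sub_le (z w : C) : Cnorm (z - w) <= Cnorm z + Cnorm w.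
Proof. rewrite <- (Cnorm_opp w); apply Cnorm_triang. Qed.

Lemma Cnorm_sub_ge (z w : C) : Cnorm z - Cnorm w <= Cnorm (z - w).
Proof.
  pose proof (Cnorm_triang (z - w) w) as H; replace (z - w + w)%C with z in H by ring; lra.
Qed.

Lemma Cnorm_RtoC (x : R) : Cnorm (RtoC x) = Rabs x.
Proof.
  apply sqr_eq_inv; [apply Cnorm_ge0|apply Rabs_pos|].
  rewrite Cnorm_sqr, <- Rabs_mult, Rabs_right; unfold sqn; simpl; nra.
Qed.

Lemma Cnorm_inv (z : C) : z <> C0 -> Cnorm (Cinv z) = / Cnorm z.
Proof.
  intro Hz; pose proof (Cnorm_pos z Hz).
  apply Rmult_eq_reg_l with (Cnorm z); [|lra].
  rewrite <- Cnorm_mul, Rinv_r by lra.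
  replace (z * Cinv z)%C with C1 by (field; exact Hz); apply Cnorm_1.
Qed.

Lemma Cnorm_div (z w : C) : w <> C0 -> Cnorm (z / w) = Cnorm z / Cnorm w.
Proof. intro Hw; unfold Cdiv; rewrite Cnorm_mul, Cnorm_inv by exact Hw; reflexivity. Qed.

Lemma Cnorm_pow (z : C) (n : nat) : Cnorm (z ^ n) = Cnorm z ^ n.
Proof. induction n as [|n IH]; simpl; [apply Cnorm_1|rewrite Cnorm_mul, IH; reflexivity]. Qed.

Lemma Cpow_add (z : C) (n m : nat) : (z ^ (n + m))%C = (z ^ n * z ^ m)%C.
Proof. induction n as [|n IH]; simpl; [ring|rewrite IH; ring]. Qed.

Lemma Cpow_mul (z : C) (n m : nat) : (z ^ (n * m))%C = ((z ^ n) ^ m)%C.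
Proof.
  induction m as [|m IH]; simpl.
  - rewrite Nat.mul_0_r; reflexivity.
  - rewrite Nat.mul_succ_r, Nat.add_comm, Cpow_add, IH; reflexivity.
Qed.

Lemma Cpow_mul_base (z w : C) (n : nat) : ((z * w) ^ n)%C = (z ^ n * w ^ n)%C.
Proof. induction n as [|n IH]; simpl; [ring|rewrite IH; ring]. Qed.

Lemma Cmul_neq0 (z w : C) : z <> C0 -> w <> C0 -> (z * w)%C <> C0.
Proof.
  intros Hz Hw; apply Cnorm_neq0; rewrite Cnorm_mul.
  apply Rmult_lt_0_compat; apply Cnorm_pos; assumption.
Qed.

Lemma Cpow_neq0 (z : C) (n : nat) : z <> C0 -> (z ^ n)%C <> C0.
Proof.
  intro Hz; induction n as [|n IH]; simpl; [exact C1_neq_C0|apply Cmul_neq0; assumption].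
Qed.

Lemma Cpow_C1 (n : nat) : (C1 ^ n)%C = C1.
Proof. induction n as [|n IH]; simpl; [reflexivity|rewrite IH; ring]. Qed.

Lemma Cmul_comm (z w : C) : (z * w)%C = (w * z)%C.
Proof. ring. Qed.

Lemma Csub_eq0 (z w : C) : (z - w)%C = C0 -> z = w.
Proof. intro H; replace z with ((z - w) + w)%C by ring; rewrite H; ring. Qed.

Lemma RtoC_neq0 (x : R) : x <> 0 -> RtoC x <> C0.
Proof. intros H E; apply (f_equal Re) in E; apply H, E. Qed.

(** * Finite sums and polynomial functions of one variable *)

Fixpoint Csum (n : nat) (F : nat -> C) : C :=
  match n with O => C0 | S k => (Csum k F + F k)%C end.

Lemma Csum_ext (n : nat) (F G : nat -> C) :
  (forall k, (k < n)%nat -> F k = G k) -> Csum n F = Csum n G.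
Proof.
  induction n as [|n IH]; intro H; simpl; [reflexivity|].
  rewrite IH, (H n) by (intros; auto with arith); reflexivity.
Qed.

Lemma Csum_add (n : nat) (F G : nat -> C) :
  Csum n (fun k => F k + G k)%C = (Csum n F + Csum n G)%C.
Proof. induction n as [|n IH]; simpl; [ring|rewrite IH; ring]. Qed.

Lemma Csum_scal (n : nat) (a : C) (F : nat -> C) :
  Csum n (fun k => a * F k)%C = (a * Csum n F)%C.
Proof. induction n as [|n IH]; simpl; [ring|rewrite IH; ring]. Qed.

Lemma Csum_zero (n : nat) (F : nat -> C) :
  (forall k, (k < n)%nat -> F k = C0) -> Csum n F = C0.
Proof.
  induction n as [|n IH]; intro H; simpl; [reflexivity|].
  rewrite IH, (H n) by (intros; auto with arith); ring.
Qed.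

Lemma Csum_single (n i : nat) (F : nat -> C) :
  (i < n)%nat -> (forall k, (k < n)%nat -> k <> i -> F k = C0) -> Csum n F = F i.
Proof.
  induction n as [|n IH]; intros Hi H; [lia|]; simpl.
  destruct (Nat.eq_dec i n) as [->|Hne].
  - rewrite Csum_zero; [ring|intros; apply H; lia].
  - rewrite IH, (H n) by (try lia; intros; apply H; lia); ring.
Qed.

Lemma Csum_swap (n m : nat) (F : nat -> nat -> C) :
  Csum n (fun i => Csum m (F i)) = Csum m (fun j => Csum n (fun i => F i j)).
Proof.
  induction n as [|n IH]; simpl.
  - symmetry; apply Csum_zero; reflexivity.
  - rewrite IH, <- Csum_add; reflexivity.
Qed.

Lemma Csum_norm_le (n : nat) (F : nat -> C) (k : R) :
  (forall i, (i < n)%nat -> Cnorm (F i) <= k) -> Cnorm (Csum n F) <= INR n * k.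
Proof.
  induction n as [|n IH]; intro H; [simpl; rewrite Cnorm_0; lra|].
  rewrite S_INR; simpl.
  eapply Rle_trans; [apply Cnorm_triang|].
  assert (Cnorm (Csum n F) <= INR n * k) by (apply IH; auto with arith).
  specialize (H n ltac:(lia)); lra.
Qed.

Fixpoint ceval (l : list C) (y : C) : C :=
  match l with nil => C0 | a :: l' => (a + y * ceval l' y)%C end.

Lemma ceval_sum (l : list C) (y : C) :
  ceval l y = Csum (length l) (fun i => nth i l C0 * y ^ i)%C.
Proof.
  assert (Hsh : forall n F, Csum (S n) F = (F O + Csum n (fun i => F (S i)))%C).
  { intros n F; induction n as [|n IH]; [simpl; ring|].
    change (Csum (S (S n)) F) with (Csum (S n) F + F (S n))%C; rewrite IH; simpl; ring. }
  induction l as [|a l IH]; [reflexivity|].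
  change (length (a :: l)) with (S (length l)); rewrite Hsh; simpl ceval; rewrite IH.
  rewrite <- Csum_scal; simpl; f_equal; [ring|].
  apply Csum_ext; intros; ring.
Qed.

(** The weights n, n+1, ... give y^(1-n) (y^n l(y))' = y l'(y) + n l(y), a form that recurses on the
    list. The derivative of a + y l(y) is the case n = 1 on the tail. *)
Fixpoint cderiv_from (n : nat) (l : list C) : list C :=
  match l with
  | nil => nil
  | a :: l' => (RtoC (INR n) * a)%C :: cderiv_from (S n) l'
  end.
Definition cderiv (l : list C) : list C := cderiv_from 1 (tl l).

Fixpoint Cprod (bs : list C) (y : C) : C :=
  match bs with nil => C1 | b :: bs' => ((y - b) * Cprod bs' y)%C end.

Fixpoint Csumlist (bs : list C) (F : C -> C) : C :=
  match bs with nil => C0 | b :: bs' => (F b + Csumlist bs' F)%C end.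

(** * Splitting of complex polynomials into linear factors *)

Module Factorization.
Import all_boot all_algebra complex Rstruct.
Import GRing.Theory.
Local Open Scope ring_scope.

Definition K := R[i].
Definition toK (z : Defs.C) : K := Complex (Defs.Re z) (Defs.Im z).
Definition ofK (z : K) : Defs.C := mkC (complex.Re z) (complex.Im z).

Lemma toK_inj z w : toK z = toK w -> z = w.
Proof. by case: z => a b; case: w => c d [-> ->]. Qed.
Lemma ofKK z : toK (ofK z) = z.
Proof. by case: z. Qed.
Lemma toKD z w : toK (Cadd z w) = toK z + toK w.
Proof. by []. Qed.
Lemma toKM z w : toK (Cmul z w) = toK z * toK w.
Proof. by []. Qed.
Lemma toKN z : toK (Copp z) = - toK z.
Proof. by []. Qed.
Lemma toK_nat n : toK (RtoC (INR n)) = n%:R.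
Proof.
elim: n => [|n IH]; first by [].
rewrite S_INR mulrSr -IH. rewrite /toK /RtoC /=.
by apply/eqP; rewrite eq_complex /= addr0 !eqxx.
Qed.

Definition pol (l : list Defs.C) : {poly K} := Poly (map toK l).

Lemma pol_cons a l : pol (a :: l) = pol l * 'X + (toK a)%:P.
Proof. by rewrite /pol /= cons_poly_def. Qed.

Lemma pol_eval l y : (pol l).[toK y] = toK (ceval l y).
Proof.
elim: l => [|a l IH]; first by rewrite /pol /= horner0.
by rewrite pol_cons hornerMXaddC IH /= toKD toKM addrC mulrC.
Qed.

Lemma pol_deriv_from l n : pol (cderiv_from n l) = (pol l)^`() * 'X + (pol l) *+ n.
Proof.
elim: l n => [|a l IH] n; first by rewrite /pol /= deriv0 mul0r mul0rn addr0.
rewrite [cderiv_from n (a :: l)]/= !pol_cons IH derivD derivC addr0 derivM derivX mulr1.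
have -> : (toK (RtoC (INR n) * a))%:P = (toK a)%:P *+ n.
  by rewrite toKM toK_nat mulr_natl polyCMn.
rewrite mulrnDl mulrDl mulrSr mulrDl !addrA -mulrnAl.
by rewrite mulrDl (addrAC (_ * _)%R (pol l *+ n * _)%R).
Qed.

Lemma pol_deriv l : pol (cderiv l) = (pol l)^`().
Proof.
case: l => [|a l]; first by rewrite /cderiv /pol /= deriv0.
by rewrite /cderiv /= pol_deriv_from mulr1n pol_cons derivD derivC addr0 derivM derivX mulr1.
Qed.

Lemma prod_eval rs y :
  (\prod_(z <- rs) ('X - z%:P)).[toK y] = toK (Cprod (List.map ofK rs) y).
Proof.
elim: rs => [|b rs IH]; first by rewrite big_nil hornerC.
by rewrite big_cons hornerM IH hornerXsubC /= toKM /Csub toKD toKN ofKK.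
Qed.

(** [R[i]] is algebraically closed, so the transported polynomial splits as soon as one value shows
    it nonzero. Roots are listed with multiplicity, as the logarithmic derivative l'/l = sum of 1/(y
    - b) requires. Their number is only bounded by the length of the list, since top coefficients
    may be 0. *)
Lemma poly_factor (l : list Defs.C) (y0 : Defs.C) : ceval l y0 <> C0 ->
  exists (a : Defs.C) (bs : list Defs.C), a <> C0 /\ (length bs <= length l)%coq_nat /\
    (forall y, ceval l y = Cmul a (Cprod bs y)) /\
    (forall y, ceval l y <> C0 ->
       ceval (cderiv l) y = Cmul (ceval l y) (Csumlist bs (fun b => Cinv (Csub y b)))).
Proof.
move=> Hy0.
have Hp : pol l != 0.
  apply/eqP => H; apply: Hy0; apply: toK_inj; by rewrite -pol_eval H horner0.
have [rs Hrs] := closed_field_poly_normal (pol l).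
have Hlc : lead_coef (pol l) != 0 by rewrite lead_coef_eq0.
set a := ofK (lead_coef (pol l)).
have Ea : toK a = lead_coef (pol l) by rewrite ofKK.
have Hev y : ceval l y = Cmul a (Cprod (List.map ofK rs) y).
  by apply: toK_inj; rewrite -pol_eval {1}Hrs hornerZ prod_eval toKM Ea.
have Ha : a <> C0 by move=> H; move: Hlc; rewrite -Ea H eqxx.
exists a, (List.map ofK rs); split; [exact: Ha | split; [|split]] => //.
  rewrite List.length_map.
  have := congr1 (fun p : {poly K} => size p) Hrs.
  rewrite size_scale // size_prod_XsubC => Hs.
  have := size_Poly (map toK l); rewrite -/(pol l) size_map Hs => H.
  apply/leP; exact: (leq_trans (leqnSn _) H).
have Hd : forall rs', forall y, Cprod (List.map ofK rs') y <> C0 ->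
   ((\prod_(z <- rs') ('X - z%:P))^`()).[toK y] =
   toK (Cmul (Cprod (List.map ofK rs') y)
      (Csumlist (List.map ofK rs') (fun b => Cinv (Csub y b)))).
  elim=> [|b rs' IH] y Hy; first by rewrite big_nil derivC horner0 /= toKM mulr0.
  have H1 : Csub y (ofK b) <> C0.
    by move=> E; apply: Hy; rewrite /= E; apply: toK_inj; rewrite toKM mul0r.
  have H2 : Cprod (List.map ofK rs') y <> C0.
    by move=> E; apply: Hy; rewrite /= E; apply: toK_inj; rewrite toKM mulr0.
  rewrite big_cons derivM derivXsubC mul1r hornerD hornerM IH // prod_eval hornerXsubC.
  have -> : toK y - b = toK (Csub y (ofK b)) by rewrite /Csub toKD toKN ofKK.
  rewrite -toKM -toKD; congr toK; rewrite /=.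
  move: (Csumlist _ _) (Cprod _ _) (Csub _ _) H1 => s p u Hu.
  by field.
move=> y Hy; apply: toK_inj.
have Hpy : Cprod (List.map ofK rs) y <> C0.
  by move=> E; apply: Hy; rewrite Hev E; apply: toK_inj; rewrite toKM mulr0.
rewrite -pol_eval pol_deriv Hrs derivZ hornerZ Hd // Hev !toKM Ea mulrA.
by [].
Qed.
End Factorization.

(** * Roots of unity and the vanishing of their power sums *)

Lemma primitive_root (N : nat) : (0 < N)%nat ->
  exists w : C, Cnorm w = 1 /\ (w ^ N)%C = C1 /\
    forall k, (0 < k < N)%nat -> (w ^ k)%C <> C1.
Proof.
  intro HN; set (a := 2 * PI / INR N).
  assert (HNR : 0 < INR N) by (apply lt_0_INR; lia).
  assert (Hpow : forall k, ((mkC (cos a) (sin a)) ^ k)%C = mkC (cos (INR k * a)) (sin (INR k * a))).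
  { induction k as [|k IH].
    - simpl; rewrite Rmult_0_l, cos_0, sin_0; reflexivity.
    - simpl Cpow; rewrite IH, S_INR, Rmult_plus_distr_r, Rmult_1_l, cos_plus, sin_plus.
      Cext; ring. }
  exists (mkC (cos a) (sin a)); repeat split.
  - unfold Cnorm; simpl; pose proof (sin2_cos2 a) as H; unfold Rsqr in H.
    rewrite Rplus_comm, H; apply sqrt_1.
  - rewrite Hpow; replace (INR N * a) with (2 * PI) by (unfold a; field; lra).
    rewrite cos_2PI, sin_2PI; reflexivity.
  - intros k Hk E; rewrite Hpow in E; apply (f_equal Re) in E; simpl in E.
    assert (Hb : 0 < INR k * a < 2 * PI).
    { pose proof PI_RGT_0; assert (0 < INR k) by (apply lt_0_INR; lia).
      assert (INR k < INR N) by (apply lt_INR; lia).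
      assert (0 < a) by (unfold a; apply Rdiv_lt_0_compat; lra).
      split; [nra|]. replace (2 * PI) with (INR N * a) by (unfold a; field; lra); nra. }
    (* A cosine equal to 1 would make the sine of the half angle vanish, but the half angle lies
       strictly between 0 and pi. *)
    assert (Ec : cos (INR k * a) = 1 - 2 * sin (INR k * a / 2) * sin (INR k * a / 2)).
    { rewrite <- cos_2a_sin; f_equal; field. }
    assert (0 < sin (INR k * a / 2)) by (apply sin_gt_0; lra).
    nra.
Qed.

Lemma geometric_root_sum (N : nat) (z : C) :
  (z ^ N)%C = C1 -> z <> C1 -> Csum N (fun l => z ^ l)%C = C0.
Proof.
  intros HN Hz.
  assert (E : forall n, ((z - C1) * Csum n (fun l => z ^ l) = z ^ n - C1)%C).
  { induction n as [|n IH]; simpl; [ring|].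
    replace ((z - C1) * (Csum n (fun l => z ^ l) + z ^ n))%C
      with ((z - C1) * Csum n (fun l => z ^ l) + (z - C1) * z ^ n)%C by ring.
    rewrite IH; ring. }
  specialize (E N); rewrite HN in E.
  apply NNPP; intro Hs.
  apply (Cmul_neq0 (z - C1) _ (fun H => Hz (Csub_eq0 _ _ H)) Hs).
  rewrite E; ring.
Qed.

(** * One-variable polynomials and their uniform limits on a closed disc *)

Definition Pol1 (f : C -> C) : Prop := exists l, forall x, f x = ceval l x.

Fixpoint cadd (l m : list C) : list C :=
  match l, m with
  | nil, _ => m
  | _, nil => l
  | a :: l', b :: m' => (a + b)%C :: cadd l' m'
  end.
Lemma ceval_add l : forall m x, ceval (cadd l m) x = (ceval l x + ceval m x)%C.
Proof.
  induction l as [|a l IH]; intros [|b m] x; simpl; try ring.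
  rewrite IH; ring.
Qed.
Lemma ceval_scal c l x : ceval (map (Cmul c) l) x = (c * ceval l x)%C.
Proof. induction l as [|a l IH]; simpl; [ring|rewrite IH; ring]. Qed.
Fixpoint cmul (l m : list C) : list C :=
  match l with
  | nil => nil
  | a :: l' => cadd (map (Cmul a) m) (C0 :: cmul l' m)
  end.
Lemma ceval_mul l m x : ceval (cmul l m) x = (ceval l x * ceval m x)%C.
Proof.
  induction l as [|a l IH]; simpl; [ring|].
  rewrite ceval_add, ceval_scal; simpl; rewrite IH; ring.
Qed.

Lemma Pol1_const c : Pol1 (fun _ => c).
Proof. exists (c :: nil); intro; simpl; ring. Qed.
Lemma Pol1_id : Pol1 (fun x => x).
Proof. exists (C0 :: C1 :: nil); intro; simpl; ring. Qed.
Lemma Pol1_add f g : Pol1 f -> Pol1 g -> Pol1 (fun x => f x + g x)%C.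
Proof. intros [l Hl] [m Hm]; exists (cadd l m); intro; rewrite ceval_add, Hl, Hm; reflexivity. Qed.
Lemma Pol1_mul f g : Pol1 f -> Pol1 g -> Pol1 (fun x => f x * g x)%C.
Proof. intros [l Hl] [m Hm]; exists (cmul l m); intro; rewrite ceval_mul, Hl, Hm; reflexivity. Qed.

Lemma Cnorm_mul_le z w a b : Cnorm z <= a -> Cnorm w <= b -> Cnorm (z * w) <= a * b.
Proof.
  intros; rewrite Cnorm_mul; apply Rmult_le_compat; try apply Cnorm_ge0; assumption.
Qed.

Lemma Pol1_bounded f eta : Pol1 f -> exists M, 0 <= M /\ forall x, Cnorm x <= eta -> Cnorm (f x) <= M.
Proof.
  intros [l Hl]; revert f Hl.
  assert (H : exists M, 0 <= M /\ forall x, Cnorm x <= eta -> Cnorm (ceval l x) <= M).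
  { induction l as [|a l [M [HM IH]]].
    - exists 0; split; [lra|intros; simpl; rewrite Cnorm_0; lra].
    - exists (Cnorm a + Rabs eta * M); split.
      + pose proof (Cnorm_ge0 a); pose proof (Rabs_pos eta); nra.
      + intros x Hx; simpl; eapply Rle_trans; [apply Cnorm_triang|].
        apply Rplus_le_compat_l, Cnorm_mul_le; [|auto].
        eapply Rle_trans; [exact Hx|apply Rle_abs]. }
  intros f Hl; destruct H as [M [HM H]]; exists M; split; [exact HM|].
  intros; rewrite Hl; auto.
Qed.

(* Uniform limits of polynomials on a disc; these satisfy the maximum principle
   at the centre because a polynomial is averaged exactly by roots of unity. *)
Definition Papprox (eta : R) (f : C -> C) : Prop :=
  forall eps, 0 < eps -> exists l, forall x, Cnorm x <= eta -> Cnorm (f x - ceval l x) <= eps.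

Lemma Pol1_Papprox eta f : Pol1 f -> Papprox eta f.
Proof.
  intros [l Hl] eps He; exists l; intros; rewrite Hl.
  replace (ceval l x - ceval l x)%C with C0 by ring; rewrite Cnorm_0; lra.
Qed.

Lemma Papprox_bounded eta f : Papprox eta f ->
  exists M, 0 <= M /\ forall x, Cnorm x <= eta -> Cnorm (f x) <= M.
Proof.
  intro H; destruct (H 1 Rlt_0_1) as [l Hl].
  destruct (Pol1_bounded (ceval l) eta (ex_intro _ l (fun _ => eq_refl))) as [M [HM HB]].
  exists (1 + M); split; [lra|]; intros x Hx.
  replace (f x) with ((f x - ceval l x) + ceval l x)%C by ring.
  eapply Rle_trans; [apply Cnorm_triang|].
  specialize (Hl x Hx); specialize (HB x Hx); lra.
Qed.

Lemma Papprox_add eta f g : Papprox eta f -> Papprox eta g -> Papprox eta (fun x => f x + g x)%C.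
Proof.
  intros Hf Hg eps He; destruct (Hf (eps/2) ltac:(lra)) as [l Hl].
  destruct (Hg (eps/2) ltac:(lra)) as [m Hm]; exists (cadd l m); intros x Hx.
  rewrite ceval_add.
  replace (f x + g x - (ceval l x + ceval m x))%C
    with ((f x - ceval l x) + (g x - ceval m x))%C by ring.
  eapply Rle_trans; [apply Cnorm_triang|]; specialize (Hl x Hx); specialize (Hm x Hx); lra.
Qed.

Lemma Papprox_mul eta f g : Papprox eta f -> Papprox eta g -> Papprox eta (fun x => f x * g x)%C.
Proof.
  intros Hf Hg eps He.
  destruct (Papprox_bounded _ _ Hf) as [A [HA BA]].
  destruct (Papprox_bounded _ _ Hg) as [B [HB BB]].
  destruct (Hg (Rmin 1 (eps / (2 * (A + 1))))) as [m Hm].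
  { apply Rmin_glb_lt; [lra|apply Rdiv_lt_0_compat; lra]. }
  destruct (Hf (eps / (2 * (B + 1)))) as [l Hl].
  { apply Rdiv_lt_0_compat; lra. }
  exists (cmul l m); intros x Hx; rewrite ceval_mul.
  specialize (Hl x Hx); specialize (Hm x Hx); specialize (BA x Hx); specialize (BB x Hx).
  assert (H1 := Rle_trans _ _ _ Hm (Rmin_l _ _)); assert (H2 := Rle_trans _ _ _ Hm (Rmin_r _ _)).
  assert (H3 : Cnorm (ceval m x) <= B + 1).
  { replace (ceval m x) with (g x - (g x - ceval m x))%C by ring.
    eapply Rle_trans; [apply Cnorm_sub_le|]; lra. }
  replace (f x * g x - ceval l x * ceval m x)%C
    with (f x * (g x - ceval m x) + (f x - ceval l x) * ceval m x)%C by ring.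
  eapply Rle_trans; [apply Cnorm_triang|].
  assert (Cnorm (f x * (g x - ceval m x)) <= (A + 1) * (eps / (2 * (A + 1))))
    by (apply Cnorm_mul_le; lra).
  assert (Cnorm ((f x - ceval l x) * ceval m x) <= (eps / (2 * (B + 1))) * (B + 1))
    by (apply Cnorm_mul_le; lra).
  replace ((A + 1) * (eps / (2 * (A + 1)))) with (eps/2) in * by (field; lra).
  replace ((eps / (2 * (B + 1))) * (B + 1)) with (eps/2) in * by (field; lra).
  lra.
Qed.

Lemma Papprox_sum eta n (F : nat -> C -> C) :
  (forall k, (k < n)%nat -> Papprox eta (F k)) -> Papprox eta (fun x => Csum n (fun k => F k x)).
Proof.
  induction n as [|n IH]; intro H; simpl.
  - apply Pol1_Papprox, Pol1_const.
  - apply Papprox_add; [apply IH; auto with arith|apply H; lia].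
Qed.

Lemma half_pow_small (eps : R) : 0 < eps -> exists N, forall n, (N <= n)%nat -> (/2)^n < eps.
Proof.
  intro He; destruct (pow_lt_1_zero (/2) ltac:(rewrite Rabs_right; lra) eps He) as [N HN].
  exists N; intros n Hn; specialize (HN n Hn).
  rewrite Rabs_right in HN; [exact HN|apply Rle_ge, pow_le; lra].
Qed.

Lemma Papprox_ext eta f g : (forall x, Cnorm x <= eta -> f x = g x) -> Papprox eta f -> Papprox eta g.
Proof.
  intros E H eps He; destruct (H eps He) as [l Hl]; exists l; intros; rewrite <- E; auto.
Qed.

Lemma Csum_geometric (z : C) n : ((C1 - z) * Csum n (fun k => z ^ k) = C1 - z ^ n)%C.
Proof.
  induction n as [|n IH]; simpl; [ring|].
  replace ((C1 - z) * (Csum n (fun k => z ^ k) + z ^ n))%C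
    with ((C1 - z) * Csum n (fun k => z ^ k) + (C1 - z) * z ^ n)%C by ring.
  rewrite IH; ring.
Qed.

(** Geometric series in 1 - f. After n terms the remainder is (1 - f)^n / f, at most 2 (1/2)^n
    because |f| >= 1/2; hence the choice of n for eps/4. *)
Lemma Papprox_inv_near_one eta f : Papprox eta f ->
  (forall x, Cnorm x <= eta -> Cnorm (C1 - f x) <= /2) ->
  Papprox eta (fun x => Cinv (f x)).
Proof.
  intros Hf Hn eps He.
  destruct (half_pow_small (eps/4) ltac:(lra)) as [n Hn'].
  specialize (Hn' n (Nat.le_refl _)).
  assert (HS : Papprox eta (fun x => Csum n (fun k => (C1 - f x) ^ k)%C)).
  { apply (Papprox_sum eta n (fun k x => (C1 - f x) ^ k)%C); intros k _.
    induction k as [|k IH]; simpl; [apply Pol1_Papprox, Pol1_const|].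
    apply Papprox_mul; [|exact IH].
    apply (Papprox_ext _ (fun x => C1 + (Copp C1) * f x)%C); [intros; ring|].
    apply Papprox_add; [apply Pol1_Papprox, Pol1_const|].
    apply Papprox_mul; [apply Pol1_Papprox, Pol1_const|exact Hf]. }
  destruct (HS (eps/2) ltac:(lra)) as [l Hl]; exists l; intros x Hx.
  specialize (Hl x Hx); specialize (Hn x Hx).
  set (S := Csum n _) in *.
  assert (Hfx : /2 <= Cnorm (f x)).
  { replace (f x) with (C1 - (C1 - f x))%C by ring.
    pose proof (Cnorm_sub_ge C1 (C1 - f x)) as H; rewrite Cnorm_1 in H; lra. }
  assert (Hfx0 : f x <> C0) by (apply Cnorm_neq0; lra).
  assert (HI : Cnorm (Cinv (f x) - S) <= eps/2).
  { assert (E := Csum_geometric (C1 - f x) n); fold S in E.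
    replace (C1 - (C1 - f x))%C with (f x) in E by ring.
    replace (Cinv (f x) - S)%C with (Cinv (f x) * (C1 - f x * S))%C by (field; exact Hfx0).
    rewrite E; replace (C1 - (C1 - (C1 - f x) ^ n))%C with ((C1 - f x) ^ n)%C by ring.
    rewrite Cnorm_mul, Cnorm_pow, Cnorm_inv by exact Hfx0.
    assert (/ Cnorm (f x) <= 2).
    { replace 2 with (/ / 2) by lra; apply Rinv_le_contravar; lra. }
    assert (0 < / Cnorm (f x)) by (apply Rinv_0_lt_compat; lra).
    assert (Cnorm (C1 - f x) ^ n <= (/2)^n) by (apply pow_incr; split; [apply Cnorm_ge0|exact Hn]).
    assert (0 <= Cnorm (C1 - f x) ^ n) by (apply pow_le, Cnorm_ge0).
    nra. }
  replace (Cinv (f x) - ceval l x)%C with ((Cinv (f x) - S) + (S - ceval l x))%C by ring.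
  eapply Rle_trans; [apply Cnorm_triang|]; lra.
Qed.

(** Division by [c] brings the values of f into the disc of radius 1/2 about 1, where the geometric
    series converges. *)
Lemma Papprox_inv eta f c : Papprox eta f -> c <> C0 ->
  (forall x, Cnorm x <= eta -> Cnorm (f x - c) <= Cnorm c / 2) ->
  Papprox eta (fun x => Cinv (f x)).
Proof.
  intros Hf Hc Hn.
  assert (Hcp := Cnorm_pos c Hc).
  assert (Hnz : forall x, Cnorm x <= eta -> f x <> C0).
  { intros x Hx; apply Cnorm_neq0; specialize (Hn x Hx).
    replace (f x) with (c - (c - f x))%C by ring.
    pose proof (Cnorm_sub_ge c (c - f x)); rewrite Cnorm_sub_sym in Hn; lra. }
  apply (Papprox_ext _ (fun x => Cinv c * Cinv (Cinv c * f x))%C).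
  { intros x Hx; field; split; [exact (Hnz x Hx)|exact Hc]. }
  apply Papprox_mul; [apply Pol1_Papprox, Pol1_const|].
  apply Papprox_inv_near_one.
  - apply Papprox_mul; [apply Pol1_Papprox, Pol1_const|exact Hf].
  - intros x Hx; replace (C1 - Cinv c * f x)%C with (Cinv c * (c - f x))%C by (field; exact Hc).
    rewrite Cnorm_mul, Cnorm_inv by exact Hc; specialize (Hn x Hx).
    rewrite Cnorm_sub_sym in Hn.
    apply Rmult_le_reg_l with (Cnorm c); [exact Hcp|].
    replace (Cnorm c * (/ Cnorm c * Cnorm (c - f x))) with (Cnorm (c - f x)) by (field; lra); lra.
Qed.

Lemma Papprox_mean eta f k : 0 <= eta -> Papprox eta f ->
  (forall x, Cnorm x = eta -> Cnorm (f x) <= k) -> Cnorm (f C0) <= k.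
Proof.
  intros Heta Hf Hk; apply Rnot_lt_le; intro Hlt.
  set (e := (Cnorm (f C0) - k) / 3); assert (0 < e) by (unfold e; lra).
  destruct (Hf e) as [l Hl]; [assumption|].
  (* N exceeds the degree of the approximating polynomial, so no exponent other than 0 is a multiple
     of N and the average over the N points is exactly the constant term. *)
  set (N := S (length l)).
  destruct (primitive_root N) as [w [Hw [HwN Hwk]]]; [lia|].
  assert (HN : 0 < INR N) by (apply lt_0_INR; lia).
  assert (E : Csum N (fun j => ceval l (RtoC eta * w ^ j)) = (RtoC (INR N) * ceval l C0)%C).
  { transitivity (Csum N (fun j => Csum (length l) (fun i => nth i l C0 * (RtoC eta * w ^ j) ^ i))%C).
    { apply Csum_ext; intros; apply ceval_sum. }
    rewrite Csum_swap.
    transitivity (Csum (length l) (fun i => (nth i l C0 * RtoC eta ^ i) * Csum N (fun j => (w ^ i) ^ j))%C).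
    { apply Csum_ext; intros i Hi; rewrite <- Csum_scal; apply Csum_ext; intros j Hj.
      rewrite Cpow_mul_base, <- !Cpow_mul, (Nat.mul_comm i j); ring. }
    destruct l as [|a l']; [simpl; ring|].
    rewrite (Csum_single _ O); [| simpl; lia |].
    - assert (Hc : forall n, Csum n (fun j => (w ^ 0) ^ j)%C = RtoC (INR n)).
      { induction n as [|n IH]; [reflexivity|].
        rewrite S_INR; cbn [Csum]; rewrite IH; simpl; rewrite Cpow_C1; Cext; ring. }
      rewrite Hc; simpl; ring.
    - intros i Hi Hi0; rewrite geometric_root_sum; [ring| |].
      + rewrite <- Cpow_mul, Nat.mul_comm, Cpow_mul, HwN; apply Cpow_C1.
      + apply Hwk; simpl in *; unfold N; simpl; lia. }
  assert (Hb : Cnorm (Csum N (fun j => ceval l (RtoC eta * w ^ j))) <= INR N * (k + e)).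
  { apply Csum_norm_le; intros j _.
    set (x := (RtoC eta * w ^ j)%C).
    assert (Hx : Cnorm x = eta).
    { unfold x; rewrite Cnorm_mul, Cnorm_pow, Hw, pow1, Cnorm_RtoC, Rabs_right; lra. }
    specialize (Hl x ltac:(lra)); specialize (Hk x Hx).
    replace (ceval l x) with (f x - (f x - ceval l x))%C by ring.
    eapply Rle_trans; [apply Cnorm_sub_le|]; lra. }
  rewrite E, Cnorm_mul, Cnorm_RtoC, Rabs_right in Hb by lra.
  apply Rmult_le_reg_l in Hb; [|exact HN].
  specialize (Hl C0 ltac:(rewrite Cnorm_0; lra)).
  assert (Cnorm (f C0) <= Cnorm (ceval l C0) + e).
  { replace (f C0) with (ceval l C0 + (f C0 - ceval l C0))%C by ring.
    eapply Rle_trans; [apply Cnorm_triang|]; lra. }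
  unfold e in *; lra.
Qed.

(** * Discrete residue calculus on a circle *)

Lemma sum_geometric2 (y b : C) (N : nat) :
  ((y - b) * Csum N (fun q => y ^ (N - 1 - q) * b ^ q) = y ^ N - b ^ N)%C.
Proof.
  assert (Hrec : forall n, Csum (S n) (fun q => y ^ (S n - 1 - q) * b ^ q)%C =
     (y * Csum n (fun q => y ^ (n - 1 - q) * b ^ q) + b ^ n)%C).
  { intro n; cbn [Csum]; rewrite <- Csum_scal.
    replace (S n - 1 - n)%nat with O by lia; simpl (y ^ 0)%C.
    f_equal; [|ring].
    apply Csum_ext; intros q Hq.
    replace (S n - 1 - q)%nat with (S (n - 1 - q)) by lia; simpl; ring. }
  induction N as [|n IH]; [simpl; ring|].
  rewrite Hrec.
  replace ((y - b) * (y * Csum n (fun q => y ^ (n - 1 - q) * b ^ q) + b ^ n))%C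
    with (y * ((y - b) * Csum n (fun q => y ^ (n - 1 - q) * b ^ q)) + (y - b) * b ^ n)%C by ring.
  rewrite IH; simpl; ring.
Qed.

(** A discrete Cauchy integral of y^(i+1) / (y - b). Writing 1/(y - b) as the geometric sum divided
    by y^N - b^N, where y^N = s^N at all N nodes, leaves powers of y; the average kills every
    exponent i + N - q except q = i. The resulting weight s^N / (s^N - b^N) tends to 1 for |b| < s
    and to 0 for |b| > s. *)
Lemma root_average_kernel (N i : nat) (w b : C) (s : R) :
  (i < N)%nat -> (w ^ N)%C = C1 -> (forall k, (0 < k < N)%nat -> (w ^ k)%C <> C1) ->
  (RtoC s ^ N)%C <> (b ^ N)%C ->
  Csum N (fun j => (RtoC s * w ^ j) ^ S i / (RtoC s * w ^ j - b))%C =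
  (RtoC (INR N) * (b ^ i * RtoC s ^ N / (RtoC s ^ N - b ^ N)))%C.
Proof.
  intros Hi HwN Hwk Hne.
  assert (HD : (RtoC s ^ N - b ^ N)%C <> C0) by (intro E; apply Hne, Csub_eq0, E).
  assert (HyN : forall j, ((RtoC s * w ^ j) ^ N = RtoC s ^ N)%C).
  { intro j; rewrite Cpow_mul_base, <- Cpow_mul, Nat.mul_comm, Cpow_mul, HwN, Cpow_C1; ring. }
  transitivity (Csum N (fun j => Csum N (fun q =>
     (b ^ q / (RtoC s ^ N - b ^ N)) * (RtoC s * w ^ j) ^ (i + N - q)))%C).
  { apply Csum_ext; intros j _; set (y := (RtoC s * w ^ j)%C).
    assert (Hyb : (y - b)%C <> C0).
    { intro E; apply HD; rewrite <- (HyN j); fold y; rewrite <- sum_geometric2, E; ring. }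
    transitivity (y ^ S i * Csum N (fun q => y ^ (N - 1 - q) * b ^ q) / (RtoC s ^ N - b ^ N))%C.
    { assert (HD' := HD); rewrite <- (HyN j) in HD' |- *; fold y in HD' |- *.
      rewrite <- sum_geometric2 in HD' |- *.
      field; split; [|exact Hyb].
      intro E; apply HD'; rewrite E; ring. }
    unfold Cdiv.
    transitivity (Csum N (fun k => Cinv (RtoC s ^ N - b ^ N) * (y ^ S i * (y ^ (N - 1 - k) * b ^ k))))%C;
      [rewrite !Csum_scal; ring|].
    apply Csum_ext; intros q Hq.
    replace (i + N - q)%nat with (S i + (N - 1 - q))%nat by lia; rewrite (Cpow_add y); ring. }
  rewrite Csum_swap, (Csum_single N i); [|exact Hi|].
  - rewrite Csum_scal; replace (i + N - i)%nat with N by lia.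
    rewrite (Csum_ext N _ (fun _ => RtoC s ^ N)%C) by (intros; apply HyN).
    assert (Hc : forall n, Csum n (fun _ => RtoC s ^ N)%C = (RtoC (INR n) * RtoC s ^ N)%C).
    { induction n as [|n IH]; [simpl; replace (RtoC 0) with C0 by reflexivity; ring|].
      rewrite S_INR; cbn [Csum]; rewrite IH.
      replace (RtoC (INR n + 1)) with (RtoC (INR n) + C1)%C by (Cext; ring); ring. }
    rewrite Hc; field; exact HD.
  - intros q Hq Hqi; rewrite Csum_scal.
    rewrite (Csum_ext N _ (fun j => RtoC s ^ (i + N - q) * (w ^ (i + N - q)) ^ j)%C).
    2:{ intros j _; rewrite Cpow_mul_base, <- !Cpow_mul, (Nat.mul_comm j); reflexivity. }
    rewrite Csum_scal, geometric_root_sum; [ring| |].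
    + rewrite <- Cpow_mul, Nat.mul_comm, Cpow_mul, HwN; apply Cpow_C1.
    + destruct (Nat.lt_ge_cases i q).
      * apply Hwk; lia.
      * replace (i + N - q)%nat with (N + (i - q))%nat by lia; rewrite Cpow_add, HwN.
        intro E; apply (Hwk (i - q)%nat); [lia|].
        transitivity (C1 * w ^ (i - q))%C; [ring|exact E].
Qed.

Lemma Csumlist_norm_le bs F k :
  (forall b, In b bs -> Cnorm (F b) <= k) -> Cnorm (Csumlist bs F) <= INR (length bs) * k.
Proof.
  induction bs as [|b bs IH]; intro H; [simpl; rewrite Cnorm_0; lra|].
  change (length (b :: bs)) with (S (length bs)); rewrite S_INR; simpl.
  eapply Rle_trans; [apply Cnorm_triang|].
  assert (Cnorm (F b) <= k) by (apply H; left; reflexivity).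
  assert (Cnorm (Csumlist bs F) <= INR (length bs) * k) by (apply IH; intros; apply H; right; assumption).
  lra.
Qed.

Lemma Csumlist_ext bs F G : (forall b, In b bs -> F b = G b) -> Csumlist bs F = Csumlist bs G.
Proof.
  induction bs as [|b bs IH]; intro H; simpl; [reflexivity|].
  rewrite H, IH; [reflexivity|intros; apply H; right; assumption|left; reflexivity].
Qed.

Lemma Csumlist_scal bs a F : Csumlist bs (fun b => a * F b)%C = (a * Csumlist bs F)%C.
Proof. induction bs as [|b bs IH]; simpl; [ring|rewrite IH; ring]. Qed.

Lemma Csum_Csumlist n bs (F : nat -> C -> C) :
  Csum n (fun j => Csumlist bs (F j)) = Csumlist bs (fun b => Csum n (fun j => F j b)).
Proof.
  induction bs as [|b bs IH]; simpl.
  - apply Csum_zero; reflexivity.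
  - rewrite Csum_add, IH; reflexivity.
Qed.

Lemma Cprod_root bs y : In y bs -> Cprod bs y = C0.
Proof.
  induction bs as [|b bs IH]; simpl; [contradiction|].
  intros [->|H]; [ring|rewrite IH by exact H; ring].
Qed.

Lemma Cprod_root_inv bs y : Cprod bs y = C0 -> In y bs.
Proof.
  induction bs as [|b bs IH]; simpl; intro H.
  - exfalso; exact (C1_neq_C0 H).
  - destruct (classic (y = b)) as [->|Hne]; [left; reflexivity|right].
    apply IH, NNPP; intro H2.
    apply (Cmul_neq0 (y - b) (Cprod bs y)); [intro E; apply Hne, Csub_eq0, E|exact H2|exact H].
Qed.

Lemma pow_lt_strict (a b : R) (n : nat) : 0 <= a < b -> (0 < n)%nat -> a ^ n < b ^ n.
Proof.
  intros Hab Hn; destruct n as [|n]; [lia|clear Hn].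
  induction n as [|n IH]; [simpl; lra|].
  change (a * a ^ S n < b * b ^ S n).
  assert (0 <= a ^ S n) by (apply pow_le; lra); nra.
Qed.

(** Discrete argument principle: the contour integral of m l'/l, which sums m over the enclosed
    zeros of l, becomes a sum over all zeros with the soft cutoff s^N / (s^N - b^N). The zero-free
    annulus keeps every root off the circle, so the denominators do not vanish. *)
Lemma poly_log_derivative_average (l m : list C) (N : nat) (s : R) (w : C) :
  (0 < N)%nat -> (length m <= N)%nat -> 0 < s ->
  Cnorm w = 1 -> (w ^ N)%C = C1 -> (forall k, (0 < k < N)%nat -> (w ^ k)%C <> C1) ->
  (forall y, s / 2 <= Cnorm y <= 2 * s -> ceval l y <> C0) ->
  exists bs, (length bs <= length l)%nat /\
   (forall y, In y bs <-> ceval l y = C0) /\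
   (forall b, In b bs -> (RtoC s ^ N)%C <> (b ^ N)%C) /\
   (Cinv (RtoC (INR N)) * Csum N (fun j => let y := (RtoC s * w ^ j)%C in
       (ceval m y * (y * ceval (cderiv l) y * Cinv (ceval l y))))
    = Csumlist bs (fun b => ceval m b * (RtoC s ^ N / (RtoC s ^ N - b ^ N))))%C.
Proof.
  intros HN Hm Hs Hw HwN Hwk Hl.
  assert (Hy : forall j, Cnorm (RtoC s * w ^ j) = s).
  { intro j; rewrite Cnorm_mul, Cnorm_pow, Hw, pow1, Cnorm_RtoC, Rabs_right; lra. }
  destruct (Factorization.poly_factor l (RtoC s * w ^ 0)%C) as (a & bs & Ha & Hlen & Hev & Hder).
  { apply Hl; rewrite Hy; lra. }
  assert (Hroot : forall y, In y bs <-> ceval l y = C0).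
  { intro y; rewrite Hev; split; intro H.
    - rewrite Cprod_root by exact H; ring.
    - apply Cprod_root_inv, NNPP; intro H2; exact (Cmul_neq0 _ _ Ha H2 H). }
  assert (Hb : forall b, In b bs -> (RtoC s ^ N)%C <> (b ^ N)%C).
  { intros b Hb E; apply (f_equal Cnorm) in E.
    rewrite !Cnorm_pow, Cnorm_RtoC, Rabs_right in E by lra.
    assert (Eb : Cnorm b = s).
    { pose proof (Cnorm_ge0 b).
      destruct (Rtotal_order (Cnorm b) s) as [H1|[H1|H1]]; [|exact H1|].
      - assert (Cnorm b ^ N < s ^ N) by (apply pow_lt_strict; [lra|lia]); lra.
      - assert (s ^ N < Cnorm b ^ N) by (apply pow_lt_strict; [lra|lia]); lra. }
    apply Hroot in Hb; apply (Hl b); [rewrite Eb; lra|exact Hb]. }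
  exists bs; split; [exact Hlen|]; split; [exact Hroot|]; split; [exact Hb|].
  assert (HNR : RtoC (INR N) <> C0).
  { apply RtoC_neq0, not_0_INR; lia. }
  transitivity (Cinv (RtoC (INR N)) * Csum N (fun j => Csumlist bs (fun b =>
      Csum (length m) (fun i => nth i m C0 * ((RtoC s * w ^ j) ^ S i / (RtoC s * w ^ j - b))))))%C.
  { f_equal; apply Csum_ext; intros j _; cbv zeta; set (y := (RtoC s * w ^ j)%C).
    assert (Hy0 : ceval l y <> C0) by (apply Hl; unfold y; rewrite Hy; lra).
    rewrite Hder by exact Hy0.
    transitivity (ceval m y * (y * Csumlist bs (fun b => Cinv (y - b))))%C; [field; exact Hy0|].
    rewrite <- Csumlist_scal, <- Csumlist_scal; apply Csumlist_ext; intros b Hbin.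
    rewrite ceval_sum, (Cmul_comm (Csum _ _)), <- Csum_scal; apply Csum_ext; intros i _.
    simpl; unfold Cdiv; ring. }
  rewrite Csum_Csumlist, <- Csumlist_scal; apply Csumlist_ext; intros b Hbin.
  rewrite Csum_swap, ceval_sum.
  transitivity (Cinv (RtoC (INR N)) * Csum (length m) (fun i => nth i m C0 *
       (RtoC (INR N) * (b ^ i * RtoC s ^ N / (RtoC s ^ N - b ^ N)))))%C.
  { f_equal; apply Csum_ext; intros i Hi; rewrite Csum_scal; f_equal.
    apply root_average_kernel; auto; lia. }
  assert (HD : (RtoC s ^ N - b ^ N)%C <> C0) by (intro E; apply (Hb b Hbin), Csub_eq0, E).
  rewrite <- Csum_scal, (Cmul_comm (Csum _ _)), <- Csum_scal; apply Csum_ext; intros i _.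
  field; split; assumption.
Qed.

(** The list is ordered by powers of y, with coefficients depending on x, because the fibre over
    each fixed x is factored separately. *)
Definition beval (p : list (C -> C)) (x y : C) : C := ceval (map (fun a => a x) p) y.

Lemma Pol1_beval p y : Forall Pol1 p -> Pol1 (fun x => beval p x y).
Proof.
  induction 1 as [|a p Ha _ IH]; unfold beval; simpl; [apply Pol1_const|].
  apply Pol1_add; [exact Ha|]; apply Pol1_mul; [apply Pol1_const|exact IH].
Qed.

Lemma Pol1_bderiv p y : Forall Pol1 p -> Pol1 (fun x => ceval (cderiv (map (fun a => a x) p)) y).
Proof.
  intro H.
  assert (E : forall q n, Forall Pol1 q ->
    Pol1 (fun x => ceval (cderiv_from n (map (fun a => a x) q)) y)).
  { induction q as [|a q IH]; intros n Hq; simpl; [apply Pol1_const|].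
    inversion Hq; subst.
    apply Pol1_add; [apply Pol1_mul; [apply Pol1_const|assumption]|].
    apply Pol1_mul; [apply Pol1_const|apply IH; assumption]. }
  destruct p as [|a p]; unfold cderiv; simpl; [apply Pol1_const|].
  inversion H; subst; apply E; assumption.
Qed.

Lemma coeffs_bounded g eta : Forall Pol1 g ->
  exists G, 0 <= G /\ forall x i, Cnorm x <= eta -> Cnorm (nth i (map (fun a => a x) g) C0) <= G.
Proof.
  induction 1 as [|a g Ha _ [G [HG IH]]].
  - exists 0; split; [lra|]; intros x [|i] _; simpl; rewrite Cnorm_0; lra.
  - destruct (Pol1_bounded a eta Ha) as [M [HM HB]].
    exists (M + G); split; [lra|]; intros x [|i] Hx; simpl.
    + specialize (HB x Hx); lra.
    + specialize (IH x i Hx); lra.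
Qed.

Lemma inside_weight N (s : R) (b : C) : (0 < N)%nat -> 0 < s -> Cnorm b <= s / 2 ->
  Cnorm (RtoC s ^ N / (RtoC s ^ N - b ^ N)) <= 2.
Proof.
  intros HN Hs Hb.
  assert (Hp : 0 < s ^ N) by (apply pow_lt; lra).
  assert (H1 : Cnorm (b ^ N) <= s ^ N / 2).
  { rewrite Cnorm_pow; destruct N as [|n]; [lia|].
    apply Rle_trans with ((s / 2) ^ S n).
    - apply pow_incr; split; [apply Cnorm_ge0|exact Hb].
    - unfold Rdiv; rewrite Rpow_mult_distr; apply Rmult_le_compat_l; [lra|].
      simpl; assert ((/2) ^ n <= 1) by (rewrite <- (pow1 n); apply pow_incr; lra); lra. }
  assert (H2 : s ^ N / 2 <= Cnorm (RtoC s ^ N - b ^ N)).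
  { pose proof (Cnorm_sub_ge (RtoC s ^ N) (b ^ N)) as H.
    rewrite Cnorm_pow, Cnorm_RtoC, Rabs_right in H by lra; lra. }
  rewrite Cnorm_div by (apply Cnorm_neq0; lra).
  rewrite Cnorm_pow, Cnorm_RtoC, Rabs_right by lra.
  apply Rmult_le_reg_r with (Cnorm (RtoC s ^ N - b ^ N)); [lra|].
  unfold Rdiv; rewrite Rmult_assoc, Rinv_l by lra; lra.
Qed.

(** Outer roots may run off to infinity as x varies, where a leading coefficient vanishes. The
    weight is therefore estimated together with the power b^i of the summed function: i < N makes
    the bound uniform in b. *)
Lemma outside_weight N i (s : R) (b : C) : (i < N)%nat -> 0 < s -> 2 * s <= Cnorm b ->
  Cnorm (b ^ i * (RtoC s ^ N / (RtoC s ^ N - b ^ N))) <= 2 * (2 * s) ^ i * (/2) ^ N.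
Proof.
  intros HN Hs Hb.
  assert (Hp : 0 < s ^ N) by (apply pow_lt; lra).
  set (B := Cnorm b) in *.
  assert (HBp : 0 < B ^ N) by (apply pow_lt; lra).
  assert (H2N : (2 * s) ^ N <= B ^ N) by (apply pow_incr; lra).
  assert (H1 : 2 * s ^ N <= B ^ N).
  { eapply Rle_trans; [|exact H2N]; rewrite Rpow_mult_distr.
    apply Rmult_le_compat_r; [lra|]; destruct N as [|n]; [lia|]; simpl.
    assert (1 <= 2 ^ n) by (apply pow_R1_Rle; lra); lra. }
  assert (H2 : B ^ N / 2 <= Cnorm (RtoC s ^ N - b ^ N)).
  { rewrite Cnorm_sub_sym; pose proof (Cnorm_sub_ge (b ^ N) (RtoC s ^ N)) as H.
    rewrite !Cnorm_pow, Cnorm_RtoC, Rabs_right in H by lra; fold B in H; lra. }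
  rewrite Cnorm_mul, Cnorm_div by (apply Cnorm_neq0; lra).
  rewrite !Cnorm_pow, Cnorm_RtoC, Rabs_right by lra; fold B.
  apply Rle_trans with (B ^ i * (s ^ N / (B ^ N / 2))).
  { apply Rmult_le_compat_l; [apply pow_le; lra|].
    unfold Rdiv at 1 2; apply Rmult_le_compat_l; [lra|].
    apply Rinv_le_contravar; lra. }
  replace N with (i + (N - i))%nat by lia; set (k := (N - i)%nat).
  rewrite !pow_add.
  assert (Hk : (2 * s) ^ k <= B ^ k) by (apply pow_incr; lra).
  rewrite !Rpow_mult_distr in *; rewrite !pow_inv.
  assert (0 < s ^ i) by (apply pow_lt; lra). assert (0 < s ^ k) by (apply pow_lt; lra).
  assert (0 < 2 ^ i) by (apply pow_lt; lra). assert (0 < 2 ^ k) by (apply pow_lt; lra).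
  assert (0 < B ^ i) by (apply pow_lt; lra). assert (0 < B ^ k) by (apply pow_lt; lra).
  replace (B ^ i * (s ^ i * s ^ k / (B ^ i * B ^ k / 2))) with (2 * s ^ i * (s ^ k / B ^ k)) by (field; lra).
  replace (2 * (2 ^ i * s ^ i) * (/ 2 ^ i * / 2 ^ k)) with (2 * s ^ i * / 2 ^ k) by (field; lra).
  apply Rmult_le_compat_l; [nra|].
  apply Rmult_le_reg_r with (B ^ k); [assumption|].
  replace (s ^ k / B ^ k * B ^ k) with (s ^ k) by (field; lra).
  apply Rmult_le_reg_l with (2 ^ k); [assumption|].
  replace (2 ^ k * (/ 2 ^ k * B ^ k)) with (B ^ k) by (field; lra); exact Hk.
Qed.

(* A root of [p] at the centre of the disc controls [g] there by the roots over
   the boundary circle: the weighted sum of [g] over the fibre is holomorphic. *)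
Lemma fibre_bound (p g : list (C -> C)) (eta s k : R) :
  0 < eta -> 0 < s -> Forall Pol1 p -> Forall Pol1 g ->
  (forall x y, Cnorm x <= eta -> s / 2 <= Cnorm y <= 2 * s ->
     beval p C0 y <> C0 /\ Cnorm (beval p x y - beval p C0 y) <= Cnorm (beval p C0 y) / 2) ->
  beval p C0 C0 = C0 ->
  (forall y, Cnorm y <= s -> beval p C0 y = C0 -> y = C0) ->
  0 <= k ->
  (forall x y, Cnorm x = eta -> Cnorm y <= s -> beval p x y = C0 -> Cnorm (beval g x y) <= k) ->
  Cnorm (beval g C0 C0) <= 2 * INR (length p) * k.
Proof.
  intros Heta Hs Hp Hg Hann H00 Honly Hk Hbd.
  destruct (coeffs_bounded g eta Hg) as [G [HG HGb]].
  set (n := length g); set (d := length p).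
  (* [K * (/2)^N] will bound the contribution of a single root outside the circle. *)
  set (K := INR n * (G * (2 * (1 + 2 * s) ^ n))).
  assert (HK : 0 <= K).
  { unfold K; apply Rmult_le_pos; [apply pos_INR|]; apply Rmult_le_pos; [exact HG|].
    assert (0 <= (1 + 2 * s) ^ n) by (apply pow_le; lra); lra. }
  assert (Hd : 0 <= INR d) by apply pos_INR.
  apply Rnot_lt_le; intro Hlt.
  set (D := Cnorm (beval g C0 C0) - 2 * INR d * k) in *.
  assert (HD : 0 < D) by (unfold D; lra).
  (* N is so large that the outer roots, counted once over the centre and once over the boundary,
     cost less than the gap [D]. Adding n to it exceeds the y-degree of g. *)
  destruct (half_pow_small (D / (2 * (INR d * K + 1)))) as [N0 HN0].
  { apply Rdiv_lt_0_compat; [exact HD|nra]. }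
  set (N := S (N0 + n)).
  specialize (HN0 N ltac:(unfold N; lia)).
  assert (Hsmall : 2 * (INR d * (K * (/2) ^ N)) < D).
  { apply Rmult_lt_compat_r with (r := 2 * (INR d * K + 1)) in HN0; [|nra].
    replace (D / (2 * (INR d * K + 1)) * (2 * (INR d * K + 1))) with D in HN0 by (field; nra).
    assert (0 < (/2)^N) by (apply pow_lt; lra); nra. }
  destruct (primitive_root N) as [w [Hw [HwN Hwk]]]; [unfold N; lia|].
  assert (Hnz : forall x y, Cnorm x <= eta -> s / 2 <= Cnorm y <= 2 * s -> beval p x y <> C0).
  { intros x y Hx Hy; destruct (Hann x y Hx Hy) as [H1 H2].
    intro E; rewrite E in H2; pose proof (Cnorm_pos _ H1).
    replace (C0 - beval p C0 y)%C with (- beval p C0 y)%C in H2 by ring.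
    rewrite Cnorm_opp in H2; lra. }
  (* The trace of g along the fibre over x, as a contour average. It is a uniform limit of
     polynomials in x because p(x, y) stays within half of p(0, y) at every node, which makes 1/p
     approximable. *)
  set (T := fun x => (Cinv (RtoC (INR N)) * Csum N (fun j => let y := (RtoC s * w ^ j)%C in
       (beval g x y * (y * ceval (cderiv (map (fun a => a x) p)) y * Cinv (beval p x y)))))%C).
  assert (HyN : forall j, Cnorm (RtoC s * w ^ j) = s).
  { intro j; rewrite Cnorm_mul, Cnorm_pow, Hw, pow1, Cnorm_RtoC, Rabs_right; lra. }
  assert (HT : Papprox eta T).
  { unfold T; apply Papprox_mul; [apply Pol1_Papprox, Pol1_const|].
    apply (Papprox_sum eta N (fun j x => let y := (RtoC s * w ^ j)%C in
       (beval g x y * (y * ceval (cderiv (map (fun a => a x) p)) y * Cinv (beval p x y)))%C)).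
    intros j _; cbv zeta.
    apply Papprox_mul; [apply Pol1_Papprox, Pol1_beval, Hg|].
    apply Papprox_mul; [apply Papprox_mul;
        [apply Pol1_Papprox, Pol1_const|apply Pol1_Papprox, Pol1_bderiv, Hp]|].
    apply Papprox_inv with (c := beval p C0 (RtoC s * w ^ j)).
    - apply Pol1_Papprox, Pol1_beval, Hp.
    - apply (Hann C0); [rewrite Cnorm_0|rewrite HyN]; lra.
    - intros x Hx; apply (Hann x); [exact Hx|rewrite HyN; lra]. }
  assert (Hrep : forall x, Cnorm x <= eta -> exists bs, (length bs <= d)%nat /\
    (forall y, In y bs <-> beval p x y = C0) /\
    T x = Csumlist bs (fun b => beval g x b * (RtoC s ^ N / (RtoC s ^ N - b ^ N)))%C).
  { intros x Hx.
    destruct (poly_log_derivative_average (map (fun a => a x) p) (map (fun a => a x) g) N s w)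
      as (bs & Hlen & Hroots & _ & E); auto.
    - unfold N; lia.
    - rewrite length_map; unfold N, n; lia.
    - intros y Hy; exact (Hnz x y Hx Hy).
    - exists bs; rewrite length_map in Hlen; auto. }
  assert (Hout : forall x b, Cnorm x <= eta -> 2 * s <= Cnorm b ->
    Cnorm (beval g x b * (RtoC s ^ N / (RtoC s ^ N - b ^ N))) <= K * (/2) ^ N).
  { intros x b Hx Hb; unfold beval at 1; rewrite ceval_sum, Cmul_comm, <- Csum_scal.
    rewrite length_map; fold n; unfold K; rewrite Rmult_assoc.
    apply Csum_norm_le; intros i Hi.
    replace (RtoC s ^ N / (RtoC s ^ N - b ^ N) * (nth i (map (fun a => a x) g) C0 * b ^ i))%C
      with (nth i (map (fun a => a x) g) C0 * (b ^ i * (RtoC s ^ N / (RtoC s ^ N - b ^ N))))%C by ring.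
    rewrite Rmult_assoc; apply Cnorm_mul_le; [apply HGb, Hx|].
    eapply Rle_trans; [apply outside_weight; [unfold N; lia|lra|lra]|].
    apply Rmult_le_compat_r; [apply pow_le; lra|].
    apply Rmult_le_compat_l; [lra|].
    apply Rle_trans with ((1 + 2 * s) ^ i); [apply pow_incr; lra|].
    apply Rle_pow; [lra|lia]. }
  assert (Hdich : forall x b, Cnorm x <= eta -> beval p x b = C0 -> Cnorm b <= s / 2 \/ 2 * s <= Cnorm b).
  { intros x b Hx Hb.
    destruct (Rle_dec (Cnorm b) (s/2)) as [H1|H1]; [left; exact H1|right].
    apply Rnot_lt_le; intro H2; apply (Hnz x b Hx); [lra|exact Hb]. }
  assert (HwN0 : 0 < (/2) ^ N) by (apply pow_lt; lra).
  (* Maximum principle for the trace: over |x| = eta an inner root contributes at most 2k, the 2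
     coming from [inside_weight], and an outer root almost nothing. *)
  assert (HTc : Cnorm (T C0) <= INR d * (2 * k + K * (/2)^N)).
  { apply (Papprox_mean eta); [lra|exact HT|]; intros x Hx.
    destruct (Hrep x ltac:(lra)) as (bs & Hlen & Hroots & ->).
    apply Rle_trans with (INR (length bs) * (2 * k + K * (/2)^N)).
    2:{ apply Rmult_le_compat_r; [nra|apply le_INR, Hlen]. }
    apply Csumlist_norm_le; intros b Hb; apply Hroots in Hb.
    destruct (Hdich x b ltac:(lra) Hb) as [H1|H1].
    - assert (Cnorm (beval g x b * (RtoC s ^ N / (RtoC s ^ N - b ^ N))) <= k * 2).
      { apply Cnorm_mul_le; [apply Hbd; [exact Hx|lra|exact Hb]|].
        apply inside_weight; [unfold N; lia|lra|lra]. }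
      nra.
    - pose proof (Hout x b ltac:(lra) H1); nra. }
  assert (H0 : Cnorm C0 <= eta) by (rewrite Cnorm_0; lra).
  destruct (Hrep C0 H0) as (bs & Hlen & Hroots & ET).
  (* Over the centre the inner roots are all [C0], each with weight exactly 1. So the trace there is
     m times g(0, 0) up to the outer error, where m >= 1 is the multiplicity. The induction runs
     over an arbitrary list of roots. *)
  assert (Hlow : forall L, (forall b, In b L -> beval p C0 b = C0) ->
    exists m, Cnorm (Csumlist L (fun b => beval g C0 b * (RtoC s ^ N / (RtoC s ^ N - b ^ N)))%C
                     - RtoC (INR m) * beval g C0 C0) <= INR (length L) * (K * (/2) ^ N) /\
              (In C0 L -> (1 <= m)%nat)).
  { induction L as [|b L IH]; intro HL.
    - exists O; split; [|contradiction]; simpl.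
      replace (C0 - RtoC 0 * beval g C0 C0)%C with C0 by (Cext; ring); rewrite Cnorm_0; lra.
    - destruct IH as [m [Hm1 Hm2]]; [intros; apply HL; right; assumption|].
      assert (Hb : beval p C0 b = C0) by (apply HL; left; reflexivity).
      change (length (b :: L)) with (S (length L)); rewrite (S_INR (length L)).
      destruct (Hdich C0 b H0 Hb) as [H1|H1].
      + assert (Eb : b = C0) by (apply Honly; [lra|exact Hb]).
        exists (S m); split; [|intro; lia]; subst b; rewrite S_INR; cbn [Csumlist].
        set (Sg := Csumlist L _) in *.
        assert (E1 : (RtoC s ^ N / (RtoC s ^ N - C0 ^ N) = C1)%C).
        { unfold N; simpl (C0 ^ _)%C.
          assert ((RtoC s ^ S (N0 + n))%C <> C0) by (apply Cpow_neq0, RtoC_neq0; lra).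
          field; intro E; apply H; rewrite <- E; simpl; ring. }
        rewrite E1.
        replace (beval g C0 C0 * C1 + Sg - RtoC (INR m + 1) * beval g C0 C0)%C
          with (Sg - RtoC (INR m) * beval g C0 C0)%C by (Cext; ring).
        nra.
      + exists m; split.
        * cbn [Csumlist]; set (Sg := Csumlist L _) in *.
          pose proof (Hout C0 b H0 H1).
          set (u := (beval g C0 b * _)%C) in *.
          replace (u + Sg - RtoC (INR m) * beval g C0 C0)%C
            with (u + (Sg - RtoC (INR m) * beval g C0 C0))%C by ring.
          eapply Rle_trans; [apply Cnorm_triang|]; lra.
        * intros [E|Hin]; [|auto].
          subst b; rewrite Cnorm_0 in H1; lra. }
  destruct (Hlow bs) as [m [Hm1 Hm2]]; [intros b Hb; apply Hroots, Hb|].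
  rewrite <- ET in Hm1.
  assert (Hm : 1 <= INR m) by (change 1 with (INR 1); apply le_INR, Hm2, Hroots, H00).
  assert (Hup : Cnorm (RtoC (INR m) * beval g C0 C0) <= INR d * (2 * k + K * (/2)^N) + INR d * (K * (/2)^N)).
  { replace (RtoC (INR m) * beval g C0 C0)%C
      with (T C0 - (T C0 - RtoC (INR m) * beval g C0 C0))%C by ring.
    eapply Rle_trans; [apply Cnorm_sub_le|].
    assert (INR (length bs) * (K * (/2) ^ N) <= INR d * (K * (/2)^N))
      by (apply Rmult_le_compat_r; [nra|apply le_INR, Hlen]).
    lra. }
  rewrite Cnorm_mul, Cnorm_RtoC, Rabs_right in Hup by lra.
  pose proof (Cnorm_ge0 (beval g C0 C0)).
  assert (Cnorm (beval g C0 C0) <= INR m * Cnorm (beval g C0 C0)) by nra.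
  unfold D in *; lra.
Qed.

(** * Sequential compactness *)

Definition seqcv {U} (d : U -> U -> R) (u : nat -> U) (a : U) : Prop :=
  forall eps, 0 < eps -> exists N, forall n, (N <= n)%nat -> d a (u n) < eps.
Definition incr_seq (phi : nat -> nat) : Prop := forall n, (phi n < phi (S n))%nat.
Definition seqcompact {U} (d : U -> U -> R) (A : U -> Prop) : Prop :=
  forall u : nat -> U, (forall n, A (u n)) ->
  exists phi a, incr_seq phi /\ A a /\ seqcv d (fun n => u (phi n)) a.

Lemma incr_seq_lt phi n m : incr_seq phi -> (n < m)%nat -> (phi n < phi m)%nat.
Proof. intros H Hnm; induction Hnm; [apply H|specialize (H m); lia]. Qed.

Lemma incr_seq_ge phi n : incr_seq phi -> (n <= phi n)%nat.
Proof. intro H; induction n as [|n IH]; [lia|specialize (H n); lia]. Qed.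

Lemma seqcv_sub {U} (d : U -> U -> R) u a phi :
  incr_seq phi -> seqcv d u a -> seqcv d (fun n => u (phi n)) a.
Proof.
  intros Hp Hu eps He; destruct (Hu eps He) as [N HN]; exists N; intros n Hn.
  apply HN; pose proof (incr_seq_ge phi n Hp); lia.
Qed.

Lemma inv_INR_small eps : 0 < eps -> exists N, forall n, (N <= n)%nat -> / INR (S n) < eps.
Proof.
  intro He; destruct (archimed_cor1 eps He) as [N [HN HN0]]; exists N; intros n Hn.
  eapply Rle_lt_trans; [|exact HN].
  apply Rinv_le_contravar; [apply lt_0_INR; lia|apply le_INR; lia].
Qed.

Lemma bolzano_weierstrass_R (u : nat -> R) (B : R) : (forall n, Rabs (u n) <= B) ->
  exists phi l, incr_seq phi /\ Rabs l <= B /\ seqcv Rdist (fun n => u (phi n)) l.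
Proof.
  intro HB.
  destruct (Bolzano_Weierstrass u (fun c => - B <= c <= B)) as [l Hl].
  { apply compact_P3. }
  { intro n; specialize (HB n); pose proof (Rle_abs (u n)); pose proof (Rle_abs (- u n)); rewrite Rabs_Ropp in *; lra. }
  assert (Hch : forall n N, exists q, (N < q)%nat /\ Rabs (u q - l) < / INR (S n)).
  { intros n N.
    destruct (Hl (disc l (mkposreal (/ INR (S n)) (Rinv_0_lt_compat _ (lt_0_INR _ (Nat.lt_0_succ n))))) (S N))
      as [q [Hq1 Hq2]].
    { exists (mkposreal _ (Rinv_0_lt_compat _ (lt_0_INR _ (Nat.lt_0_succ n)))); intros x Hx; exact Hx. }
    exists q; split; [lia|exact Hq2]. }
  set (next := fun n N => proj1_sig (constructive_indefinite_description _ (Hch n N))).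
  assert (Hnext : forall n N, (N < next n N)%nat /\ Rabs (u (next n N) - l) < / INR (S n)).
  { intros n N; unfold next; destruct constructive_indefinite_description; assumption. }
  set (phi := fix phi n := match n with O => next O O | S k => next (S k) (phi k) end).
  assert (Hphi : forall n, Rabs (u (phi n) - l) < / INR (S n)).
  { intros [|n]; apply Hnext. }
  exists phi, l; split; [|split].
  - intro n; simpl; apply Hnext.
  - apply Rnot_lt_le; intro Hlt.
    destruct (inv_INR_small (Rabs l - B)) as [N HN]; [lra|].
    specialize (HN N (Nat.le_refl _)); specialize (Hphi N); specialize (HB (phi N)).
    pose proof (Rabs_triang_inv l (u (phi N))); rewrite (Rabs_minus_sym l) in H; lra.
  - intros eps He; destruct (inv_INR_small eps He) as [N HN]; exists N; intros n Hn.
    unfold Rdist; rewrite Rabs_minus_sym; eapply Rlt_trans; [apply Hphi|apply HN, Hn].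
Qed.

Lemma Cnorm_le_of_parts z a b : Rabs (Re z) < a -> Rabs (Im z) < b -> Cnorm z < a + b.
Proof. intros; pose proof (Cnorm_le_parts z); lra. Qed.

Lemma bolzano_weierstrass_C (u : nat -> C) (B : R) : (forall n, Cnorm (u n) <= B) ->
  exists phi l, incr_seq phi /\ seqcv Cdist (fun n => u (phi n)) l.
Proof.
  intro HB.
  destruct (bolzano_weierstrass_R (fun n => Re (u n)) B) as (phi & a & Hphi & _ & Ha).
  { intro n; eapply Rle_trans; [apply Re_le_Cnorm|apply HB]. }
  destruct (bolzano_weierstrass_R (fun n => Im (u (phi n))) B) as (psi & b & Hpsi & _ & Hb).
  { intro n; eapply Rle_trans; [apply Im_le_Cnorm|apply HB]. }
  exists (fun n => phi (psi n)), (mkC a b); split.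
  - intro n; apply incr_seq_lt; [exact Hphi|apply Hpsi].
  - intros eps He.
    apply (seqcv_sub _ _ _ psi Hpsi) in Ha.
    destruct (Ha (eps/2) ltac:(lra)) as [N HN]; destruct (Hb (eps/2) ltac:(lra)) as [M HM].
    exists (max N M); intros n Hn; unfold Cdist.
    specialize (HN n ltac:(lia)); specialize (HM n ltac:(lia)); unfold Rdist in *.
    replace eps with (eps/2 + eps/2) by lra; apply Cnorm_le_of_parts; simpl; assumption.
Qed.

Lemma continuous_seq {U V} (dU : U -> U -> R) (dV : V -> V -> R) A f u a :
  continuous_on dU dV A f -> A a -> (forall n, A (u n)) -> seqcv dU u a ->
  seqcv dV (fun n => f (u n)) (f a).
Proof.
  intros Hf Ha Hu Hc eps He; destruct (Hf a Ha eps He) as [de [Hde H]].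
  destruct (Hc de Hde) as [N HN]; exists N; intros n Hn; apply H; auto.
Qed.

Lemma seqcompact_max {U} (dU : U -> U -> R) A (F : U -> R) (a0 : U) :
  seqcompact dU A -> A a0 -> continuous_on dU Rdist A F ->
  exists a, A a /\ forall b, A b -> F b <= F a.
Proof.
  intros Hc Ha0 HF.
  assert (Hbd : exists M, forall b, A b -> F b <= M).
  { apply NNPP; intro Hn.
    assert (Hch : forall n, exists b, A b /\ INR n < F b).
    { intro n; apply NNPP; intro H; apply Hn; exists (INR n); intros b Hb.
      apply Rnot_lt_le; intro Hlt; apply H; exists b; auto. }
    set (u := fun n => proj1_sig (constructive_indefinite_description _ (Hch n))).
    assert (Hu : forall n, A (u n) /\ INR n < F (u n)).
    { intro n; unfold u; destruct constructive_indefinite_description; assumption. }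
    destruct (Hc u (fun n => proj1 (Hu n))) as (phi & a & Hphi & Ha & Hcv).
    pose proof (continuous_seq _ _ _ _ _ _ HF Ha (fun n => proj1 (Hu (phi n))) Hcv) as H.
    destruct (H 1 Rlt_0_1) as [N HN].
    destruct (INR_unbounded (F a + 1)) as [M HM].
    set (n := max N M).
    specialize (HN n ltac:(unfold n; lia)); unfold Rdist in HN.
    destruct (Hu (phi n)) as [_ Hbig].
    assert (INR M <= INR (phi n)).
    { apply le_INR; pose proof (incr_seq_ge phi n Hphi); unfold n in *; lia. }
    apply Rabs_def2 in HN; lra. }
  destruct (completeness (fun y => exists b, A b /\ y = F b)) as [m [Hub Hlub]].
  { destruct Hbd as [M HM]; exists M; intros y [b [Hb ->]]; auto. }
  { exists (F a0), a0; auto. }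
  assert (Hch : forall n, exists b, A b /\ m - / INR (S n) < F b).
  { intro n; apply NNPP; intro H.
    assert (0 < / INR (S n)) by (apply Rinv_0_lt_compat, lt_0_INR; lia).
    assert (m <= m - / INR (S n)); [|lra].
    apply Hlub; intros y [b [Hb ->]]; apply Rnot_lt_le; intro Hlt; apply H; exists b; auto. }
  set (u := fun n => proj1_sig (constructive_indefinite_description _ (Hch n))).
  assert (Hu : forall n, A (u n) /\ m - / INR (S n) < F (u n)).
  { intro n; unfold u; destruct constructive_indefinite_description; assumption. }
  destruct (Hc u (fun n => proj1 (Hu n))) as (phi & a & Hphi & Ha & Hcv).
  pose proof (continuous_seq _ _ _ _ _ _ HF Ha (fun n => proj1 (Hu (phi n))) Hcv) as H.
  exists a; split; [exact Ha|].
  assert (m <= F a).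
  { apply Rnot_lt_le; intro Hlt.
    destruct (H ((m - F a)/2) ltac:(lra)) as [N HN].
    destruct (inv_INR_small ((m - F a)/2) ltac:(lra)) as [M HM].
    set (n := max N M).
    specialize (HN n ltac:(unfold n; lia)); unfold Rdist in HN.
    assert (HM' : / INR (S (phi n)) < (m - F a)/2).
    { apply HM; pose proof (incr_seq_ge phi n Hphi); unfold n in *; lia. }
    destruct (Hu (phi n)) as [_ Hbig]; apply Rabs_def2 in HN; lra. }
  intros b Hb; apply Rle_trans with m; [apply Hub; exists b; auto|assumption].
Qed.

Section Continuity.
Context {U : Type} (dU : U -> U -> R) (A : U -> Prop).
Let cont (f : U -> C) := continuous_on dU Cdist A f.

Lemma cont_const c : cont (fun _ => c).
Proof.
  intros x _ eps He; exists 1; split; [lra|]; intros; unfold Cdist.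
  replace (c - c)%C with C0 by ring; rewrite Cnorm_0; lra.
Qed.

Lemma cont_add f g : cont f -> cont g -> cont (fun x => f x + g x)%C.
Proof.
  intros Hf Hg x Hx eps He.
  destruct (Hf x Hx (eps/2) ltac:(lra)) as [d1 [H1 H1']].
  destruct (Hg x Hx (eps/2) ltac:(lra)) as [d2 [H2 H2']].
  exists (Rmin d1 d2); split; [apply Rmin_glb_lt; assumption|]; intros y Hy Hd.
  specialize (H1' y Hy (Rlt_le_trans _ _ _ Hd (Rmin_l _ _))).
  specialize (H2' y Hy (Rlt_le_trans _ _ _ Hd (Rmin_r _ _))); unfold Cdist in *.
  replace (f x + g x - (f y + g y))%C with ((f x - f y) + (g x - g y))%C by ring.
  eapply Rle_lt_trans; [apply Cnorm_triang|]; lra.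
Qed.

Lemma cont_mul f g : cont f -> cont g -> cont (fun x => f x * g x)%C.
Proof.
  intros Hf Hg x Hx eps He.
  pose proof (Cnorm_ge0 (f x)); pose proof (Cnorm_ge0 (g x)).
  set (e1 := eps / (2 * (Cnorm (g x) + 1))).
  set (e2 := Rmin 1 (eps / (2 * (Cnorm (f x) + 1 + eps)))).
  assert (He1 : 0 < e1) by (apply Rdiv_lt_0_compat; lra).
  destruct (Hf x Hx (Rmin e1 eps)) as [d1 [H1 H1']]; [apply Rmin_glb_lt; lra|].
  destruct (Hg x Hx e2) as [d2 [H2 H2']].
  { apply Rmin_glb_lt; [lra|apply Rdiv_lt_0_compat; lra]. }
  exists (Rmin d1 d2); split; [apply Rmin_glb_lt; assumption|]; intros y Hy Hd.
  specialize (H1' y Hy (Rlt_le_trans _ _ _ Hd (Rmin_l _ _))).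
  specialize (H2' y Hy (Rlt_le_trans _ _ _ Hd (Rmin_r _ _))); unfold Cdist in *.
  replace (f x * g x - f y * g y)%C with ((f x - f y) * g x + f y * (g x - g y))%C by ring.
  eapply Rle_lt_trans; [apply Cnorm_triang|].
  pose proof (Rmin_l e1 eps); pose proof (Rmin_r e1 eps).
  pose proof (Rmin_r 1 (eps / (2 * (Cnorm (f x) + 1 + eps)))); fold e2 in H5.
  assert (Cnorm (f y) <= Cnorm (f x) + eps).
  { replace (f y) with (f x - (f x - f y))%C by ring.
    eapply Rle_trans; [apply Cnorm_sub_le|]; lra. }
  rewrite !Cnorm_mul.
  assert (Cnorm (f x - f y) * Cnorm (g x) <= e1 * (Cnorm (g x) + 1)).
  { apply Rmult_le_compat; try apply Cnorm_ge0; lra. }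
  assert (Cnorm (f y) * Cnorm (g x - g y)
     < (Cnorm (f x) + 1 + eps) * (eps / (2 * (Cnorm (f x) + 1 + eps)))).
  { apply Rmult_le_0_lt_compat; try apply Cnorm_ge0; lra. }
  replace (e1 * (Cnorm (g x) + 1)) with (eps/2) in * by (unfold e1; field; lra).
  replace ((Cnorm (f x) + 1 + eps) * (eps / (2 * (Cnorm (f x) + 1 + eps)))) with (eps/2) in *
    by (field; lra).
  lra.
Qed.

Lemma cont_ext f g : (forall x, A x -> f x = g x) -> cont f -> cont g.
Proof.
  intros E Hf x Hx eps He; destruct (Hf x Hx eps He) as [d [Hd H]]; exists d; split; [exact Hd|].
  intros y Hy Hxy; rewrite <- !E by assumption; auto.
Qed.

Lemma cont_ceval l f : cont f -> cont (fun x => ceval l (f x)).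
Proof.
  intro Hf; induction l as [|a l IH]; simpl; [apply cont_const|].
  apply cont_add; [apply cont_const|apply cont_mul; assumption].
Qed.

Lemma cont_inv f : cont f -> (forall x, A x -> f x <> C0) -> cont (fun x => Cinv (f x)).
Proof.
  intros Hf Hnz x Hx eps He.
  assert (Hp := Cnorm_pos _ (Hnz x Hx)); set (m := Cnorm (f x)) in *.
  destruct (Hf x Hx (Rmin (m/2) (eps * m * m / 2))) as [d [Hd H]].
  { apply Rmin_glb_lt; [lra|]. assert (0 < eps * m) by nra. nra. }
  exists d; split; [exact Hd|]; intros y Hy Hxy.
  specialize (H y Hy Hxy); unfold Cdist in *.
  assert (H1 := Rlt_le_trans _ _ _ H (Rmin_l _ _)); assert (H2 := Rlt_le_trans _ _ _ H (Rmin_r _ _)).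
  assert (H3 : m / 2 < Cnorm (f y)).
  { replace (f y) with (f x - (f x - f y))%C by ring.
    pose proof (Cnorm_sub_ge (f x) (f x - f y)); fold m in H0; lra. }
  assert (Hy0 := Hnz y Hy); assert (Hx0 := Hnz x Hx).
  replace (Cinv (f x) - Cinv (f y))%C with ((f y - f x) * (Cinv (f x) * Cinv (f y)))%C
    by (field; split; assumption).
  rewrite !Cnorm_mul, !Cnorm_inv, Cnorm_sub_sym by assumption; fold m.
  apply Rmult_lt_reg_r with (m * Cnorm (f y)); [nra|].
  replace (Cnorm (f x - f y) * (/ m * / Cnorm (f y)) * (m * Cnorm (f y)))
    with (Cnorm (f x - f y)) by (field; lra).
  assert (0 < eps * m) by nra; nra.
Qed.

Lemma cont_sqn f : cont f -> continuous_on dU Rdist A (fun x => sqn (f x)).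
Proof.
  intros Hf.
  assert (Hc : cont (fun x => f x * Cconj (f x))%C).
  { apply cont_mul; [exact Hf|]; intros x Hx eps He; destruct (Hf x Hx eps He) as [d [Hd H]].
    exists d; split; [exact Hd|]; intros y Hy Hxy; specialize (H y Hy Hxy); unfold Cdist in *.
    replace (Cnorm (Cconj (f x) - Cconj (f y))) with (Cnorm (f x - f y)); [exact H|].
    unfold Cnorm; simpl; f_equal; ring. }
  intros x Hx eps He; destruct (Hc x Hx eps He) as [d [Hd H]]; exists d; split; [exact Hd|].
  intros y Hy Hxy; specialize (H y Hy Hxy); unfold Cdist, Rdist in *.
  eapply Rle_lt_trans; [|exact H].
  replace (sqn (f x) - sqn (f y)) with (Re (f x * Cconj (f x) - f y * Cconj (f y))%C)
    by (unfold sqn; simpl; ring).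
  apply Re_le_Cnorm.
Qed.
End Continuity.

Lemma contR_add {U} (dU : U -> U -> R) A (f g : U -> R) :
  continuous_on dU Rdist A f -> continuous_on dU Rdist A g ->
  continuous_on dU Rdist A (fun x => f x + g x).
Proof.
  intros Hf Hg x Hx eps He.
  destruct (Hf x Hx (eps/2) ltac:(lra)) as [d1 [H1 H1']].
  destruct (Hg x Hx (eps/2) ltac:(lra)) as [d2 [H2 H2']].
  exists (Rmin d1 d2); split; [apply Rmin_glb_lt; assumption|]; intros y Hy Hd.
  specialize (H1' y Hy (Rlt_le_trans _ _ _ Hd (Rmin_l _ _))).
  specialize (H2' y Hy (Rlt_le_trans _ _ _ Hd (Rmin_r _ _))); unfold Rdist in *.
  replace (f x + g x - (f y + g y)) with ((f x - f y) + (g x - g y)) by ring.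
  eapply Rle_lt_trans; [apply Rabs_triang|]; lra.
Qed.

Lemma contR_scal {U} (dU : U -> U -> R) A (c : R) (f : U -> R) :
  continuous_on dU Rdist A f -> continuous_on dU Rdist A (fun x => c * f x).
Proof.
  intros Hf x Hx eps He; pose proof (Rabs_pos c).
  destruct (Hf x Hx (eps / (Rabs c + 1))) as [d [Hd H1]]; [apply Rdiv_lt_0_compat; lra|].
  exists d; split; [exact Hd|]; intros y Hy Hxy; specialize (H1 y Hy Hxy); unfold Rdist in *.
  replace (c * f x - c * f y) with (c * (f x - f y)) by ring; rewrite Rabs_mult.
  apply Rle_lt_trans with ((Rabs c) * (eps / (Rabs c + 1))).
  - apply Rmult_le_compat_l; lra.
  - apply Rmult_lt_reg_r with (Rabs c + 1); [lra|].
    replace (Rabs c * (eps / (Rabs c + 1)) * (Rabs c + 1)) with (Rabs c * eps) by (field; lra); lra.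
Qed.

(** * The maximum principle on plane algebraic curves *)

Definition Biv (f : C -> C -> C) : Prop :=
  exists p, Forall Pol1 p /\ forall x y, f x y = beval p x y.

Fixpoint badd (l m : list (C -> C)) : list (C -> C) :=
  match l, m with
  | nil, _ => m
  | _, nil => l
  | a :: l', b :: m' => (fun x => a x + b x)%C :: badd l' m'
  end.
Fixpoint bmul (l m : list (C -> C)) : list (C -> C) :=
  match l with
  | nil => nil
  | a :: l' => badd (map (fun b x => a x * b x)%C m) ((fun _ => C0) :: bmul l' m)
  end.
Lemma beval_add l : forall m x y, beval (badd l m) x y = (beval l x y + beval m x y)%C.
Proof.
  unfold beval; induction l as [|a l IH]; intros [|b m] x y; simpl; try ring.
  rewrite IH; ring.
Qed.
Lemma beval_scal a m x y : beval (map (fun b x => a x * b x)%C m) x y = (a x * beval m x y)%C.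
Proof. unfold beval; induction m as [|b m IH]; simpl; [ring|rewrite IH; ring]. Qed.
Lemma beval_mul l m x y : beval (bmul l m) x y = (beval l x y * beval m x y)%C.
Proof.
  induction l as [|a l IH]; [unfold beval; simpl; ring|].
  simpl bmul; rewrite beval_add, beval_scal.
  change (beval ((fun _ => C0) :: bmul l m) x y) with (C0 + y * beval (bmul l m) x y)%C.
  rewrite IH; change (beval (a :: l) x y) with (a x + y * beval l x y)%C; ring.
Qed.
Lemma badd_Pol1 l : forall m, Forall Pol1 l -> Forall Pol1 m -> Forall Pol1 (badd l m).
Proof.
  induction l as [|a l IH]; intros [|b m] Hl Hm; simpl; auto.
  inversion Hl; inversion Hm; subst; constructor; [apply Pol1_add; assumption|auto].
Qed.
Lemma bmul_Pol1 l m : Forall Pol1 l -> Forall Pol1 m -> Forall Pol1 (bmul l m).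
Proof.
  induction 1 as [|a l Ha _ IH]; intro Hm; simpl; [constructor|].
  apply badd_Pol1.
  - clear IH; induction Hm; simpl; constructor; [apply Pol1_mul; assumption|assumption].
  - constructor; [apply Pol1_const|auto].
Qed.

Lemma Biv_add f g : Biv f -> Biv g -> Biv (fun x y => f x y + g x y)%C.
Proof.
  intros [p [Hp Ep]] [q [Hq Eq]]; exists (badd p q); split; [apply badd_Pol1; assumption|].
  intros; rewrite beval_add, Ep, Eq; reflexivity.
Qed.
Lemma Biv_mul f g : Biv f -> Biv g -> Biv (fun x y => f x y * g x y)%C.
Proof.
  intros [p [Hp Ep]] [q [Hq Eq]]; exists (bmul p q); split; [apply bmul_Pol1; assumption|].
  intros; rewrite beval_mul, Ep, Eq; reflexivity.
Qed.
Lemma Biv_Pol1 a : Pol1 a -> Biv (fun x _ => a x).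
Proof.
  intro Ha; exists (a :: nil); split; [repeat constructor; exact Ha|].
  intros; unfold beval; simpl; ring.
Qed.
Lemma Biv_const c : Biv (fun _ _ => c).
Proof. apply (Biv_Pol1 (fun _ => c)), Pol1_const. Qed.
Lemma Biv_x : Biv (fun x _ => x).
Proof. apply (Biv_Pol1 (fun x => x)), Pol1_id. Qed.
Lemma Biv_y : Biv (fun _ y => y).
Proof.
  exists ((fun _ => C0) :: (fun _ => C1) :: nil); split; [repeat constructor; apply Pol1_const|].
  intros; unfold beval; simpl; ring.
Qed.
Lemma Biv_ext f g : (forall x y, f x y = g x y) -> Biv f -> Biv g.
Proof. intros E [p [Hp Ep]]; exists p; split; [exact Hp|intros; rewrite <- E; apply Ep]. Qed.
Lemma Biv_pow f n : Biv f -> Biv (fun x y => f x y ^ n)%C.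
Proof. intro Hf; induction n as [|n IH]; simpl; [apply Biv_const|apply Biv_mul; assumption]. Qed.

Lemma Biv_shift f x0 y0 : Biv f -> Biv (fun x y => f (x0 + x) (y0 + y))%C.
Proof.
  intros [p [Hp Ep]]; apply (Biv_ext (fun x y => beval p (x0 + x) (y0 + y))%C);
    [intros; symmetry; apply Ep|].
  clear f Ep; induction Hp as [|a p [l Hl] _ IH]; [apply (Biv_const C0)|].
  apply (Biv_ext (fun x y => a (x0 + x) + (y0 + y) * beval p (x0 + x) (y0 + y))%C); [reflexivity|].
  apply Biv_add.
  - apply (Biv_Pol1 (fun x => a (x0 + x))%C).
    assert (H : Pol1 (fun x => ceval l (x0 + x))%C).
    { clear Hl; induction l as [|c l IHl]; simpl; [apply Pol1_const|].
      apply Pol1_add; [apply Pol1_const|apply Pol1_mul; [|exact IHl]].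
      apply Pol1_add; [apply Pol1_const|apply Pol1_id]. }
    destruct H as [m Hm]; exists m; intro; rewrite Hl; apply Hm.
  - apply Biv_mul; [|exact IH]; apply Biv_add; [apply Biv_const|apply Biv_y].
Qed.

Definition d2 (p q : C * C) : R := Cdist (fst p) (fst q) + Cdist (snd p) (snd q).

Lemma cont_fst A : continuous_on d2 Cdist A fst.
Proof.
  intros p _ eps He; exists eps; split; [exact He|]; intros q _ H.
  unfold d2, Cdist in *; pose proof (Cnorm_ge0 (snd p - snd q)); lra.
Qed.
Lemma cont_snd A : continuous_on d2 Cdist A snd.
Proof.
  intros p _ eps He; exists eps; split; [exact He|]; intros q _ H.
  unfold d2, Cdist in *; pose proof (Cnorm_ge0 (fst p - fst q)); lra.
Qed.

Lemma Biv_continuous f A : Biv f -> continuous_on d2 Cdist A (fun p => f (fst p) (snd p)).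
Proof.
  intros [p [Hp Ep]].
  apply cont_ext with (f := fun q => beval p (fst q) (snd q)); [intros; symmetry; apply Ep|].
  clear f Ep; induction Hp as [|a p [l Hl] _ IH]; [apply (cont_const d2 A C0)|].
  apply cont_ext with (f := fun q => (a (fst q) + snd q * beval p (fst q) (snd q))%C); [reflexivity|].
  apply cont_add; [|apply cont_mul; [apply cont_snd|exact IH]].
  apply cont_ext with (f := fun q => ceval l (fst q)); [intros; symmetry; apply Hl|].
  apply cont_ceval, cont_fst.
Qed.

Lemma Biv_bounded f B : Biv f ->
  exists M, 0 <= M /\ forall x y, Cnorm x <= B -> Cnorm y <= B -> Cnorm (f x y) <= M.
Proof.
  intros [p [Hp Ep]].
  assert (H : exists M, 0 <= M /\ forall x y, Cnorm x <= B -> Cnorm y <= B -> Cnorm (beval p x y) <= M).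
  { clear f Ep; induction Hp as [|a p Ha _ [M [HM IH]]].
    - exists 0; split; [lra|]; intros; unfold beval; simpl; rewrite Cnorm_0; lra.
    - destruct (Pol1_bounded a B Ha) as [K [HK HKb]].
      exists (K + Rabs B * M); split; [pose proof (Rabs_pos B); nra|].
      intros x y Hx Hy; change (beval (a :: p) x y) with (a x + y * beval p x y)%C.
      eapply Rle_trans; [apply Cnorm_triang|]; apply Rplus_le_compat; [auto|].
      apply Cnorm_mul_le; [|auto]; pose proof (Rle_abs B); lra. }
  destruct H as [M [HM H]]; exists M; split; [exact HM|]; intros; rewrite Ep; auto.
Qed.

Lemma Biv_lipschitz_at_0 p B : Forall Pol1 p -> 0 <= B ->
  exists L, 0 <= L /\ forall x y, Cnorm x <= 1 -> Cnorm y <= B ->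
    Cnorm (beval p x y - beval p C0 y) <= L * Cnorm x.
Proof.
  intros Hp HB; induction Hp as [|a p [l Hl] _ [L [HL IH]]].
  - exists 0; split; [lra|]; intros; unfold beval; simpl.
    replace (C0 - C0)%C with C0 by ring; rewrite Cnorm_0; lra.
  - assert (Ha : exists K, 0 <= K /\ forall x, Cnorm x <= 1 -> Cnorm (a x - a C0) <= K * Cnorm x).
    { destruct l as [|c l].
      - exists 0; split; [lra|]; intros; rewrite !Hl; simpl.
        replace (C0 - C0)%C with C0 by ring; rewrite Cnorm_0; lra.
      - destruct (Pol1_bounded (ceval l) 1 (ex_intro _ l (fun _ => eq_refl))) as [K [HK HKb]].
        exists K; split; [exact HK|]; intros x Hx; rewrite !Hl; simpl.
        replace (c + x * ceval l x - (c + C0 * ceval l C0))%C with (ceval l x * x)%C by ring.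
        apply Cnorm_mul_le; [auto|lra]. }
    destruct Ha as [K [HK HKb]].
    exists (K + B * L); split; [nra|]; intros x y Hx Hy.
    change (Cnorm (a x + y * beval p x y - (a C0 + y * beval p C0 y)) <= (K + B * L) * Cnorm x).
    replace (a x + y * beval p x y - (a C0 + y * beval p C0 y))%C
      with ((a x - a C0) + y * (beval p x y - beval p C0 y))%C by ring.
    eapply Rle_trans; [apply Cnorm_triang|].
    specialize (HKb x Hx); specialize (IH x y Hx Hy).
    assert (Cnorm (y * (beval p x y - beval p C0 y)) <= B * (L * Cnorm x))
      by (apply Cnorm_mul_le; assumption).
    lra.
Qed.

(** The factor 4 keeps nonzero roots clear of the annulus s/2 <= |y| <= 2s used in [fibre_bound]. *)
Lemma root_gap (bs : list C) (m : R) : 0 < m ->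
  exists s, 0 < s <= m /\ forall b, In b bs -> b = C0 \/ 4 * s <= Cnorm b.
Proof.
  intro Hm; induction bs as [|b bs [s [Hs IH]]].
  - exists m; split; [lra|]; intros b [].
  - destruct (classic (b = C0)) as [->|Hb].
    + exists s; split; [exact Hs|]; intros c [<-|Hc]; auto.
    + pose proof (Cnorm_pos b Hb).
      exists (Rmin s (Cnorm b / 4)); pose proof (Rmin_l s (Cnorm b / 4));
        pose proof (Rmin_r s (Cnorm b / 4)); split.
      * split; [apply Rmin_glb_lt; lra|lra].
      * intros c [<-|Hc]; [right; lra|].
        destruct (IH c Hc); [left; assumption|right; lra].
Qed.

Lemma Cprod_lower bs y t : 0 <= t -> (forall b, In b bs -> t <= Cnorm (y - b)) ->
  t ^ length bs <= Cnorm (Cprod bs y).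
Proof.
  intros Ht; induction bs as [|b bs IH]; intro H; simpl.
  - rewrite Cnorm_1; lra.
  - rewrite Cnorm_mul; apply Rmult_le_compat; [exact Ht|apply pow_le, Ht|apply H; left; reflexivity|].
    apply IH; intros; apply H; right; assumption.
Qed.

(** |1 + h/c|^2 = 1 + 2 Re h / c + |h|^2 / c^2. Once M^2 <= c a, the quadratic term eats only half
    of the linear gain 2a/c, leaving at most 1 - a/c. The summands 1 and a in [c] ensure c > 0 and
    a/c < 1. *)
Lemma one_plus_norm_lt (M a : R) : 0 <= M -> 0 < a ->
  exists c k, 0 < c /\ 0 <= k < 1 /\
    forall h, Cnorm h <= M -> Re h <= - a -> Cnorm (C1 + RtoC (/ c) * h) <= k.
Proof.
  intros HM Ha.
  set (c := M * M / a + 1 + a).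
  assert (HMa : 0 <= M * M / a) by (apply Rmult_le_pos; [nra|left; apply Rinv_0_lt_compat, Ha]).
  assert (Hc : 0 < c) by (unfold c; lra).
  assert (Hca : M * M <= c * a).
  { unfold c; replace (M * M) with (M * M / a * a) at 1 by (field; lra); nra. }
  assert (Hac : a / c < 1).
  { apply Rmult_lt_reg_r with c; [exact Hc|]; unfold Rdiv; rewrite Rmult_assoc, Rinv_l by lra.
    unfold c; lra. }
  assert (Hac0 : 0 < a / c) by (apply Rdiv_lt_0_compat; lra).
  exists c, (sqrt (1 - a / c)); split; [exact Hc|]; split.
  { split; [apply sqrt_pos|]; rewrite <- sqrt_1 at 2; apply sqrt_lt_1; lra. }
  intros h Hh Hre.
  apply sqr_le_inv; [apply sqrt_pos|].
  rewrite Cnorm_sqr, sqrt_sqrt by lra.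
  assert (Hs : sqn h <= M * M).
  { rewrite <- Cnorm_sqr; apply Rmult_le_compat; try apply Cnorm_ge0; exact Hh. }
  assert (Hi : 0 < / c) by (apply Rinv_0_lt_compat, Hc).
  replace (sqn (C1 + RtoC (/ c) * h)) with (1 + 2 * (/ c * Re h) + / c * (/ c * sqn h))
    by (unfold sqn; simpl; ring).
  assert (/ c * sqn h <= a).
  { apply Rmult_le_reg_l with c; [exact Hc|].
    rewrite <- Rmult_assoc, Rinv_r by lra; lra. }
  unfold Rdiv; assert (/ c * Re h <= / c * - a) by (apply Rmult_le_compat_l; lra).
  assert (/ c * (/ c * sqn h) <= / c * a) by (apply Rmult_le_compat_l; lra).
  lra.
Qed.

(** A strict peak of Re h at the origin turns 1 + h/c into a peak function: value 1 at the origin,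
    modulus at most k < 1 over a small circle |x| = eta. Its high powers contradict the control of
    the centre by the boundary fibres. *)
Lemma no_peak_on_curve f h (e delta : R) : Biv f -> Biv h ->
  f C0 C0 = C0 -> h C0 C0 = C0 -> 0 < e -> 0 < delta ->
  ~ (forall x y, Cnorm x <= delta -> Cnorm y <= delta -> f x y = C0 ->
      Re (h x y) <= - e * (sqn x + sqn y)).
Proof.
  intros Hf Hh Hf0 Hh0 He Hdl Hpeak.
  destruct (Biv_bounded h delta Hh) as [M [HM HMb]].
  destruct (classic (forall y, f C0 y = C0)) as [Hall|Hex].
  (* If the curve contains the line x = 0, its projection to x is useless, but the one-variable
     maximum principle on that line already gives the contradiction. *)
  - destruct (one_plus_norm_lt M (e * (delta * delta))) as (c & k & Hc & Hk & H);
      [exact HM|apply Rmult_lt_0_compat; nra|].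
    destruct Hh as [q [Hq Eq]].
    assert (Hp : Papprox delta (fun y => C1 + RtoC (/ c) * h C0 y)%C).
    { apply Papprox_add; [apply Pol1_Papprox, Pol1_const|].
      apply Papprox_mul; [apply Pol1_Papprox, Pol1_const|].
      apply Pol1_Papprox; exists (map (fun a => a C0) q); intro; apply Eq. }
    assert (HC0 : Cnorm C0 <= delta) by (rewrite Cnorm_0; lra).
    pose proof (Papprox_mean delta _ k ltac:(lra) Hp) as Hm; cbv beta in Hm.
    rewrite Hh0 in Hm.
    replace (C1 + RtoC (/ c) * C0)%C with C1 in Hm by ring; rewrite Cnorm_1 in Hm.
    enough (1 <= k) by lra; apply Hm; intros y Hy.
    apply H; [apply HMb; lra|].
    specialize (Hpeak C0 y HC0 ltac:(lra) (Hall y)).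
    rewrite <- (Cnorm_sqr y), Hy in Hpeak; unfold sqn in Hpeak; simpl in Hpeak; lra.
  - apply not_all_ex_not in Hex; destruct Hex as [y1 Hy1].
    destruct Hf as [p [Hp Ep]].
    rewrite Ep in Hy1, Hf0.
    destruct (Factorization.poly_factor (map (fun a => a C0) p) y1 Hy1) as (a & bs & Ha & _ & Hev & _).
    assert (HapR := Cnorm_pos a Ha).
    destruct (root_gap bs delta Hdl) as [s [Hs Hgap]].
    assert (Hlow : forall y, s / 2 <= Cnorm y <= 2 * s ->
      Cnorm a * (s/2) ^ length bs <= Cnorm (beval p C0 y)).
    { intros y Hy; unfold beval; rewrite Hev, Cnorm_mul; apply Rmult_le_compat_l; [lra|].
      apply Cprod_lower; [lra|]; intros b Hb; destruct (Hgap b Hb) as [->|Hb4].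
      - replace (y - C0)%C with y by ring; lra.
      - pose proof (Cnorm_sub_ge b y); rewrite Cnorm_sub_sym; lra. }
    set (m0 := Cnorm a * (s/2) ^ length bs) in *.
    assert (Hm0 : 0 < m0) by (apply Rmult_lt_0_compat; [exact HapR|apply pow_lt; lra]).
    destruct (Biv_lipschitz_at_0 p (2 * s) Hp ltac:(lra)) as [L [HL HLb]].
    (* With [m0] the minimum allowed for |p(0, y)| on the annulus and [L] a Lipschitz constant in x,
       L eta <= m0/2: p changes there by at most half of its value over the centre. *)
    set (eta := Rmin (Rmin 1 delta) (m0 / (2 * (L + 1)))).
    assert (Heta : 0 < eta).
    { unfold eta; repeat apply Rmin_glb_lt; try lra; apply Rdiv_lt_0_compat; lra. }
    assert (Heta1 : eta <= 1) by (eapply Rle_trans; [apply Rmin_l|apply Rmin_l]).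
    assert (Heta2 : eta <= delta) by (eapply Rle_trans; [apply Rmin_l|apply Rmin_r]).
    assert (Heta3 : L * eta <= m0 / 2).
    { assert (eta <= m0 / (2 * (L + 1))) by apply Rmin_r.
      apply Rle_trans with ((L + 1) * eta); [nra|].
      apply Rle_trans with ((L + 1) * (m0 / (2 * (L + 1)))); [apply Rmult_le_compat_l; lra|].
      right; field; lra. }
    destruct (one_plus_norm_lt M (e * (eta * eta))) as (c & k & Hc & Hk & H);
      [exact HM|apply Rmult_lt_0_compat; nra|].
    (* The loss factor [2 * INR (length p)] of [fibre_bound] does not depend on the power n, whereas
       k^n tends to 0. *)
    assert (Hbound : forall n, 1 <= 2 * INR (length p) * k ^ n).
    { intro n.
      assert (Hg : Biv (fun x y => (C1 + RtoC (/ c) * h x y) ^ n)%C).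
      { apply (Biv_pow (fun x y => C1 + RtoC (/ c) * h x y)%C); apply Biv_add; [apply Biv_const|].
        apply Biv_mul; [apply Biv_const|exact Hh]. }
      destruct Hg as [g [Hgp Hg]].
      assert (Hg0 : beval g C0 C0 = C1).
      { rewrite <- Hg, Hh0; replace (C1 + RtoC (/ c) * C0)%C with C1 by ring; apply Cpow_C1. }
      rewrite <- Cnorm_1; rewrite <- Hg0.
      apply (fibre_bound p g eta s); auto; try lra.
      - intros x y Hx Hy; specialize (Hlow y Hy); split; [apply Cnorm_neq0; lra|].
        specialize (HLb x y ltac:(lra) ltac:(lra)).
        assert (L * Cnorm x <= L * eta) by (apply Rmult_le_compat_l; lra); lra.
      - intros y Hy Ey; unfold beval in Ey; rewrite Hev in Ey.
        assert (Hin : In y bs).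
        { apply Cprod_root_inv, NNPP; intro H2; exact (Cmul_neq0 _ _ Ha H2 Ey). }
        destruct (Hgap y Hin); [assumption|lra].
      - apply pow_le; lra.
      - intros x y Hx Hy E0; rewrite <- Hg, Cnorm_pow; apply pow_incr; split; [apply Cnorm_ge0|].
        apply H; [apply HMb; lra|].
        specialize (Hpeak x y ltac:(lra) ltac:(lra) ltac:(rewrite Ep; exact E0)).
        rewrite <- (Cnorm_sqr x), Hx in Hpeak; pose proof (sqn_ge0 y); nra. }
    pose proof (pos_INR (length p)).
    destruct (pow_lt_1_zero k ltac:(rewrite Rabs_right; lra) (/ (2 * INR (length p) + 1))) as [N HN].
    { apply Rinv_0_lt_compat; lra. }
    specialize (HN N (Nat.le_refl _)); specialize (Hbound N).
    rewrite Rabs_right in HN by (apply Rle_ge, pow_le; lra).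
    apply Rmult_lt_compat_r with (r := 2 * INR (length p) + 1) in HN; [|lra].
    rewrite Rinv_l in HN by lra.
    assert (0 <= k ^ N) by (apply pow_le; lra); nra.
Qed.

(** If g were smaller on the sphere, |g|^2 + e |z|^2 with small e > 0 would attain its maximum over
    the part of the curve in the ball at an interior point z0. Expanding there, Re of the polynomial
    h = conj(g0) (g - g0) + e <z - z0, z0> is at most -(e/2) |z - z0|^2 on the curve, which
    [no_peak_on_curve] forbids. *)
Lemma curve_max_principle f g (r : R) : Biv f -> Biv g -> f C0 C0 = C0 -> 0 < r ->
  exists x y, sqn x + sqn y = r * r /\ f x y = C0 /\ Cnorm (g C0 C0) <= Cnorm (g x y).
Proof.
  intros Hf Hg Hf0 Hr.
  set (A := fun p : C * C => sqn (fst p) + sqn (snd p) <= r * r /\ f (fst p) (snd p) = C0).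
  assert (Hrad : forall F, continuous_on d2 Rdist (fun _ => True) F ->
     (forall u a, seqcv d2 u a -> seqcv Rdist (fun n => F (u n)) (F a))).
  { intros F HF u a Hu; apply (continuous_seq d2 Rdist (fun _ => True)); auto. }
  assert (Hcsq : continuous_on d2 Rdist (fun _ => True) (fun p : C * C => sqn (fst p) + sqn (snd p))).
  { apply contR_add; apply cont_sqn; [apply cont_fst|apply cont_snd]. }
  assert (Hcomp : forall E : C * C -> Prop, (forall p, E p -> A p) ->
     (forall u a, (forall n, E (u n)) -> seqcv d2 u a -> E a) -> seqcompact d2 E).
  { intros E HEA Hcl u Hu.
    assert (Hb : forall z w, sqn z + sqn w <= r * r -> Cnorm z <= r).
    { intros z w H; apply sqr_le_inv; [lra|]; rewrite Cnorm_sqr; pose proof (sqn_ge0 w); lra. }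
    destruct (bolzano_weierstrass_C (fun n => fst (u n)) r) as (phi & a & Hphi & Ha).
    { intro n; apply (Hb _ (snd (u n))); apply (HEA _ (Hu n)). }
    destruct (bolzano_weierstrass_C (fun n => snd (u (phi n))) r) as (psi & b & Hpsi & Hb').
    { intro n; apply (Hb _ (fst (u (phi n)))); destruct (HEA _ (Hu (phi n))); lra. }
    exists (fun n => phi (psi n)), (a, b).
    assert (Hcv : seqcv d2 (fun n => u (phi (psi n))) (a, b)).
    { intros eps He; apply (seqcv_sub _ _ _ psi Hpsi) in Ha.
      destruct (Ha (eps/2) ltac:(lra)) as [N HN]; destruct (Hb' (eps/2) ltac:(lra)) as [M HM].
      exists (max N M); intros n Hn; unfold d2; simpl.
      specialize (HN n ltac:(lia)); specialize (HM n ltac:(lia)); lra. }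
    split; [|split; [|exact Hcv]].
    - intro n; apply incr_seq_lt; [exact Hphi|apply Hpsi].
    - apply (Hcl _ _ (fun n => Hu (phi (psi n))) Hcv). }
  assert (HclA : forall u a, (forall n, A (u n)) -> seqcv d2 u a -> A a).
  { intros u a Hu Hcv; split.
    - pose proof (Hrad _ Hcsq u a Hcv) as H; apply Rnot_lt_le; intro Hlt.
      destruct (H (sqn (fst a) + sqn (snd a) - r * r) ltac:(lra)) as [N HN].
      specialize (HN N (Nat.le_refl _)); destruct (Hu N) as [H1 _]; unfold Rdist in HN.
      apply Rabs_def2 in HN; lra.
    - apply NNPP; intro Hn; apply Cnorm_pos in Hn.
      pose proof (continuous_seq d2 Cdist (fun _ => True) _ u a (Biv_continuous f _ Hf) I (fun _ => I) Hcv) as H.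
      destruct (H _ Hn) as [N HN]; specialize (HN N (Nat.le_refl _)); destruct (Hu N) as [_ H1].
      cbv beta in HN; rewrite H1 in HN; unfold Cdist in HN.
      replace (f (fst a) (snd a) - C0)%C with (f (fst a) (snd a)) in HN by ring; lra. }
  apply NNPP; intro Hno.
  assert (Hno' : forall p, A p -> sqn (fst p) + sqn (snd p) = r * r ->
     sqn (g (fst p) (snd p)) < sqn (g C0 C0)).
  { intros p [_ Hp] Hs; apply Rnot_le_lt; intro Hle; apply Hno; exists (fst p), (snd p).
    repeat split; auto; apply sqr_le_inv; [apply Cnorm_ge0|]; rewrite !Cnorm_sqr; exact Hle. }
  assert (Hgc : forall E, continuous_on d2 Rdist E (fun p : C * C => sqn (g (fst p) (snd p)))).
  { intro E; apply (cont_sqn d2 E (fun p => g (fst p) (snd p))), Biv_continuous, Hg. }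
  assert (Hcs : forall E, continuous_on d2 Rdist E (fun p : C * C => sqn (fst p) + sqn (snd p))).
  { intro E; apply contR_add; apply cont_sqn; [apply cont_fst|apply cont_snd]. }
  (* Compactness turns the strict inequality on the sphere into a margin that absorbs e r^2. If the
     curve misses the sphere, any e will do. *)
  assert (Heps : exists e, 0 < e /\ forall p, A p -> sqn (fst p) + sqn (snd p) = r * r ->
     sqn (g (fst p) (snd p)) + e * (r * r) < sqn (g C0 C0)).
  { set (Z := fun p : C * C => A p /\ sqn (fst p) + sqn (snd p) = r * r).
    destruct (classic (exists p, Z p)) as [[p0 Hp0]|Hemp].
    - destruct (seqcompact_max d2 Z (fun p => sqn (g (fst p) (snd p))) p0) as (p1 & [Hp1 Hp1'] & Hmax); auto.
      { apply Hcomp; [intros p [H _]; exact H|].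
        intros u a Hu Hcv; split; [apply (HclA u a); [intro; apply Hu|exact Hcv]|].
        pose proof (Hrad _ Hcsq u a Hcv) as H; apply NNPP; intro Hne.
        destruct (H (Rabs (sqn (fst a) + sqn (snd a) - r * r))) as [N HN].
        { apply Rabs_pos_lt; lra. }
        specialize (HN N (Nat.le_refl _)); destruct (Hu N) as [_ E].
        cbv beta in HN; unfold Rdist in HN; rewrite E in HN; lra. }
      specialize (Hno' p1 Hp1 Hp1').
      set (gap := sqn (g C0 C0) - sqn (g (fst p1) (snd p1))) in *.
      exists (gap / (2 * (r * r))); split.
      { apply Rdiv_lt_0_compat; [unfold gap; lra|nra]. }
      intros p Hp Hps; specialize (Hmax p (conj Hp Hps)).
      replace (gap / (2 * (r * r)) * (r * r)) with (gap / 2) by (field; lra).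
      unfold gap in *; lra.
    - exists 1; split; [lra|]; intros p Hp Hps; exfalso; apply Hemp; exists p; split; assumption. }
  destruct Heps as [e [He Hez]].
  destruct (seqcompact_max d2 A (fun p => sqn (g (fst p) (snd p)) + e * (sqn (fst p) + sqn (snd p)))
      (C0, C0)) as ([x0 y0] & [H0r H0f] & Hmax); simpl in *.
  { apply Hcomp; auto. }
  { split; simpl; [unfold sqn; simpl; nra|exact Hf0]. }
  { apply contR_add; [apply Hgc|apply contR_scal, Hcs]. }
  assert (Hint : sqn x0 + sqn y0 < r * r).
  { destruct H0r as [H|H]; [exact H|exfalso].
    specialize (Hez (x0, y0) (conj (or_intror H) H0f) H); simpl in Hez.
    specialize (Hmax (C0, C0)); simpl in Hmax.
    assert (HA0 : A (C0, C0)) by (split; simpl; [unfold sqn; simpl; nra|exact Hf0]).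
    specialize (Hmax HA0); rewrite H in Hmax; unfold sqn in Hmax, Hez; simpl in Hmax, Hez; lra. }
  set (g0 := g x0 y0) in *.
  apply (no_peak_on_curve (fun x y => f (x0 + x) (y0 + y))%C
     (fun x y => Cconj g0 * (g (x0 + x) (y0 + y) + - g0) + RtoC e * (Cconj x0 * x + Cconj y0 * y))%C
     (e / 2) (Rmin 1 ((r * r - sqn x0 - sqn y0) / (2 * (Cnorm x0 + Cnorm y0 + 1) + 2)))).
  - apply Biv_shift, Hf.
  - apply Biv_add.
    + apply Biv_mul; [apply Biv_const|].
      apply (Biv_add (fun x y => g (x0 + x) (y0 + y))%C (fun _ _ => - g0)%C);
        [apply Biv_shift, Hg|apply Biv_const].
    + apply Biv_mul; [apply Biv_const|]; apply Biv_add; apply Biv_mul;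
        [apply Biv_const|apply Biv_x|apply Biv_const|apply Biv_y].
  - replace (x0 + C0)%C with x0 by ring; replace (y0 + C0)%C with y0 by ring; exact H0f.
  - replace (x0 + C0)%C with x0 by ring; replace (y0 + C0)%C with y0 by ring; fold g0; ring.
  - lra.
  - apply Rmin_glb_lt; [lra|]; apply Rdiv_lt_0_compat; [lra|].
    pose proof (Cnorm_ge0 x0); pose proof (Cnorm_ge0 y0); lra.
  (* The radius [dl] keeps the displaced point in the ball: the increase 2 Re <z0, z> + |z|^2 stays
     below r^2 - |z0|^2. *)
  - set (dl := Rmin 1 _); intros x y Hx Hy Hfxy.
    assert (Hexp : forall a b, sqn (a + b)%C = sqn a + 2 * Re (Cconj a * b)%C + sqn b).
    { intros a b; unfold sqn; simpl; ring. }
    assert (Hre : forall a b, Re (Cconj a * b)%C <= Cnorm a * Cnorm b).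
    { intros a b; eapply Rle_trans; [apply Rle_abs|]; eapply Rle_trans; [apply Re_le_Cnorm|].
      rewrite Cnorm_mul; right; f_equal; unfold Cnorm; simpl; f_equal; ring. }
    assert (HA : A (x0 + x, y0 + y)%C).
    { split; simpl; [|exact Hfxy]; rewrite !Hexp.
      pose proof (Hre x0 x); pose proof (Hre y0 y).
      pose proof (Cnorm_ge0 x0); pose proof (Cnorm_ge0 y0).
      pose proof (Cnorm_ge0 x); pose proof (Cnorm_ge0 y).
      assert (dl <= 1) by apply Rmin_l.
      assert (Hdl : dl <= (r * r - sqn x0 - sqn y0) / (2 * (Cnorm x0 + Cnorm y0 + 1) + 2)) by apply Rmin_r.
      apply Rmult_le_compat_r with (r := 2 * (Cnorm x0 + Cnorm y0 + 1) + 2) in Hdl; [|lra].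
      replace ((r * r - sqn x0 - sqn y0) / (2 * (Cnorm x0 + Cnorm y0 + 1) + 2) *
         (2 * (Cnorm x0 + Cnorm y0 + 1) + 2)) with (r * r - sqn x0 - sqn y0) in Hdl by (field; lra).
      rewrite <- (Cnorm_sqr x), <- (Cnorm_sqr y); nra. }
    specialize (Hmax _ HA); simpl in Hmax.
    rewrite !Hexp in Hmax.
    set (g1 := g (x0 + x)%C (y0 + y)%C) in *.
    assert (Hg1 : sqn g1 = sqn g0 + 2 * Re (Cconj g0 * (g1 + - g0))%C + sqn (g1 + - g0)).
    { rewrite <- Hexp; f_equal; ring. }
    pose proof (sqn_ge0 (g1 + - g0)).
    replace (Re (Cconj g0 * (g1 + - g0) + RtoC e * (Cconj x0 * x + Cconj y0 * y))%C)
      with (Re (Cconj g0 * (g1 + - g0))%C + e * (Re (Cconj x0 * x)%C + Re (Cconj y0 * y)%C))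
      by (simpl; ring).
    lra.
Qed.

(** * A Cantor set meeting every algebraic surface through the origin *)

Definition C3 : Type := (C * C * C)%type.
Definition x1 (z : C3) : C := fst (fst z).
Definition x2 (z : C3) : C := snd (fst z).
Definition x3 (z : C3) : C := snd z.
Definition d3 (z w : C3) : R := Cdist (x1 z) (x1 w) + Cdist (x2 z) (x2 w) + Cdist (x3 z) (x3 w).
Definition n3 (z : C3) : R := Cnorm (x1 z) + Cnorm (x2 z) + Cnorm (x3 z).
Definition O3 : C3 := (C0, C0, C0).

(* Polynomials on C^3 are represented by [poly4] with the fourth variable set to 0. *)
Definition ev (p : poly4) (z : C3) : C := peval p (mkC4 (x1 z) (x2 z) (x3 z) C0).

Definition rho (z : C3) : R := Re (x3 z) + sqn (x1 z) + sqn (x2 z).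

(* The complex tangent plane at [w] of the strictly pseudoconvex level set of [rho]. *)
Definition plane (w : C3) (x y : C) : C3 :=
  ((x1 w + x)%C, (x2 w + y)%C,
   (x3 w - RtoC 2 * (Cconj (x1 w) * x + Cconj (x2 w) * y))%C).

Lemma rho_plane w x y : rho (plane w x y) = rho w + (sqn x + sqn y).
Proof. unfold rho, plane, x1, x2, x3, sqn; simpl; ring. Qed.

Lemma plane_0 w : plane w C0 C0 = w.
Proof.
  destruct w as [[a b] c]; unfold plane, x1, x2, x3; simpl.
  f_equal; [f_equal; ring|ring].
Qed.

Lemma Biv_plane p w : Biv (fun x y => ev p (plane w x y)).
Proof.
  induction p as [c|v|p IHp q IHq|p IHp q IHq].
  - apply (Biv_const c).
  - destruct v.
    + apply (Biv_add (fun _ _ => x1 w) (fun x _ => x)); [apply Biv_const|apply Biv_x].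
    + apply (Biv_add (fun _ _ => x2 w) (fun _ y => y)); [apply Biv_const|apply Biv_y].
    + apply (Biv_ext (fun x y => x3 w + (- RtoC 2) * (Cconj (x1 w) * x + Cconj (x2 w) * y))%C).
      { intros; unfold ev, plane, x3; simpl; ring. }
      apply Biv_add; [apply Biv_const|]; apply Biv_mul; [apply Biv_const|].
      apply Biv_add; apply Biv_mul; [apply Biv_const|apply Biv_x|apply Biv_const|apply Biv_y].
    + apply (Biv_const C0).
  - apply (Biv_add (fun x y => ev p (plane w x y)) (fun x y => ev q (plane w x y))); assumption.
  - apply (Biv_mul (fun x y => ev p (plane w x y)) (fun x y => ev q (plane w x y))); assumption.
Qed.

(** In the tangent plane the surface becomes a plane curve and the increment of rho a squared
    radius, hence the radius [sqrt r]. *)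
Lemma surface_max_principle p q w (r : R) : ev p w = C0 -> 0 < r ->
  exists x y, sqn x + sqn y = r /\ ev p (plane w x y) = C0 /\
    Cnorm (ev q w) <= Cnorm (ev q (plane w x y)).
Proof.
  intros Hp Hr.
  destruct (curve_max_principle (fun x y => ev p (plane w x y)) (fun x y => ev q (plane w x y)) (sqrt r))
    as (x & y & H1 & H2 & H3).
  - apply Biv_plane.
  - apply Biv_plane.
  - rewrite plane_0; exact Hp.
  - apply sqrt_lt_R0, Hr.
  - rewrite plane_0 in H3; rewrite sqrt_sqrt in H1 by lra; exists x, y; auto.
Qed.

Lemma cont_x1 A : continuous_on d3 Cdist A x1.
Proof.
  intros z _ eps He; exists eps; split; [exact He|]; intros w _ H; unfold d3, Cdist in *.
  pose proof (Cnorm_ge0 (x2 z - x2 w)); pose proof (Cnorm_ge0 (x3 z - x3 w)); lra.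
Qed.
Lemma cont_x2 A : continuous_on d3 Cdist A x2.
Proof.
  intros z _ eps He; exists eps; split; [exact He|]; intros w _ H; unfold d3, Cdist in *.
  pose proof (Cnorm_ge0 (x1 z - x1 w)); pose proof (Cnorm_ge0 (x3 z - x3 w)); lra.
Qed.
Lemma cont_x3 A : continuous_on d3 Cdist A x3.
Proof.
  intros z _ eps He; exists eps; split; [exact He|]; intros w _ H; unfold d3, Cdist in *.
  pose proof (Cnorm_ge0 (x1 z - x1 w)); pose proof (Cnorm_ge0 (x2 z - x2 w)); lra.
Qed.

Lemma ev_continuous p A : continuous_on d3 Cdist A (ev p).
Proof.
  induction p as [c|v|p IHp q IHq|p IHp q IHq].
  - apply (cont_const d3 A c).
  - destruct v; [apply cont_x1|apply cont_x2|apply cont_x3|apply (cont_const d3 A C0)].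
  - apply (cont_add d3 A (ev p) (ev q)); assumption.
  - apply (cont_mul d3 A (ev p) (ev q)); assumption.
Qed.

Lemma Re_continuous {U} (dU : U -> U -> R) A f :
  continuous_on dU Cdist A f -> continuous_on dU Rdist A (fun x => Re (f x)).
Proof.
  intros Hf x Hx eps He; destruct (Hf x Hx eps He) as [d [Hd H]]; exists d; split; [exact Hd|].
  intros y Hy Hxy; eapply Rle_lt_trans; [|exact (H y Hy Hxy)]; unfold Rdist, Cdist.
  exact (Re_le_Cnorm (f x - f y)).
Qed.

Lemma rho_continuous A : continuous_on d3 Rdist A rho.
Proof.
  apply (contR_add d3 A (fun z => Re (x3 z) + sqn (x1 z)) (fun z => sqn (x2 z))).
  - apply (contR_add d3 A (fun z => Re (x3 z)) (fun z => sqn (x1 z))).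
    + apply Re_continuous, cont_x3.
    + apply cont_sqn, cont_x1.
  - apply cont_sqn, cont_x2.
Qed.

Lemma real_code (B t : R) : 0 < t -> exists (m : nat) (code : R -> nat),
  (forall x, Rabs x <= B -> (code x <= m)%nat) /\
  (forall x y, Rabs x <= B -> Rabs y <= B -> code x = code y -> Rabs (x - y) <= t).
Proof.
  intro Ht.
  assert (Hbd : forall x, Rabs x <= B -> - B <= x <= B).
  { intros x Hx; pose proof (Rle_abs x); pose proof (Rle_abs (- x)); rewrite Rabs_Ropp in *; lra. }
  assert (Hpos : forall x, Rabs x <= B -> 0 <= (x + B) / t).
  { intros x Hx; specialize (Hbd x Hx); apply Rmult_le_pos; [lra|left; apply Rinv_0_lt_compat, Ht]. }
  assert (Hup : forall x, Rabs x <= B -> (0 <= up ((x + B) / t))%Z).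
  { intros x Hx; specialize (Hpos x Hx); destruct (archimed ((x + B) / t)) as [H _].
    apply le_IZR; lra. }
  exists (Z.to_nat (up (2 * B / t) + 1)), (fun x => Z.to_nat (up ((x + B) / t))); split.
  - intros x Hx; apply Z2Nat.inj_le; [apply Hup, Hx| |].
    + assert (HB : Rabs B <= B).
      { pose proof (Rabs_pos x); rewrite Rabs_right; lra. }
      pose proof (Hup B HB) as H; replace (B + B) with (2 * B) in H by ring; lia.
    + destruct (archimed ((x + B) / t)) as [_ H1]; destruct (archimed (2 * B / t)) as [H2 _].
      assert ((x + B) / t <= 2 * B / t).
      { apply Rmult_le_compat_r; [left; apply Rinv_0_lt_compat, Ht|specialize (Hbd x Hx); lra]. }
      apply le_IZR; rewrite plus_IZR; lra.
  - intros x y Hx Hy E; apply Z2Nat.inj in E; try (apply Hup; assumption).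
    destruct (archimed ((x + B) / t)) as [H1 H2]; destruct (archimed ((y + B) / t)) as [H3 H4].
    rewrite E in H1, H2.
    replace (x - y) with (t * ((x + B) / t - (y + B) / t)) by (field; lra).
    rewrite Rabs_mult, (Rabs_right t) by lra.
    assert (Rabs ((x + B) / t - (y + B) / t) <= 1) by (apply Rabs_le; lra).
    nra.
Qed.

(** Mixed-radix digits: since [code z <= m], both parts of [c1 (f z) * S m + code z] can be read
    off. *)
Lemma list_code {U} (fs : list (U -> R)) (B t : R) : 0 < t -> exists (m : nat) (code : U -> nat),
  (forall z, (forall f, In f fs -> Rabs (f z) <= B) -> (code z <= m)%nat) /\
  (forall z w, (forall f, In f fs -> Rabs (f z) <= B) -> (forall f, In f fs -> Rabs (f w) <= B) ->
     code z = code w -> forall f, In f fs -> Rabs (f z - f w) <= t).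
Proof.
  intro Ht; induction fs as [|f fs (m & code & Hm & Hc)].
  - exists O, (fun _ => O); split; [lia|]; intros z w _ _ _ f [].
  - destruct (real_code B t Ht) as (m1 & c1 & Hm1 & Hc1).
    exists (m1 * S m + m)%nat, (fun z => c1 (f z) * S m + code z)%nat; split.
    + intros z Hz.
      assert (code z <= m)%nat by (apply Hm; intros; apply Hz; right; assumption).
      assert (c1 (f z) <= m1)%nat by (apply Hm1, Hz; left; reflexivity). nia.
    + intros z w Hz Hw E.
      assert (Hcz : (code z <= m)%nat) by (apply Hm; intros; apply Hz; right; assumption).
      assert (Hcw : (code w <= m)%nat) by (apply Hm; intros; apply Hw; right; assumption).
      assert (E1 : c1 (f z) = c1 (f w)) by nia.
      assert (E2 : code z = code w) by nia.
      intros g [<-|Hg].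
      * apply Hc1; [apply Hz; left; reflexivity|apply Hw; left; reflexivity|exact E1].
      * apply Hc; auto; intros; [apply Hz|apply Hw]; right; assumption.
Qed.

Definition coords3 : list (C3 -> R) :=
  (fun z => Re (x1 z)) :: (fun z => Im (x1 z)) :: (fun z => Re (x2 z)) ::
  (fun z => Im (x2 z)) :: (fun z => Re (x3 z)) :: (fun z => Im (x3 z)) :: nil.

Lemma coords3_bounded z B f : n3 z <= B -> In f coords3 -> Rabs (f z) <= B.
Proof.
  intros Hz Hf; unfold n3 in Hz.
  pose proof (Cnorm_ge0 (x1 z)); pose proof (Cnorm_ge0 (x2 z)); pose proof (Cnorm_ge0 (x3 z)).
  pose proof (Re_le_Cnorm (x1 z)); pose proof (Im_le_Cnorm (x1 z)).
  pose proof (Re_le_Cnorm (x2 z)); pose proof (Im_le_Cnorm (x2 z)).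
  pose proof (Re_le_Cnorm (x3 z)); pose proof (Im_le_Cnorm (x3 z)).
  simpl in Hf; decompose [or] Hf; subst; try lra; contradiction.
Qed.

Lemma coords3_dist z w t : (forall f, In f coords3 -> Rabs (f z - f w) <= t) -> d3 z w <= 6 * t.
Proof.
  intro H; unfold d3, Cdist.
  pose proof (Cnorm_le_parts (x1 z - x1 w)); pose proof (Cnorm_le_parts (x2 z - x2 w)).
  pose proof (Cnorm_le_parts (x3 z - x3 w)).
  assert (Hx : forall f, In f coords3 -> Rabs (f z + - f w) <= t) by exact H.
  simpl in *.
  pose proof (Hx (fun z => Re (x1 z)) ltac:(tauto)); pose proof (Hx (fun z => Im (x1 z)) ltac:(tauto)).
  pose proof (Hx (fun z => Re (x2 z)) ltac:(tauto)); pose proof (Hx (fun z => Im (x2 z)) ltac:(tauto)).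
  pose proof (Hx (fun z => Re (x3 z)) ltac:(tauto)); pose proof (Hx (fun z => Im (x3 z)) ltac:(tauto)).
  simpl in *; lra.
Qed.

Lemma geometric_cauchy_R (u : nat -> R) K : (forall k, Rabs (u (S k) - u k) <= K * (/2)^k) ->
  exists l, forall k, Rabs (u k - l) <= 2 * K * (/2)^k.
Proof.
  intro H.
  assert (Hn : forall k i, Rabs (u (k + i)%nat - u k) <= 2 * K * (/2)^k - 2 * K * (/2)^(k + i)).
  { intros k i; induction i as [|i IH].
    - rewrite Nat.add_0_r; replace (u k - u k) with 0 by ring; rewrite Rabs_R0; lra.
    - replace (k + S i)%nat with (S (k + i)) by lia.
      replace (u (S (k + i)) - u k) with ((u (S (k + i)) - u (k + i)%nat) + (u (k + i)%nat - u k)) by ring.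
      eapply Rle_trans; [apply Rabs_triang|]; specialize (H (k + i)%nat); simpl; lra. }
  assert (HK : 0 <= K).
  { specialize (H O); simpl in H; pose proof (Rabs_pos (u 1%nat - u O)); lra. }
  assert (Hn' : forall k n, (k <= n)%nat -> Rabs (u n - u k) <= 2 * K * (/2)^k).
  { intros k n Hkn; replace n with (k + (n - k))%nat by lia.
    eapply Rle_trans; [apply Hn|].
    assert (0 < (/2)^(k + (n - k))) by (apply pow_lt; lra); nra. }
  destruct (R_complete u) as [l Hl].
  { intros eps He; destruct (half_pow_small (eps / (4 * (K + 1)))) as [N HN].
    { apply Rdiv_lt_0_compat; lra. }
    exists N; intros n m Hn1 Hm1; unfold Rfunctions.Rdist.
    specialize (HN N (Nat.le_refl _)).
    apply Rmult_lt_compat_r with (r := 4 * (K + 1)) in HN; [|lra].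
    replace (eps / (4 * (K + 1)) * (4 * (K + 1))) with eps in HN by (field; lra).
    pose proof (Hn' N n Hn1); pose proof (Hn' N m Hm1).
    replace (u n - u m) with ((u n - u N) - (u m - u N)) by ring.
    assert (0 < (/2)^N) by (apply pow_lt; lra).
    eapply Rle_lt_trans; [apply Rabs_triang|]; rewrite Rabs_Ropp; nra. }
  exists l; intro k; apply Rnot_lt_le; intro Hlt.
  destruct (Hl (Rabs (u k - l) - 2 * K * (/2)^k)) as [N HN]; [lra|].
  specialize (HN (max N k) ltac:(lia)); unfold Rfunctions.Rdist in HN.
  pose proof (Hn' k (max N k) ltac:(lia)).
  replace (u k - l) with (- (u (max N k) - u k) + (u (max N k) - l)) in HN by ring.
  pose proof (Rabs_triang (- (u (max N k) - u k)) (u (max N k) - l)); rewrite Rabs_Ropp in *.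
  lra.
Qed.

Lemma geometric_cauchy_C (u : nat -> C) K : (forall k, Cnorm (u (S k) - u k) <= K * (/2)^k) ->
  exists l, forall k, Cnorm (u k - l) <= 4 * K * (/2)^k.
Proof.
  intro H.
  destruct (geometric_cauchy_R (fun k => Re (u k)) K) as [a Ha].
  { intro k; eapply Rle_trans; [|apply H]; exact (Re_le_Cnorm (u (S k) - u k)). }
  destruct (geometric_cauchy_R (fun k => Im (u k)) K) as [b Hb].
  { intro k; eapply Rle_trans; [|apply H]; exact (Im_le_Cnorm (u (S k) - u k)). }
  exists (mkC a b); intro k; eapply Rle_trans; [apply Cnorm_le_parts|]; simpl.
  specialize (Ha k); specialize (Hb k); unfold Rminus in *; lra.
Qed.

Section CantorSet.
Variables (m : nat -> nat) (code : nat -> C3 -> nat).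
(** The radius 20 = 2 + 2 + 16 is the size of the trajectories found in [traj_bounds]. *)
Hypothesis code_le : forall k z, n3 z <= 20 -> (code k z <= m k)%nat.

(** The unit of the digit written at stage k. Division by [4 * INR (S (m (S j)))] makes even the
    largest step of stage k+1 at most delta k / 4, so all later steps together stay below delta k /
    3 and cannot blur that digit. *)
Fixpoint delta (k : nat) : R :=
  match k with
  | O => / INR (S (m O))
  | S j => delta j / (4 * INR (S (m (S j))))
  end.

(* The squared length of the step from [z] records the cell [code k z], so that
   the limit of the trajectory is decoded from its value of [rho]. *)
Definition step (k : nat) (z : C3) : R := delta k * (1 + INR (code k z)).

Definition traj (w : nat -> C3) : Prop := w O = O3 /\
  forall k, exists x y, w (S k) = plane (w k) x y /\ sqn x + sqn y = step k (w k).

(** The rate is built in: 40 = 4 (1 + 1 + 8), from the step bounds 1, 1, 8 times (1/2)^k of the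
    three coordinates and the factor 4 of [geometric_cauchy_C]. *)
Definition cantor (z : C3) : Prop :=
  exists w, traj w /\ forall k, d3 (w k) z <= 40 * (/2)^k.

Lemma INR_S_pos k : 0 < INR (S k).
Proof. apply lt_0_INR; lia. Qed.

Lemma delta_pos k : 0 < delta k.
Proof.
  induction k as [|k IH]; cbn [delta].
  - apply Rinv_0_lt_compat, INR_S_pos.
  - apply Rdiv_lt_0_compat; [exact IH|]; pose proof (INR_S_pos (m (S k))); lra.
Qed.

Lemma step_pos k z : 0 < step k z.
Proof.
  unfold step; apply Rmult_lt_0_compat; [apply delta_pos|].
  pose proof (pos_INR (code k z)); lra.
Qed.

Lemma step_S_le k z : n3 z <= 20 -> step (S k) z <= delta k / 4.
Proof.
  intro Hz; unfold step; cbn [delta].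
  pose proof (INR_S_pos (m (S k))); pose proof (delta_pos k).
  assert (1 + INR (code (S k) z) <= INR (S (m (S k)))).
  { rewrite S_INR; pose proof (le_INR _ _ (code_le (S k) z Hz)); lra. }
  replace (delta k / 4) with (delta k / (4 * INR (S (m (S k)))) * INR (S (m (S k)))) by (field; lra).
  apply Rmult_le_compat_l; [|assumption].
  left; apply Rdiv_lt_0_compat; lra.
Qed.

Lemma delta_S_le k : delta (S k) <= delta k / 4.
Proof.
  cbn [delta]; pose proof (delta_pos k).
  assert (1 <= INR (S (m (S k)))) by (rewrite S_INR; pose proof (pos_INR (m (S k))); lra).
  unfold Rdiv; apply Rmult_le_compat_l; [lra|]; apply Rinv_le_contravar; lra.
Qed.

Lemma delta_le_pow k : delta k <= (/4)^k.
Proof.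
  induction k as [|k IH].
  - cbn [delta pow]; rewrite <- Rinv_1; apply Rinv_le_contravar; [lra|].
    rewrite S_INR; pose proof (pos_INR (m O)); lra.
  - pose proof (delta_S_le k); cbn [pow]; lra.
Qed.

Lemma step_le_pow k z : n3 z <= 20 -> step k z <= (/4)^k.
Proof.
  intro Hz; destruct k as [|k].
  - unfold step; cbn [delta]; pose proof (INR_S_pos (m O)).
    assert (1 + INR (code O z) <= INR (S (m O))).
    { rewrite S_INR; pose proof (le_INR _ _ (code_le O z Hz)); lra. }
    simpl pow; apply Rmult_le_reg_l with (INR (S (m O))); [assumption|].
    rewrite <- Rmult_assoc, Rinv_r by lra; lra.
  - pose proof (step_S_le k z Hz); pose proof (delta_le_pow k); cbn [pow]; lra.
Qed.

Lemma half_sqr_pow k : (/2)^k * (/2)^k = (/4)^k.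
Proof. rewrite <- Rpow_mult_distr; f_equal; lra. Qed.

(** Sizes and step lengths go together by induction, since the step bound 4^(-k) presupposes norm at
    most 20. From |x|, |y| <= 2^(-k) and |x1|, |x2| <= 2, the third coordinate moves by at most 2 (2
    + 2) 2^(-k). *)
Lemma traj_bounds w : traj w -> forall k,
  Cnorm (x1 (w k)) <= 2 - 2 * (/2)^k /\ Cnorm (x2 (w k)) <= 2 - 2 * (/2)^k /\
  Cnorm (x3 (w k)) <= 16 - 16 * (/2)^k /\
  Cnorm (x1 (w (S k)) - x1 (w k)) <= 1 * (/2)^k /\
  Cnorm (x2 (w (S k)) - x2 (w k)) <= 1 * (/2)^k /\
  Cnorm (x3 (w (S k)) - x3 (w k)) <= 8 * (/2)^k.
Proof.
  intros [Hw0 Hw].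
  assert (Hstep : forall k, Cnorm (x1 (w k)) <= 2 - 2 * (/2)^k ->
    Cnorm (x2 (w k)) <= 2 - 2 * (/2)^k -> Cnorm (x3 (w k)) <= 16 - 16 * (/2)^k ->
    Cnorm (x1 (w (S k)) - x1 (w k)) <= 1 * (/2)^k /\
    Cnorm (x2 (w (S k)) - x2 (w k)) <= 1 * (/2)^k /\
    Cnorm (x3 (w (S k)) - x3 (w k)) <= 8 * (/2)^k).
  { intros k H1 H2 H3.
    assert (Hpk : 0 < (/2)^k) by (apply pow_lt; lra).
    assert (Hz : n3 (w k) <= 20) by (unfold n3; lra).
    destruct (Hw k) as (x & y & -> & Hs).
    pose proof (step_le_pow k (w k) Hz) as Hst.
    assert (Hx : Cnorm x <= (/2)^k).
    { apply sqr_le_inv; [lra|]; rewrite Cnorm_sqr, half_sqr_pow; pose proof (sqn_ge0 y); lra. }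
    assert (Hy : Cnorm y <= (/2)^k).
    { apply sqr_le_inv; [lra|]; rewrite Cnorm_sqr, half_sqr_pow; pose proof (sqn_ge0 x); lra. }
    unfold plane, x1, x2, x3; simpl fst; simpl snd.
    fold (x1 (w k)) (x2 (w k)) (x3 (w k)).
    assert (Hcj : forall z, Cnorm (Cconj z) = Cnorm z).
    { intro z; unfold Cnorm; simpl; f_equal; ring. }
    repeat split.
    - replace (x1 (w k) + x - x1 (w k))%C with x by ring; lra.
    - replace (x2 (w k) + y - x2 (w k))%C with y by ring; lra.
    - set (u := (Cconj (x1 (w k)) * x + Cconj (x2 (w k)) * y)%C).
      replace (x3 (w k) - RtoC 2 * u - x3 (w k))%C with (- (RtoC 2 * u))%C by ring.
      rewrite Cnorm_opp, Cnorm_mul, Cnorm_RtoC, Rabs_right by lra.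
      assert (Cnorm u <= 2 * (/2)^k + 2 * (/2)^k); [|lra].
      eapply Rle_trans; [apply Cnorm_triang|].
      apply Rplus_le_compat; apply Cnorm_mul_le; rewrite ?Hcj; lra. }
  assert (Hb : forall k, Cnorm (x1 (w k)) <= 2 - 2 * (/2)^k /\
    Cnorm (x2 (w k)) <= 2 - 2 * (/2)^k /\ Cnorm (x3 (w k)) <= 16 - 16 * (/2)^k).
  { induction k as [|k (H1 & H2 & H3)].
    - rewrite Hw0; unfold O3, x1, x2, x3; simpl; rewrite Cnorm_0; lra.
    - destruct (Hstep k H1 H2 H3) as (E1 & E2 & E3).
      assert (Ht : forall a b, Cnorm a <= Cnorm (a - b) + Cnorm b).
      { intros a b; pose proof (Cnorm_sub_ge a b); lra. }
      pose proof (Ht (x1 (w (S k))) (x1 (w k))); pose proof (Ht (x2 (w (S k))) (x2 (w k))).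
      pose proof (Ht (x3 (w (S k))) (x3 (w k))); simpl; lra. }
  intro k; destruct (Hb k) as (H1 & H2 & H3); destruct (Hstep k H1 H2 H3) as (E1 & E2 & E3); auto 10.
Qed.

Lemma traj_n3 w k : traj w -> n3 (w k) <= 20.
Proof.
  intro Hw; destruct (traj_bounds w Hw k) as (H1 & H2 & H3 & _).
  assert (0 < (/2)^k) by (apply pow_lt; lra); unfold n3; lra.
Qed.

Lemma traj_limit w : traj w -> exists z, forall k, d3 (w k) z <= 40 * (/2)^k.
Proof.
  intro Hw; pose proof (traj_bounds w Hw) as H.
  destruct (geometric_cauchy_C (fun k => x1 (w k)) 1) as [a Ha]; [intro; apply H|].
  destruct (geometric_cauchy_C (fun k => x2 (w k)) 1) as [b Hb]; [intro; apply H|].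
  destruct (geometric_cauchy_C (fun k => x3 (w k)) 8) as [c Hc]; [intro; apply H|].
  exists (a, b, c); intro k; unfold d3, Cdist, x1 at 2, x2 at 2, x3 at 2; simpl fst; simpl snd.
  specialize (Ha k); specialize (Hb k); specialize (Hc k); lra.
Qed.

Lemma limit_seqcv w z : (forall k, d3 (w k) z <= 40 * (/2)^k) -> seqcv d3 w z.
Proof.
  intros H eps He; destruct (half_pow_small (eps / 40)) as [N HN]; [lra|].
  exists N; intros n Hn; specialize (HN n Hn); specialize (H n).
  replace (d3 z (w n)) with (d3 (w n) z); [lra|].
  unfold d3, Cdist; rewrite (Cnorm_sub_sym (x1 _)), (Cnorm_sub_sym (x2 _)), (Cnorm_sub_sym (x3 _)); reflexivity.
Qed.

Lemma traj_rho w k : traj w -> rho (w (S k)) = rho (w k) + step k (w k).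
Proof. intros [_ Hw]; destruct (Hw k) as (x & y & -> & <-); apply rho_plane. Qed.

(** The bound telescopes because d/3 - (d/4)/3 = d/4 dominates the next step. *)
Lemma traj_rho_tail w k i : traj w ->
  0 <= rho (w (S k + i)%nat) - rho (w (S k)) <= delta k / 3 - delta (k + i) / 3.
Proof.
  intro Hw; induction i as [|i IH].
  - rewrite !Nat.add_0_r; lra.
  - replace (S k + S i)%nat with (S (S k + i)) by lia.
    rewrite traj_rho by exact Hw.
    pose proof (step_pos (S k + i) (w (S k + i)%nat)).
    pose proof (step_S_le (k + i) (w (S k + i)%nat) (traj_n3 _ _ Hw)).
    pose proof (delta_S_le (k + i)).
    replace (k + S i)%nat with (S (k + i)) by lia.
    change (S k + i)%nat with (S (k + i)) in *; lra.
Qed.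

Lemma limit_rho w z k : traj w -> (forall k, d3 (w k) z <= 40 * (/2)^k) ->
  0 <= rho z - rho (w (S k)) <= delta k / 3.
Proof.
  intros Hw Hz.
  pose proof (continuous_seq d3 Rdist (fun _ => True) rho w z (rho_continuous _) I (fun _ => I)
     (limit_seqcv w z Hz)) as Hc.
  assert (Hlim : forall e, 0 < e -> - e <= rho z - rho (w (S k)) <= delta k / 3 + e).
  { intros e He; destruct (Hc e He) as [N HN].
    specialize (HN (S k + N)%nat ltac:(lia)); unfold Rdist in HN; apply Rabs_def2 in HN.
    pose proof (traj_rho_tail w k N Hw); pose proof (delta_pos (k + N)); lra. }
  split; apply Rnot_lt_le; intro Hlt.
  - specialize (Hlim ((rho (w (S k)) - rho z)/2) ltac:(lra)); lra.
  - specialize (Hlim ((rho z - rho (w (S k)) - delta k / 3)/2) ltac:(lra)); lra.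
Qed.

Lemma delta_decr j k : (j <= k)%nat -> delta k <= delta j.
Proof.
  induction 1 as [|k _ IH]; [lra|]; pose proof (delta_S_le k); pose proof (delta_pos k); lra.
Qed.

(** At the first stage j <= k where the digits differ, rho splits by at least delta j, and the tails
    recover at most delta j / 3; the limits would be at least 2 delta j / 3 apart in rho. The
    trajectories themselves may differ: only their rho and their cells are shown to agree. *)
Lemma limit_decode w z u v k : traj w -> (forall k, d3 (w k) z <= 40 * (/2)^k) ->
  traj u -> (forall k, d3 (u k) v <= 40 * (/2)^k) -> Rabs (rho z - rho v) < delta k / 2 ->
  rho (w k) = rho (u k) /\ code k (w k) = code k (u k).
Proof.
  intros Hw Hz Hu Hv Hd.
  assert (Hcode : forall j, (j <= k)%nat -> rho (w j) = rho (u j) -> code j (w j) = code j (u j)).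
  { intros j Hj E; apply NNPP; intro Hne.
    pose proof (limit_rho w z j Hw Hz); pose proof (limit_rho u v j Hu Hv).
    rewrite !traj_rho, E in * by assumption; unfold step in *.
    pose proof (delta_pos j); pose proof (delta_decr j k Hj).
    apply Rabs_def2 in Hd.
    destruct (Nat.lt_total (code j (w j)) (code j (u j))) as [Hlt|[Heq|Hlt]]; [|tauto|];
      apply le_INR in Hlt; rewrite S_INR in Hlt; nra. }
  assert (Hrho : forall j, (j <= k)%nat -> rho (w j) = rho (u j)).
  { induction j as [|j IH]; intro Hj.
    - rewrite (proj1 Hw), (proj1 Hu); reflexivity.
    - rewrite !traj_rho, IH by (assumption || lia); unfold step; rewrite Hcode by (try apply IH; lia).
      reflexivity. }
  split; [apply Hrho; lia|apply Hcode; [lia|apply Hrho; lia]].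
Qed.

(** The trajectory is chosen inside the surface p = 0 (hence the sigma type) with |q| nondecreasing
    along it; both properties are closed and pass to the limit. *)
Lemma cantor_meets p q : ev p O3 = C0 ->
  exists z, cantor z /\ ev p z = C0 /\ Cnorm (ev q O3) <= Cnorm (ev q z).
Proof.
  intro Hp.
  assert (Hnext : forall k (w : {w | ev p w = C0}), exists w' : {w | ev p w = C0},
     (exists x y, proj1_sig w' = plane (proj1_sig w) x y /\ sqn x + sqn y = step k (proj1_sig w)) /\
     Cnorm (ev q (proj1_sig w)) <= Cnorm (ev q (proj1_sig w'))).
  { intros k [w Hw]; destruct (surface_max_principle p q w (step k w) Hw (step_pos k w))
      as (x & y & H1 & H2 & H3).
    exists (exist (fun w => ev p w = C0) _ H2); simpl; split; [exists x, y; auto|exact H3]. }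
  set (next := fun k w => proj1_sig (constructive_indefinite_description _ (Hnext k w))).
  assert (Hn : forall k w,
     (exists x y, proj1_sig (next k w) = plane (proj1_sig w) x y /\ sqn x + sqn y = step k (proj1_sig w)) /\
     Cnorm (ev q (proj1_sig w)) <= Cnorm (ev q (proj1_sig (next k w)))).
  { intros k w; unfold next; destruct constructive_indefinite_description; assumption. }
  set (W := fix W n := match n with O => exist (fun w => ev p w = C0) O3 Hp | S k => next k (W k) end).
  set (w := fun n => proj1_sig (W n)).
  assert (Hw : traj w) by (split; [reflexivity|intro k; apply (Hn k (W k))]).
  assert (Hq : forall k, Cnorm (ev q O3) <= Cnorm (ev q (w k))).
  { induction k as [|k IH]; [apply Rle_refl|]; eapply Rle_trans; [exact IH|apply (Hn k (W k))]. }
  destruct (traj_limit w Hw) as [z Hz]; exists z.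
  pose proof (limit_seqcv w z Hz) as Hcv.
  pose proof (continuous_seq d3 Cdist (fun _ => True) (ev p) w z (ev_continuous p _) I (fun _ => I) Hcv) as Hcp.
  pose proof (continuous_seq d3 Cdist (fun _ => True) (ev q) w z (ev_continuous q _) I (fun _ => I) Hcv) as Hcq.
  split; [exists w; auto|split].
  - apply NNPP; intro Hne; apply Cnorm_pos in Hne; destruct (Hcp _ Hne) as [N HN].
    specialize (HN N (Nat.le_refl _)); unfold Cdist in HN.
    assert (E : ev p (w N) = C0) by exact (proj2_sig (W N)).
    cbv beta in HN; rewrite E in HN; replace (ev p z - C0)%C with (ev p z) in HN by ring; lra.
  - apply Rnot_lt_le; intro Hlt.
    destruct (Hcq (Cnorm (ev q O3) - Cnorm (ev q z)) ltac:(lra)) as [N HN].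
    specialize (HN N (Nat.le_refl _)); unfold Cdist in HN; rewrite Cnorm_sub_sym in HN.
    pose proof (Cnorm_sub_ge (ev q (w N)) (ev q z)); specialize (Hq N); lra.
Qed.
End CantorSet.

Lemma d3_triang a b c : d3 a c <= d3 a b + d3 b c.
Proof.
  unfold d3, Cdist.
  pose proof (Cnorm_sub_triang (x1 a) (x1 b) (x1 c)); pose proof (Cnorm_sub_triang (x2 a) (x2 b) (x2 c)).
  pose proof (Cnorm_sub_triang (x3 a) (x3 b) (x3 c)); lra.
Qed.

Lemma d3_sym a b : d3 a b = d3 b a.
Proof.
  unfold d3, Cdist; rewrite (Cnorm_sub_sym (x1 _)), (Cnorm_sub_sym (x2 _)), (Cnorm_sub_sym (x3 _)); reflexivity.
Qed.

Lemma d3_ge0 a b : 0 <= d3 a b.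
Proof.
  unfold d3, Cdist; pose proof (Cnorm_ge0 (x1 a - x1 b)); pose proof (Cnorm_ge0 (x2 a - x2 b)).
  pose proof (Cnorm_ge0 (x3 a - x3 b)); lra.
Qed.

Lemma n3_le_d3 a b : n3 a <= n3 b + d3 a b.
Proof.
  unfold n3, d3, Cdist; pose proof (Cnorm_sub_ge (x1 a) (x1 b)); pose proof (Cnorm_sub_ge (x2 a) (x2 b)).
  pose proof (Cnorm_sub_ge (x3 a) (x3 b)); lra.
Qed.

Theorem cantor_set_exists : exists (S : C3 -> Prop) (t0 : R), 0 < t0 < 2 /\
  (forall z, S z -> n3 z <= 60 /\ t0 <= rho z <= 2) /\
  (forall eps, 0 < eps -> exists de, 0 < de /\
     forall z w, S z -> S w -> Rabs (rho z - rho w) < de -> d3 z w < eps) /\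
  (forall p q, ev p O3 = C0 -> exists z, S z /\ ev p z = C0 /\ Cnorm (ev q O3) <= Cnorm (ev q z)).
Proof.
  assert (Hch : forall k, exists mc : nat * (C3 -> nat),
    (forall z, n3 z <= 20 -> (snd mc z <= fst mc)%nat) /\
    (forall z w, n3 z <= 20 -> n3 w <= 20 -> snd mc z = snd mc w -> d3 z w <= 6 * (/2)^k)).
  { intro k; destruct (list_code coords3 20 ((/2)^k)) as (m & c & H1 & H2); [apply pow_lt; lra|].
    exists (m, c); simpl; split.
    - intros z Hz; apply H1; intros f Hf; apply (coords3_bounded z 20 f Hz Hf).
    - intros z w Hz Hw E; apply coords3_dist, H2; auto; intros f Hf.
      + apply (coords3_bounded z 20 f Hz Hf).
      + apply (coords3_bounded w 20 f Hw Hf). }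
  set (mc := fun k => proj1_sig (constructive_indefinite_description _ (Hch k))).
  assert (Hmc : forall k, (forall z, n3 z <= 20 -> (snd (mc k) z <= fst (mc k))%nat) /\
    (forall z w, n3 z <= 20 -> n3 w <= 20 -> snd (mc k) z = snd (mc k) w -> d3 z w <= 6 * (/2)^k)).
  { intro k; unfold mc; destruct constructive_indefinite_description; assumption. }
  set (m := fun k => fst (mc k)); set (code := fun k => snd (mc k)).
  assert (Hle : forall k z, n3 z <= 20 -> (code k z <= m k)%nat) by (intro k; apply Hmc).
  assert (Hinj : forall k z w, n3 z <= 20 -> n3 w <= 20 -> code k z = code k w -> d3 z w <= 6 * (/2)^k)
    by (intro k; apply Hmc).
  (* The least possible first step, delta 0, bounds rho from below and so separates the set from the
     origin. *)
  exists (cantor m code), (delta m 0).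
  pose proof (delta_pos m 0); pose proof (delta_le_pow m 0) as Hd0; simpl pow in Hd0.
  split; [lra|]; split; [|split].
  - intros z (w & Hw & Hz); split.
    + pose proof (traj_n3 m code Hle w 0 Hw); pose proof (n3_le_d3 z (w O)); specialize (Hz O).
      rewrite d3_sym in Hz; simpl in Hz; lra.
    + pose proof (limit_rho m code Hle w z 0 Hw Hz).
      rewrite (traj_rho m code) in * by exact Hw; rewrite (proj1 Hw) in *.
      assert (Hr0 : rho O3 = 0) by (unfold rho, O3, x1, x2, x3, sqn; simpl; ring).
      rewrite Hr0 in *.
      assert (n3 O3 <= 20) by (unfold n3, O3, x1, x2, x3; simpl; rewrite Cnorm_0; lra).
      pose proof (step_le_pow m code Hle 0 O3 ltac:(assumption)) as Hs; simpl pow in Hs.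
      assert (delta m 0 <= step m code 0 O3).
      { unfold step; pose proof (pos_INR (code O O3)); nra. }
      lra.
  (* 86 = 40 + 6 + 40: limit to trajectory, diameter of a common cell, trajectory to limit. *)
  - intros eps He; destruct (half_pow_small (eps / 86)) as [k Hk]; [lra|].
    specialize (Hk k (Nat.le_refl _)).
    exists (delta m k / 2); split; [pose proof (delta_pos m k); lra|].
    intros z v (w & Hw & Hz) (u & Hu & Hv) Hd.
    destruct (limit_decode m code Hle w z u v k Hw Hz Hu Hv Hd) as [_ Hc].
    pose proof (Hinj k _ _ (traj_n3 m code Hle w k Hw) (traj_n3 m code Hle u k Hu) Hc).
    pose proof (d3_triang z (w k) v); pose proof (d3_triang (w k) (u k) v).
    specialize (Hz k); specialize (Hv k); rewrite (d3_sym (w k) z) in Hz; lra.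
  - intros p q Hp; apply cantor_meets; assumption.
Qed.

(** * A dense sequence of polynomials *)

Definition ratR (n : nat) : R :=
  let (a, r) := Cantor.of_nat n in let (b, d) := Cantor.of_nat r in (INR a - INR b) / INR (S d).

Lemma ratR_dense x eps : 0 < eps -> exists n, Rabs (x - ratR n) <= eps.
Proof.
  intro He; destruct (inv_INR_small eps He) as [d Hd]; specialize (Hd d (Nat.le_refl _)).
  assert (HS : 0 < INR (S d)) by (apply lt_0_INR; lia).
  set (k := up (x * INR (S d))); destruct (archimed (x * INR (S d))) as [H1 H2]; fold k in H1, H2.
  exists (Cantor.to_nat (Z.to_nat k, Cantor.to_nat (Z.to_nat (- k), d))).
  unfold ratR; rewrite !Cantor.cancel_of_to.
  assert (E : INR (Z.to_nat k) - INR (Z.to_nat (- k)) = IZR k).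
  { rewrite !INR_IZR_INZ, <- minus_IZR; f_equal; lia. }
  rewrite E; apply Rabs_le.
  assert (IZR k / INR (S d) * INR (S d) = IZR k) by (field; lra).
  assert (/ INR (S d) * INR (S d) = 1) by (field; lra).
  split; apply Rmult_le_reg_r with (INR (S d)); try exact HS; nra.
Qed.

(** Recursion is on the depth [d], while n codes a tag and two subtrees. Tag 0 embeds the previous
    depth, so that subtrees of unequal depth can be raised to a common one. *)
Fixpoint polyE (d n : nat) : poly4 :=
  let (t, r) := Cantor.of_nat n in
  let (a, b) := Cantor.of_nat r in
  match d with
  | O => match t with
         | 0 => Pconst (mkC (ratR a) (ratR b))
         | 1 => Pvar V1 | 2 => Pvar V2 | 3 => Pvar V3 | _ => Pvar V4
         end%nat
  | S d' => match t with
         | 0 => polyE d' r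
         | 1 => Padd (polyE d' a) (polyE d' b)
         | _ => Pmul (polyE d' a) (polyE d' b)
         end%nat
  end.

Lemma polyE_lift d n : exists m, polyE (S d) m = polyE d n.
Proof.
  exists (Cantor.to_nat (0%nat, n)); cbn [polyE]; rewrite Cantor.cancel_of_to.
  destruct (Cantor.of_nat n) eqn:E; reflexivity.
Qed.

Lemma polyE_lift_le d d' n : (d <= d')%nat -> exists m, polyE d' m = polyE d n.
Proof.
  induction 1 as [|d' _ [m Hm]]; [exists n; reflexivity|].
  rewrite <- Hm; apply polyE_lift.
Qed.

Lemma ev_bounded p B : exists M, 0 <= M /\ forall z, n3 z <= B -> Cnorm (ev p z) <= M.
Proof.
  induction p as [c|v|p [M [HM IHp]] q [K [HK IHq]]|p [M [HM IHp]] q [K [HK IHq]]].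
  - exists (Cnorm c); split; [apply Cnorm_ge0|intros; unfold ev; simpl; lra].
  - exists (Rabs B); split; [apply Rabs_pos|]; intros z Hz; pose proof (Rle_abs B).
    unfold n3 in Hz; pose proof (Cnorm_ge0 (x1 z)); pose proof (Cnorm_ge0 (x2 z)); pose proof (Cnorm_ge0 (x3 z)).
    destruct v; unfold ev; simpl; try lra; rewrite Cnorm_0; apply Rabs_pos.
  - exists (M + K); split; [lra|]; intros z Hz; specialize (IHp z Hz); specialize (IHq z Hz).
    change (Cnorm (ev p z + ev q z) <= M + K); eapply Rle_trans; [apply Cnorm_triang|lra].
  - exists (M * K); split; [nra|]; intros z Hz; change (Cnorm (ev p z * ev q z) <= M * K).
    apply Cnorm_mul_le; auto.
Qed.

Lemma polyE_dense p : forall B eps, 0 < eps -> exists d n, forall z, n3 z <= B ->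
  Cnorm (ev p z - ev (polyE d n) z) <= eps.
Proof.
  assert (Hself : forall q B eps, 0 < eps -> forall z, n3 z <= B -> Cnorm (ev q z - ev q z) <= eps).
  { intros q B eps He z _; replace (ev q z - ev q z)%C with C0 by ring; rewrite Cnorm_0; lra. }
  induction p as [c|v|p IHp q IHq|p IHp q IHq]; intros B eps He.
  - destruct (ratR_dense (Re c) (eps/2) ltac:(lra)) as [a Ha].
    destruct (ratR_dense (Im c) (eps/2) ltac:(lra)) as [b Hb].
    exists O, (Cantor.to_nat (0%nat, Cantor.to_nat (a, b))); intros z _; cbn [polyE].
    rewrite !Cantor.cancel_of_to; unfold ev; simpl.
    eapply Rle_trans; [apply Cnorm_le_parts|]; simpl; unfold Rminus in *; lra.
  - exists O, (Cantor.to_nat (match v with V1 => 1 | V2 => 2 | V3 => 3 | V4 => 4 end, 0)%nat).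
    assert (E : polyE 0 (Cantor.to_nat (match v with V1 => 1 | V2 => 2 | V3 => 3 | V4 => 4 end, 0)%nat) = Pvar v)
      by (cbn [polyE]; rewrite Cantor.cancel_of_to; destruct v; reflexivity).
    rewrite E; apply Hself; exact He.
  - destruct (IHp B (eps/2) ltac:(lra)) as (d & n & Hn); destruct (IHq B (eps/2) ltac:(lra)) as (d' & n' & Hn').
    destruct (polyE_lift_le d (max d d') n) as [m Hm]; [lia|].
    destruct (polyE_lift_le d' (max d d') n') as [m' Hm']; [lia|].
    exists (S (max d d')), (Cantor.to_nat (1%nat, Cantor.to_nat (m, m'))); intros z Hz.
    cbn [polyE]; rewrite !Cantor.cancel_of_to, Hm, Hm'.
    change (Cnorm (ev p z + ev q z - (ev (polyE d n) z + ev (polyE d' n') z)) <= eps).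
    replace (ev p z + ev q z - (ev (polyE d n) z + ev (polyE d' n') z))%C
      with ((ev p z - ev (polyE d n) z) + (ev q z - ev (polyE d' n') z))%C by ring.
    eapply Rle_trans; [apply Cnorm_triang|]; specialize (Hn z Hz); specialize (Hn' z Hz); lra.
  - destruct (ev_bounded p B) as [M [HM HMb]]; destruct (ev_bounded q B) as [K [HK HKb]].
    destruct (IHp B (eps/(2*(K+2)))) as (d & n & Hn); [apply Rdiv_lt_0_compat; lra|].
    destruct (IHq B (Rmin 1 (eps/(2*(M+1))))) as (d' & n' & Hn').
    { apply Rmin_glb_lt; [lra|apply Rdiv_lt_0_compat; lra]. }
    destruct (polyE_lift_le d (max d d') n) as [m Hm]; [lia|].
    destruct (polyE_lift_le d' (max d d') n') as [m' Hm']; [lia|].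
    exists (S (max d d')), (Cantor.to_nat (2%nat, Cantor.to_nat (m, m'))); intros z Hz.
    cbn [polyE]; rewrite !Cantor.cancel_of_to, Hm, Hm'.
    specialize (Hn z Hz); specialize (Hn' z Hz); specialize (HMb z Hz); specialize (HKb z Hz).
    pose proof (Rmin_l 1 (eps/(2*(M+1)))); pose proof (Rmin_r 1 (eps/(2*(M+1)))).
    change (Cnorm (ev p z * ev q z - (ev (polyE d n) z * ev (polyE d' n') z)) <= eps).
    set (a := ev p z) in *; set (b := ev q z) in *; set (a' := ev (polyE d n) z) in *.
    set (b' := ev (polyE d' n') z) in *.
    assert (Hb' : Cnorm b' <= K + 2).
    { replace b' with (b - (b - b'))%C by ring; eapply Rle_trans; [apply Cnorm_sub_le|]; lra. }
    replace (a * b - a' * b')%C with (a * (b - b') + (a - a') * b')%C by ring.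
    eapply Rle_trans; [apply Cnorm_triang|].
    assert (Cnorm (a * (b - b')) <= (M + 1) * (eps/(2*(M+1)))) by (apply Cnorm_mul_le; lra).
    assert (Cnorm ((a - a') * b') <= (eps/(2*(K+2))) * (K + 2)) by (apply Cnorm_mul_le; lra).
    replace ((M + 1) * (eps/(2*(M+1)))) with (eps/2) in * by (field; lra).
    replace ((eps/(2*(K+2))) * (K + 2)) with (eps/2) in * by (field; lra).
    lra.
Qed.

Definition polyenum (n : nat) : poly4 := let (d, k) := Cantor.of_nat n in polyE d k.

Lemma polyenum_dense p B eps : 0 < eps -> exists n, forall z, n3 z <= B ->
  Cnorm (ev p z - ev (polyenum n) z) <= eps.
Proof.
  intro He; destruct (polyE_dense p B eps He) as (d & k & H).
  exists (Cantor.to_nat (d, k)); unfold polyenum; rewrite Cantor.cancel_of_to; exact H.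
Qed.

(** * Removing the zero sets of a dense family of polynomials *)

Fixpoint Ppow (p : poly4) (n : nat) : poly4 :=
  match n with O => Pconst C1 | S k => Pmul p (Ppow p k) end.

Lemma ev_pow p n z : ev (Ppow p n) z = (ev p z ^ n)%C.
Proof.
  induction n as [|n IH]; [reflexivity|].
  change (ev p z * ev (Ppow p n) z = ev p z * ev p z ^ n)%C; rewrite IH; reflexivity.
Qed.

(* The exponent makes the factor [p] harmless: where the new product is at least
   1/2 in modulus, so was the old one. *)
Lemma damped_product (B : R) (P p : poly4) : ev P O3 = C1 -> ev p O3 <> C0 ->
  exists P' c, ev P' O3 = C1 /\ 0 < c /\ forall z, n3 z <= B -> /2 <= Cnorm (ev P' z) ->
    /2 <= Cnorm (ev P z) /\ c <= Cnorm (ev p z).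
Proof.
  intros HP Hp; pose proof (Cnorm_pos _ Hp) as Hp'.
  destruct (ev_bounded p B) as [M [HM HMb]]; destruct (ev_bounded P B) as [K [HK HKb]].
  set (e := Cnorm (ev p O3)) in *.
  destruct (half_pow_small (e / (2 * (M + 1)))) as [m Hm]; [apply Rdiv_lt_0_compat; lra|].
  specialize (Hm m (Nat.le_refl _)).
  (* Where |P^m p / p(0)| >= 1/2, the bound |P| <= K forces |p| >= e / (2 (K + 1)^m). *)
  exists (Pmul (Pconst (Cinv (ev p O3))) (Pmul (Ppow P m) p)), (e / (2 * (K + 1) ^ m)).
  assert (Hev : forall z, ev (Pmul (Pconst (Cinv (ev p O3))) (Pmul (Ppow P m) p)) z =
     (Cinv (ev p O3) * (ev P z ^ m * ev p z))%C).
  { intro z; rewrite <- ev_pow; reflexivity. }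
  assert (HKm : 0 < (K + 1) ^ m) by (apply pow_lt; lra).
  split; [|split].
  - rewrite Hev, HP, Cpow_C1; field; exact Hp.
  - apply Rdiv_lt_0_compat; lra.
  - intros z Hz H; rewrite Hev, !Cnorm_mul, Cnorm_pow, Cnorm_inv in H by exact Hp; fold e in H.
    specialize (HMb z Hz); specialize (HKb z Hz).
    pose proof (Cnorm_ge0 (ev P z)); pose proof (Cnorm_ge0 (ev p z)).
    assert (H2 : e / 2 <= Cnorm (ev P z) ^ m * Cnorm (ev p z)).
    { apply Rmult_le_compat_l with (r := e) in H; [|lra].
      rewrite <- Rmult_assoc, Rinv_r, Rmult_1_l in H by lra; lra. }
    assert (0 <= Cnorm (ev P z) ^ m) by (apply pow_le; lra).
    split.
    + apply Rnot_lt_le; intro Hlt.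
      assert (Cnorm (ev P z) ^ m <= (/2)^m) by (apply pow_incr; lra).
      apply Rmult_lt_compat_r with (r := 2 * (M + 1)) in Hm; [|lra].
      replace (e / (2 * (M + 1)) * (2 * (M + 1))) with e in Hm by (field; lra).
      nra.
    + assert (Cnorm (ev P z) ^ m <= (K + 1) ^ m) by (apply pow_incr; lra).
      apply Rmult_le_reg_r with (2 * (K + 1) ^ m); [lra|].
      replace (e / (2 * (K + 1) ^ m) * (2 * (K + 1) ^ m)) with e by (field; lra). nra.
Qed.

(** The regions |P n| >= 1/2 decrease with n. Infinitely many conditions on one point can therefore
    be met by a limit of points that satisfy only the n-th condition. *)
Lemma damped_products (B : R) (p : nat -> poly4) : (forall n, ev (p n) O3 <> C0) ->
  exists (P : nat -> poly4) (c : nat -> R), (forall n, ev (P n) O3 = C1) /\ (forall n, 0 < c n) /\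
    forall n z, n3 z <= B -> /2 <= Cnorm (ev (P (S n)) z) ->
      /2 <= Cnorm (ev (P n) z) /\ c n <= Cnorm (ev (p n) z).
Proof.
  intro Hp.
  assert (Hch : forall n (P : {P | ev P O3 = C1}), exists Pc : {P | ev P O3 = C1} * R,
    0 < snd Pc /\ forall z, n3 z <= B -> /2 <= Cnorm (ev (proj1_sig (fst Pc)) z) ->
    /2 <= Cnorm (ev (proj1_sig P) z) /\ snd Pc <= Cnorm (ev (p n) z)).
  { intros n [P HP]; destruct (damped_product B P (p n) HP (Hp n)) as (P' & c & H1 & H2 & H3).
    exists (exist (fun P => ev P O3 = C1) P' H1, c); simpl; auto. }
  set (next := fun n P => proj1_sig (constructive_indefinite_description _ (Hch n P))).
  assert (Hn : forall n P, 0 < snd (next n P) /\ forall z, n3 z <= B ->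
     /2 <= Cnorm (ev (proj1_sig (fst (next n P))) z) ->
    /2 <= Cnorm (ev (proj1_sig P) z) /\ snd (next n P) <= Cnorm (ev (p n) z)).
  { intros n P; unfold next; destruct constructive_indefinite_description; assumption. }
  set (Q := fix Q n := match n with O => exist (fun P => ev P O3 = C1) (Pconst C1) eq_refl
                       | S k => fst (next k (Q k)) end).
  exists (fun n => proj1_sig (Q n)), (fun n => snd (next n (Q n))); split; [|split].
  - intro n; exact (proj2_sig (Q n)).
  - intro n; apply Hn.
  - intros n z Hz H; exact (proj2 (Hn n (Q n)) z Hz H).
Qed.

Lemma bolzano_weierstrass_C3 (u : nat -> C3) (B : R) : (forall n, n3 (u n) <= B) ->
  exists phi l, incr_seq phi /\ seqcv d3 (fun n => u (phi n)) l.
Proof.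
  intro HB.
  assert (H : forall n, Cnorm (x1 (u n)) <= B /\ Cnorm (x2 (u n)) <= B /\ Cnorm (x3 (u n)) <= B).
  { intro n; specialize (HB n); unfold n3 in HB.
    pose proof (Cnorm_ge0 (x1 (u n))); pose proof (Cnorm_ge0 (x2 (u n))); pose proof (Cnorm_ge0 (x3 (u n))); lra. }
  destruct (bolzano_weierstrass_C (fun n => x1 (u n)) B) as (f & a & Hf & Ha); [intro; apply H|].
  destruct (bolzano_weierstrass_C (fun n => x2 (u (f n))) B) as (g & b & Hg & Hb); [intro; apply H|].
  destruct (bolzano_weierstrass_C (fun n => x3 (u (f (g n)))) B) as (h & c & Hh & Hc); [intro; apply H|].
  exists (fun n => f (g (h n))), (a, b, c); split.
  - intro n; apply incr_seq_lt; [exact Hf|]; apply incr_seq_lt; [exact Hg|apply Hh].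
  - intros eps He.
    assert (Hgh : incr_seq (fun n => g (h n))) by (intro n; apply incr_seq_lt; [exact Hg|apply Hh]).
    apply (seqcv_sub _ _ _ _ Hgh) in Ha; apply (seqcv_sub _ _ _ _ Hh) in Hb.
    destruct (Ha (eps/3) ltac:(lra)) as [N1 H1]; destruct (Hb (eps/3) ltac:(lra)) as [N2 H2].
    destruct (Hc (eps/3) ltac:(lra)) as [N3 H3].
    exists (max N1 (max N2 N3)); intros n Hn.
    specialize (H1 n ltac:(lia)); specialize (H2 n ltac:(lia)); specialize (H3 n ltac:(lia)).
    unfold d3; unfold x1 at 1, x2 at 1, x3 at 1; simpl fst; simpl snd; lra.
Qed.

Lemma closed_zero {U} (dU : U -> U -> R) f u a :
  continuous_on dU Cdist (fun _ => True) f -> seqcv dU u a -> (forall n, f (u n) = C0) -> f a = C0.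
Proof.
  intros Hf Hc Hz; apply NNPP; intro Hn; apply Cnorm_pos in Hn.
  destruct (continuous_seq _ _ _ f u a Hf I (fun _ => I) Hc _ Hn) as [N HN].
  specialize (HN N (Nat.le_refl _)); unfold Cdist in HN; rewrite Hz in HN.
  replace (f a - C0)%C with (f a) in HN by ring; lra.
Qed.

Lemma closed_ge {U} (dU : U -> U -> R) f u a k M :
  continuous_on dU Cdist (fun _ => True) f -> seqcv dU u a ->
  (forall n, (M <= n)%nat -> k <= Cnorm (f (u n))) -> k <= Cnorm (f a).
Proof.
  intros Hf Hc Hz; apply Rnot_lt_le; intro Hlt.
  destruct (continuous_seq _ _ _ f u a Hf I (fun _ => I) Hc (k - Cnorm (f a)) ltac:(lra)) as [N HN].
  specialize (HN (max N M) ltac:(lia)); specialize (Hz (max N M) ltac:(lia)).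
  unfold Cdist in HN; rewrite Cnorm_sub_sym in HN.
  pose proof (Cnorm_sub_ge (f (u (max N M))) (f a)); lra.
Qed.

Theorem hull_set_exists : exists (X : C3 -> Prop) (t0 : R), 0 < t0 < 2 /\
  (forall z, X z -> n3 z <= 60 /\ t0 <= rho z <= 2) /\
  (forall eps, 0 < eps -> exists de, 0 < de /\
     forall z w, X z -> X w -> Rabs (rho z - rho w) < de -> d3 z w < eps) /\
  (forall u a, (forall n, X (u n)) -> seqcv d3 u a -> X a) /\
  (forall q, ev q O3 = C0 -> exists z, X z /\ ev q z = C0) /\
  (forall p B eps, 0 < eps -> exists p' c, 0 < c /\ (forall z, X z -> c <= Cnorm (ev p' z)) /\
     forall z, n3 z <= B -> Cnorm (ev p z - ev p' z) <= eps).
Proof.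
  destruct cantor_set_exists as (S & t0 & Ht0 & S1 & S2 & S3).
  (* Normalisation at the origin needs factors that do not vanish there; the others are replaced by
     1, and a small shift recovers density below. *)
  set (p := fun n => if excluded_middle_informative (ev (polyenum n) O3 = C0)
                     then Pconst C1 else polyenum n).
  assert (Hp : forall n, ev (p n) O3 <> C0).
  { intro n; unfold p; destruct excluded_middle_informative; [exact C1_neq_C0|assumption]. }
  destruct (damped_products 60 p Hp) as (P & c & HP0 & Hc & HP).
  (* X is taken in the closure of the Cantor set, since limits of zeros have to stay in it. Range
     and modulus of continuity survive closure. *)
  set (cl := fun z => forall eps, 0 < eps -> exists s, S s /\ d3 z s < eps).
  assert (Hcl1 : forall z, cl z -> n3 z <= 60 /\ t0 <= rho z <= 2).
  { intros z Hz.
    assert (Hr : forall e, 0 < e -> t0 - e <= rho z <= 2 + e).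
    { intros e He; destruct (rho_continuous (fun _ => True) z I e He) as [d [Hd H]].
      destruct (Hz d Hd) as [s [Hs Hzs]]; specialize (H s I Hzs); unfold Rdist in H.
      apply Rabs_def2 in H; destruct (S1 s Hs); lra. }
    split; [|split]; apply Rnot_lt_le; intro Hlt.
    - destruct (Hz (n3 z - 60) ltac:(lra)) as [s [Hs Hzs]]; destruct (S1 s Hs).
      pose proof (n3_le_d3 z s); lra.
    - specialize (Hr ((t0 - rho z)/2) ltac:(lra)); lra.
    - specialize (Hr ((rho z - 2)/2) ltac:(lra)); lra. }
  exists (fun z => cl z /\ forall k, /2 <= Cnorm (ev (P k) z)), t0.
  split; [exact Ht0|]; split; [|split; [|split; [|split]]].
  - intros z [Hz _]; auto.
  - intros eps He; destruct (S2 (eps/3) ltac:(lra)) as [de [Hde H]].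
    exists (de/3); split; [lra|]; intros z w [Hz _] [Hw _] Hzw.
    destruct (rho_continuous (fun _ => True) z I (de/3) ltac:(lra)) as [d1 [Hd1 H1]].
    destruct (rho_continuous (fun _ => True) w I (de/3) ltac:(lra)) as [d2' [Hd2 H2]].
    destruct (Hz (Rmin d1 (eps/3))) as [s [Hs Hzs]]; [apply Rmin_glb_lt; lra|].
    destruct (Hw (Rmin d2' (eps/3))) as [s' [Hs' Hws]]; [apply Rmin_glb_lt; lra|].
    specialize (H1 s I (Rlt_le_trans _ _ _ Hzs (Rmin_l _ _))).
    specialize (H2 s' I (Rlt_le_trans _ _ _ Hws (Rmin_l _ _))).
    pose proof (Rmin_r d1 (eps/3)); pose proof (Rmin_r d2' (eps/3)).
    unfold Rdist in *; apply Rabs_def2 in H1, H2, Hzw.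
    specialize (H s s' Hs Hs' ltac:(apply Rabs_def1; lra)).
    pose proof (d3_triang z s w); pose proof (d3_triang s s' w); rewrite (d3_sym s' w) in *; lra.
  - intros u a Hu Ha; split.
    + intros eps He; destruct (Ha (eps/2) ltac:(lra)) as [N HN]; specialize (HN N (Nat.le_refl _)).
      destruct (proj1 (Hu N) (eps/2) ltac:(lra)) as [s [Hs Hus]]; exists s; split; [exact Hs|].
      pose proof (d3_triang a (u N) s); lra.
    + intro k; apply (closed_ge d3 (ev (P k)) u a _ O); [apply ev_continuous|exact Ha|].
      intros n _; apply Hu.
  - intros q Hq.
    (* A zero of q with |P_n| >= |P_n(0)| = 1 satisfies all earlier conditions by nesting; a limit
       point of these zeros satisfies all conditions at once. *)
    assert (Hch : forall n, exists s, S s /\ ev q s = C0 /\ 1 <= Cnorm (ev (P n) s)).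
    { intro n; destruct (S3 q (P n) Hq) as (s & Hs & Hqs & HPs); exists s.
      rewrite HP0, Cnorm_1 in HPs; auto. }
    set (s := fun n => proj1_sig (constructive_indefinite_description _ (Hch n))).
    assert (Hs : forall n, S (s n) /\ ev q (s n) = C0 /\ 1 <= Cnorm (ev (P n) (s n))).
    { intro n; unfold s; destruct constructive_indefinite_description; assumption. }
    assert (Hdown : forall n i k, (k <= i)%nat -> (i = n)%nat -> /2 <= Cnorm (ev (P k) (s n))).
    { intros n i k Hki Hi; subst i.
      assert (Hi' : forall j, (j <= n)%nat -> /2 <= Cnorm (ev (P (n - j)%nat) (s n))).
      { induction j as [|j IH]; intro Hj.
        - rewrite Nat.sub_0_r; destruct (Hs n) as (_ & _ & H); lra.
        - apply (HP (n - Datatypes.S j)%nat); [apply S1, Hs|].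
          replace (Datatypes.S (n - Datatypes.S j)) with (n - j)%nat by lia; apply IH; lia. }
      replace k with (n - (n - k))%nat by lia; apply Hi'; lia. }
    destruct (bolzano_weierstrass_C3 s 60) as (phi & z & Hphi & Hz); [intro n; apply S1, Hs|].
    exists z; split; [split|].
    + intros eps He; destruct (Hz eps He) as [N HN]; exists (s (phi N)); split; [apply Hs|apply HN; lia].
    + intro k; apply (closed_ge d3 (ev (P k)) (fun n => s (phi n)) z _ k); [apply ev_continuous|exact Hz|].
      intros n Hn; apply (Hdown (phi n) (phi n)); [|reflexivity].
      pose proof (incr_seq_ge phi n Hphi); lia.
    + apply (closed_zero d3 (ev q) (fun n => s (phi n)) z); [apply ev_continuous|exact Hz|].
      intro n; apply Hs.
  - intros q B eps He.
    (* The shift keeps |q(0) + a| >= eps/4. An approximant within eps/8 then does not vanish at the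
       origin, so it was kept in the sequence [p]. The radius [Rmax B 0] makes the approximation
       valid at the origin too. *)
    assert (Hshift : exists a, Cnorm a <= eps/2 /\ eps/4 <= Cnorm (ev q O3 + a)).
    { destruct (Rle_dec (eps/4) (Cnorm (ev q O3))) as [H|H].
      - exists C0; rewrite Cnorm_0; split; [lra|].
        replace (ev q O3 + C0)%C with (ev q O3) by ring; exact H.
      - exists (RtoC (eps/2)); rewrite Cnorm_RtoC, Rabs_right by lra; split; [lra|].
        replace (ev q O3 + RtoC (eps/2))%C with (RtoC (eps/2) - (- ev q O3))%C by ring.
        pose proof (Cnorm_sub_ge (RtoC (eps/2)) (- ev q O3)) as H0.
        rewrite Cnorm_opp, Cnorm_RtoC, Rabs_right in H0 by lra; lra. }
    destruct Hshift as [a [Ha1 Ha2]].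
    destruct (polyenum_dense (Padd q (Pconst a)) (Rmax B 0) (eps/8) ltac:(lra)) as [n Hn].
    change (forall z, n3 z <= Rmax B 0 -> Cnorm (ev q z + a - ev (polyenum n) z) <= eps/8) in Hn.
    assert (Hpn : p n = polyenum n).
    { unfold p; destruct excluded_middle_informative as [E|E]; [exfalso|reflexivity].
      assert (Hz : n3 O3 <= Rmax B 0).
      { unfold n3, O3, x1, x2, x3; simpl; rewrite Cnorm_0; pose proof (Rmax_r B 0); lra. }
      specialize (Hn O3 Hz); rewrite E in Hn.
      replace (ev q O3 + a - C0)%C with (ev q O3 + a)%C in Hn by ring; lra. }
    exists (p n), (c n); split; [apply Hc|split].
    + intros z [Hz Hk]; apply (HP n z); [apply Hcl1, Hz|apply Hk].
    + intros z Hz; rewrite Hpn; specialize (Hn z (Rle_trans _ _ _ Hz (Rmax_l _ _))).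
      replace (ev q z - ev (polyenum n) z)%C with ((ev q z + a - ev (polyenum n) z) - a)%C by ring.
      eapply Rle_trans; [apply Cnorm_sub_le|]; lra.
Qed.

(** * Interpolation on the gaps of a closed set *)

Definition gap (T : R -> Prop) (al be : R) : Prop :=
  T al /\ T be /\ al < be /\ forall s, al < s < be -> ~ T s.

Section Interpolation.
Variables (T : R -> Prop) (a b : R).
Hypothesis Ta : T a.
Hypothesis Tb : T b.
Hypothesis T_range : forall t, T t -> a <= t <= b.
Hypothesis T_closed : forall t, (forall eps, 0 < eps -> exists s, T s /\ Rabs (t - s) < eps) -> T t.

Lemma gap_around t : a <= t <= b -> ~ T t -> exists al be, gap T al be /\ al < t < be.
Proof.
  intros Ht HT.
  destruct (completeness (fun s => T s /\ s <= t)) as [al [Hub Hlub]].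
  { exists t; intros s [_ H]; exact H. }
  { exists a; split; [exact Ta|lra]. }
  (* The right end of the gap is an infimum, obtained as minus the supremum of the reflected set. *)
  destruct (completeness (fun s => T (- s) /\ t <= - s)) as [nb [Hub' Hlub']].
  { exists (- t); intros s [_ H]; lra. }
  { exists (- b); rewrite Ropp_involutive; split; [exact Tb|lra]. }
  set (be := - nb).
  assert (Hal : T al).
  { apply T_closed; intros eps He; apply NNPP; intro Hn.
    assert (al <= al - eps); [|lra].
    apply Hlub; intros s [Hs Hst]; apply Rnot_lt_le; intro Hlt; apply Hn; exists s; split; [exact Hs|].
    assert (s <= al) by (apply Hub; split; assumption); rewrite Rabs_right; lra. }
  assert (Hbe : T be).
  { apply T_closed; intros eps He; apply NNPP; intro Hn.
    assert (nb <= nb - eps); [|lra].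
    apply Hlub'; intros s [Hs Hst]; apply Rnot_lt_le; intro Hlt; apply Hn; exists (- s); split; [exact Hs|].
    assert (s <= nb) by (apply Hub'; split; assumption); unfold be; rewrite Rabs_left1; lra. }
  assert (Hal' : al <= t) by (apply Hlub; intros s [_ H]; exact H).
  assert (Hbe' : t <= be).
  { assert (nb <= - t) by (apply Hlub'; intros s [_ H]; lra); unfold be; lra. }
  assert (al <> t) by (intro E; subst; contradiction).
  assert (be <> t) by (intro E; rewrite E in Hbe; contradiction).
  exists al, be; split; [|lra].
  split; [exact Hal|]; split; [exact Hbe|]; split; [lra|].
  intros s Hs HTs; destruct (Rle_dec s t) as [H1|H1].
  - assert (s <= al) by (apply Hub; split; assumption); lra.
  - assert (- s <= nb) by (apply Hub'; rewrite Ropp_involutive; split; [assumption|lra]).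
    unfold be in Hs; lra.
Qed.

Lemma gap_unique t al be al' be' : gap T al be -> gap T al' be' -> al < t < be -> al' < t < be' ->
  al = al' /\ be = be'.
Proof.
  intros (H1 & H2 & H3 & H4) (H1' & H2' & H3' & H4') Ht Ht'.
  split; apply Rle_antisym; apply Rnot_lt_le; intro Hlt.
  - apply (H4' al); [lra|assumption].
  - apply (H4 al'); [lra|assumption].
  - apply (H4 be'); [lra|assumption].
  - apply (H4' be); [lra|assumption].
Qed.

Lemma gap_between t t' : a <= t -> t < t' -> t' <= b -> (forall s, t < s < t' -> ~ T s) ->
  exists al be, gap T al be /\ al <= t /\ t' <= be.
Proof.
  intros Ha Hlt Hb Hno.
  destruct (gap_around ((t + t')/2)) as (al & be & Hg & Hm); [lra|apply Hno; lra|].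
  exists al, be; split; [exact Hg|]; destruct Hg as (H1 & H2 & _).
  split; apply Rnot_lt_le; intro H.
  - apply (Hno al); [lra|exact H1].
  - apply (Hno be); [lra|exact H2].
Qed.

Variables (v : R -> R) (B : R).
Hypothesis v_bounded : forall t, T t -> Rabs (v t) <= B.
Hypothesis v_unif : forall eps, 0 < eps -> exists de, 0 < de /\
  forall s s', T s -> T s' -> Rabs (s - s') < de -> Rabs (v s - v s') < eps.

Definition interp (t : R) : R :=
  match excluded_middle_informative (exists q : R * R, gap T (fst q) (snd q) /\ fst q < t < snd q) with
  | left H => let q := proj1_sig (constructive_indefinite_description _ H) in
      v (fst q) + (t - fst q) / (snd q - fst q) * (v (snd q) - v (fst q))
  | right _ => v t
  end.

Lemma interp_on t : T t -> interp t = v t.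
Proof.
  intro Ht; unfold interp; destruct excluded_middle_informative as [H|H]; [|reflexivity].
  exfalso; destruct H as [q [(_ & _ & _ & Hq) Hqt]]; exact (Hq t Hqt Ht).
Qed.

Lemma interp_gap al be t : gap T al be -> al <= t <= be ->
  interp t = v al + (t - al) / (be - al) * (v be - v al).
Proof.
  intros Hg Ht; assert (Hg' := Hg); destruct Hg' as (H1 & H2 & H3 & _).
  destruct (Req_dec t al) as [->|Hal].
  { rewrite interp_on by exact H1; field; lra. }
  destruct (Req_dec t be) as [->|Hbe].
  { rewrite interp_on by exact H2; field; lra. }
  unfold interp; destruct excluded_middle_informative as [H|H].
  - destruct constructive_indefinite_description as [[al' be'] [Hg' Ht']]; simpl in *.
    destruct (gap_unique t al be al' be' Hg Hg' ltac:(lra) Ht') as [-> ->]; reflexivity.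
  - exfalso; apply H; exists (al, be); simpl; split; [exact Hg|lra].
Qed.

Lemma interp_lipschitz al be t t' : gap T al be -> al <= t <= be -> al <= t' <= be ->
  Rabs (interp t - interp t') = Rabs (v be - v al) / (be - al) * Rabs (t - t').
Proof.
  intros Hg Ht Ht'; rewrite !(interp_gap al be) by assumption.
  destruct Hg as (_ & _ & H & _).
  replace (v al + (t - al) / (be - al) * (v be - v al) - (v al + (t' - al) / (be - al) * (v be - v al)))
    with ((v be - v al) * / (be - al) * (t - t')) by (field; lra).
  rewrite !Rabs_mult, (Rabs_right (/ (be - al))); [reflexivity|].
  apply Rle_ge; left; apply Rinv_0_lt_compat; lra.
Qed.

Lemma B_ge0 : 0 <= B.
Proof. pose proof (v_bounded a Ta); pose proof (Rabs_pos (v a)); lra. Qed.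

Lemma interp_lipschitz_long al be t t' l : gap T al be -> al <= t <= be -> al <= t' <= be ->
  0 < l -> l <= be - al -> Rabs (interp t - interp t') <= 2 * B / l * Rabs (t - t').
Proof.
  intros Hg Ht Ht' Hl Hle; rewrite (interp_lipschitz al be) by assumption.
  apply Rmult_le_compat_r; [apply Rabs_pos|].
  destruct Hg as (H1 & H2 & _).
  apply v_bounded in H1, H2; pose proof B_ge0.
  assert (Rabs (v be - v al) <= 2 * B).
  { unfold Rminus; eapply Rle_trans; [apply Rabs_triang|]; rewrite Rabs_Ropp; lra. }
  unfold Rdiv; apply Rmult_le_compat; [apply Rabs_pos|left; apply Rinv_0_lt_compat; lra|assumption|].
  apply Rinv_le_contravar; lra.
Qed.

Lemma interp_bounded t : a <= t <= b -> Rabs (interp t) <= B.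
Proof.
  intro Ht; destruct (classic (T t)) as [HT|HT]; [rewrite interp_on by exact HT; auto|].
  destruct (gap_around t Ht HT) as (al & be & Hg & Hm).
  rewrite (interp_gap al be) by (assumption || lra).
  destruct Hg as (H1 & H2 & H3 & _); apply v_bounded in H1, H2.
  set (k := (t - al) / (be - al)).
  assert (0 <= k <= 1).
  { unfold k; split; [apply Rmult_le_pos; [lra|left; apply Rinv_0_lt_compat; lra]|].
    apply Rmult_le_reg_r with (be - al); [lra|]; unfold Rdiv; rewrite Rmult_assoc, Rinv_l by lra; lra. }
  replace (v al + k * (v be - v al)) with ((1 - k) * v al + k * v be) by ring.
  eapply Rle_trans; [apply Rabs_triang|]; rewrite !Rabs_mult, (Rabs_right k), (Rabs_right (1 - k)) by lra.
  nra.
Qed.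

(** On a gap shorter than [d] the whole variation is a difference of end values, already below eps;
    on a longer gap the slope is at most 2B/d. *)
Lemma interp_unif_gap eps : 0 < eps -> exists de, 0 < de /\ forall al be t t', gap T al be ->
  al <= t <= be -> al <= t' <= be -> Rabs (t - t') < de -> Rabs (interp t - interp t') < eps.
Proof.
  intro He; destruct (v_unif eps He) as [d [Hd H]]; pose proof B_ge0 as HB.
  exists (eps * d / (2 * B + 1)); split; [apply Rdiv_lt_0_compat; [nra|lra]|].
  intros al be t t' Hg Ht Ht' Hde.
  destruct (Rlt_dec (be - al) d) as [Hs|Hs].
  - rewrite (interp_lipschitz al be) by assumption.
    destruct Hg as (H1 & H2 & H3 & _).
    specialize (H be al H2 H1 ltac:(rewrite Rabs_right; lra)).
    assert (Rabs (t - t') <= be - al) by (apply Rabs_le; lra).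
    pose proof (Rabs_pos (v be - v al)); pose proof (Rabs_pos (t - t')).
    apply Rle_lt_trans with (Rabs (v be - v al)); [|exact H].
    apply Rmult_le_reg_r with (be - al); [lra|].
    replace (Rabs (v be - v al) / (be - al) * Rabs (t - t') * (be - al))
      with (Rabs (v be - v al) * Rabs (t - t')) by (field; lra). nra.
  - eapply Rle_lt_trans; [apply (interp_lipschitz_long al be t t' d); try assumption; lra|].
    apply Rle_lt_trans with (2 * B / d * (eps * d / (2 * B + 1))).
    { apply Rmult_le_compat_l; [|lra]; apply Rmult_le_pos; [lra|left; apply Rinv_0_lt_compat, Hd]. }
    replace (2 * B / d * (eps * d / (2 * B + 1))) with (2 * B * eps / (2 * B + 1)) by (field; lra).
    apply Rmult_lt_reg_r with (2 * B + 1); [lra|].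
    replace (2 * B * eps / (2 * B + 1) * (2 * B + 1)) with (2 * B * eps) by (field; lra). nra.
Qed.

(** If T meets the segment from t to t', the path is cut at the end of the gap containing t and the
    start of the gap containing t', one third of eps for each piece. Otherwise both points lie in
    one gap. *)
Lemma interp_unif eps : 0 < eps -> exists de, 0 < de /\ forall t t', a <= t <= b -> a <= t' <= b ->
  Rabs (t - t') < de -> Rabs (interp t - interp t') < eps.
Proof.
  intro He; destruct (interp_unif_gap (eps/3) ltac:(lra)) as [d1 [Hd1 H1]].
  destruct (v_unif (eps/3) ltac:(lra)) as [d2 [Hd2 H2]].
  exists (Rmin d1 d2); split; [apply Rmin_glb_lt; assumption|].
  assert (Hmain : forall t t', a <= t <= b -> a <= t' <= b -> t < t' -> t' - t < Rmin d1 d2 ->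
     Rabs (interp t - interp t') < eps).
  { intros t t' Ht Ht' Hlt Hde.
    pose proof (Rmin_l d1 d2); pose proof (Rmin_r d1 d2).
    destruct (classic (exists s, T s /\ t <= s <= t')) as [[s [Hs Hst]]|Hno].
    - assert (Hbe : exists be, T be /\ t <= be <= t' /\ Rabs (interp t - interp be) < eps/3).
      { destruct (classic (T t)) as [HT|HT].
        - exists t; split; [exact HT|]; split; [lra|].
          replace (interp t - interp t) with 0 by ring; rewrite Rabs_R0; lra.
        - destruct (gap_around t Ht HT) as (al & be & Hg & Hm); assert (Hg' := Hg).
          destruct Hg' as (G1 & G2 & G3 & G4).
          assert (be <= s).
          { apply Rnot_lt_le; intro Hn; destruct (Req_dec s t) as [->|]; [contradiction|].
            apply (G4 s); [lra|exact Hs]. }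
          exists be; split; [exact G2|]; split; [lra|].
          apply (H1 al be); try assumption; try lra; rewrite Rabs_left; lra. }
      assert (Hal : exists al, T al /\ t <= al <= t' /\ Rabs (interp al - interp t') < eps/3).
      { destruct (classic (T t')) as [HT|HT].
        - exists t'; split; [exact HT|]; split; [lra|].
          replace (interp t' - interp t') with 0 by ring; rewrite Rabs_R0; lra.
        - destruct (gap_around t' Ht' HT) as (al & be & Hg & Hm); assert (Hg' := Hg).
          destruct Hg' as (G1 & G2 & G3 & G4).
          assert (s <= al).
          { apply Rnot_lt_le; intro Hn; destruct (Req_dec s t') as [->|]; [contradiction|].
            apply (G4 s); [lra|exact Hs]. }
          exists al; split; [exact G1|]; split; [lra|].
          apply (H1 al be); try assumption; try lra; rewrite Rabs_left; lra. }
      destruct Hbe as (be & B1 & B2 & B3); destruct Hal as (al & A1 & A2 & A3).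
      assert (Hv : Rabs (interp be - interp al) < eps/3).
      { rewrite !interp_on by assumption; apply H2; try assumption; apply Rabs_def1; lra. }
      replace (interp t - interp t')
        with ((interp t - interp be) + (interp be - interp al) + (interp al - interp t')) by ring.
      eapply Rle_lt_trans; [apply Rabs_triang|].
      eapply Rle_lt_trans; [apply Rplus_le_compat_r, Rabs_triang|]; lra.
    - destruct (gap_between t t') as (al & be & Hg & G1 & G2); try lra.
      { intros s Hs HT; apply Hno; exists s; split; [exact HT|lra]. }
      apply Rlt_trans with (eps/3); [|lra].
      apply (H1 al be); try assumption; try lra; rewrite Rabs_left; lra. }
  intros t t' Ht Ht' Hde.
  destruct (Rtotal_order t t') as [H|[->|H]].
  - apply Hmain; try assumption; rewrite Rabs_left in Hde; lra.
  - replace (interp t' - interp t') with 0 by ring; rewrite Rabs_R0; lra.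
  - rewrite Rabs_minus_sym; apply Hmain; try assumption; rewrite Rabs_right in Hde; lra.
Qed.
End Interpolation.

(** * Thin subsets of the plane *)

(** Box counting: at scale 1/N the set is covered by O(N) pieces of diameter O(1/N), as for a
    rectifiable curve, whereas a disc needs order N^2. The cover is encoded by a labelling of the
    points. *)
Definition thin (E : C -> Prop) : Prop := exists (L : R) (M N0 : nat), 0 <= L /\
  forall N, (N0 <= N)%nat -> (0 < N)%nat -> exists lab : C -> nat,
    (forall e, E e -> (lab e < M * N)%nat) /\
    (forall e e', E e -> E e' -> lab e = lab e' -> Cnorm (e - e') <= L / INR N).

Lemma thin_union E F : thin E -> thin F -> thin (fun e => E e \/ F e).
Proof.
  intros (L & M & N0 & HL & H) (L' & M' & N0' & HL' & H').
  exists (L + L'), (M + M')%nat, (max N0 N0'); split; [lra|]; intros N HN HN0.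
  destruct (H N ltac:(lia) HN0) as (lab & Hl1 & Hl2); destruct (H' N ltac:(lia) HN0) as (lab' & Hl1' & Hl2').
  exists (fun e => if excluded_middle_informative (E e) then lab e else (M * N + lab' e)%nat).
  assert (HNp : 0 < INR N) by (apply lt_0_INR; lia).
  assert (HLN : 0 <= L / INR N) by (apply Rmult_le_pos; [lra|left; apply Rinv_0_lt_compat, HNp]).
  assert (HLN' : 0 <= L' / INR N) by (apply Rmult_le_pos; [lra|left; apply Rinv_0_lt_compat, HNp]).
  assert (Ed : (L + L') / INR N = L / INR N + L' / INR N) by (field; lra).
  split.
  - intros e He; destruct excluded_middle_informative as [HE|HE].
    + specialize (Hl1 e HE); nia.
    + destruct He as [He|He]; [contradiction|]; specialize (Hl1' e He); nia.
  - intros e e' He He' Heq; rewrite Ed.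
    destruct excluded_middle_informative as [HE|HE]; destruct excluded_middle_informative as [HE'|HE'].
    + pose proof (Hl2 e e' HE HE' Heq); lra.
    + specialize (Hl1 e HE); lia.
    + specialize (Hl1 e' HE'); lia.
    + destruct He as [He|He]; [contradiction|]; destruct He' as [He'|He']; [contradiction|].
      pose proof (Hl2' e e' He He' ltac:(lia)); lra.
Qed.

(** Points are labelled by the cell of one of their parameters. The Lipschitz bound holds only for
    parameters closer than [d], hence cells of length below [d]. *)
Lemma thin_image (D : R -> Prop) (phi : R -> C) (a b d L : R) : a < b -> 0 < d -> 0 <= L ->
  (forall t, D t -> a <= t <= b) ->
  (forall t t', D t -> D t' -> Rabs (t - t') < d -> Cnorm (phi t - phi t') <= L * Rabs (t - t')) ->
  thin (fun e => exists t, D t /\ e = phi t).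
Proof.
  intros Hab Hd HL HD Hlip.
  destruct (INR_unbounded ((b - a) / d)) as [N0 HN0].
  (* The integer parts run over 0, ..., N, that is N + 1 <= 2N labels. *)
  exists (L * (b - a)), 2%nat, N0; split; [nra|]; intros N HN HNp.
  assert (HNR : 0 < INR N) by (apply lt_0_INR; lia).
  assert (HNd : (b - a) / INR N < d).
  { apply Rmult_lt_reg_r with (INR N); [exact HNR|].
    replace ((b - a) / INR N * INR N) with (b - a) by (field; lra).
    apply le_INR in HN.
    assert (b - a < d * INR N0).
    { apply Rmult_lt_reg_r with (/ d); [apply Rinv_0_lt_compat, Hd|].
      replace (d * INR N0 * / d) with (INR N0) by (field; lra); exact HN0. }
    nra. }
  set (fl := fun t => Z.to_nat (up ((t - a) / (b - a) * INR N) - 1)).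
  assert (Hfl : forall t, a <= t <= b -> (fl t < 2 * N)%nat /\
     INR (fl t) <= (t - a) / (b - a) * INR N <= INR (fl t) + 1).
  { intros t Ht; set (r := (t - a) / (b - a) * INR N).
    assert (Hr : 0 <= r <= INR N).
    { assert (0 <= (t - a) / (b - a) <= 1).
      { split; [apply Rmult_le_pos; [lra|left; apply Rinv_0_lt_compat; lra]|].
        apply Rmult_le_reg_r with (b - a); [lra|].
        replace ((t - a) / (b - a) * (b - a)) with (t - a) by (field; lra); lra. }
      unfold r; nra. }
    destruct (archimed r) as [A1 A2].
    assert (Hz : (0 <= up r - 1)%Z).
    { assert (0 < up r)%Z by (apply lt_IZR; lra); lia. }
    assert (EI : INR (fl t) = IZR (up r) - 1).
    { unfold fl; fold r; rewrite INR_IZR_INZ, Z2Nat.id, minus_IZR by exact Hz; reflexivity. }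
    split; [|rewrite EI; lra].
    apply INR_lt; rewrite EI, mult_INR; simpl; assert (1 <= INR N) by (apply (le_INR 1); lia); lra. }
  set (par := fun e => match excluded_middle_informative (exists t, D t /\ e = phi t) with
     | left H => proj1_sig (constructive_indefinite_description _ H) | right _ => a end).
  assert (Hpar : forall e, (exists t, D t /\ e = phi t) -> D (par e) /\ e = phi (par e)).
  { intros e He; unfold par; destruct excluded_middle_informative; [|contradiction].
    destruct constructive_indefinite_description; assumption. }
  exists (fun e => fl (par e)); split.
  - intros e He; apply Hfl, HD, Hpar, He.
  - intros e e' He He' Heq; destruct (Hpar e He) as [P1 P2]; destruct (Hpar e' He') as [P1' P2'].
    rewrite P2, P2'; set (t := par e) in *; set (t' := par e') in *.
    destruct (Hfl t (HD t P1)) as [_ F]; destruct (Hfl t' (HD t' P1')) as [_ F']; rewrite Heq in F.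
    assert (Habs : Rabs (t - t') <= (b - a) / INR N).
    { assert (E : t - t' = ((b - a) / INR N) * ((t - a) / (b - a) * INR N - (t' - a) / (b - a) * INR N))
        by (field; lra).
      rewrite E, Rabs_mult, (Rabs_right ((b - a) / INR N)).
      2:{ apply Rle_ge, Rmult_le_pos; [lra|left; apply Rinv_0_lt_compat, HNR]. }
      rewrite <- (Rmult_1_r ((b - a) / INR N)) at 2; apply Rmult_le_compat_l.
      - apply Rmult_le_pos; [lra|left; apply Rinv_0_lt_compat, HNR].
      - apply Rabs_le; lra. }
    eapply Rle_trans; [apply Hlip; [exact P1|exact P1'|lra]|].
    unfold Rdiv in *; rewrite Rmult_assoc; apply Rmult_le_compat_l; [exact HL|exact Habs].
Qed.

(* Pigeonhole: a grid of [K^2] points of mesh of order [1/N] does not fit in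
   [M N < K^2] pieces of smaller diameter. *)
Lemma thin_avoid E eps : thin E -> 0 < eps -> exists c, Cnorm c < eps /\ ~ E c.
Proof.
  intros (L & M & N0 & HL & H) He; apply NNPP; intro Hno.
  assert (Hall : forall c, Cnorm c < eps -> E c).
  { intros c Hc; apply NNPP; intro HE; apply Hno; exists c; auto. }
  destruct (INR_unbounded (2 * (L + 1) / eps)) as [q0 Hq0].
  (* With these values K^2 = (M + 1) N > M N, so the grid has more points than there are labels,
     while K/N = 1/q makes its side K h = (L + 1)/q less than eps/2. *)
  set (q := S (q0 + N0)); set (K := ((M + 1) * q)%nat); set (N := ((M + 1) * q * q)%nat).
  assert (Hq : 0 < INR q) by (apply lt_0_INR; unfold q; lia).
  assert (HN : (N0 <= N)%nat) by (unfold N, q; nia).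
  assert (HN' : (0 < N)%nat) by (unfold N, q; nia).
  destruct (H N HN HN') as (lab & Hl1 & Hl2).
  assert (HNR : 0 < INR N) by (apply lt_0_INR; exact HN').
  set (h := (L + 1) / INR N).
  assert (Hh : 0 < h) by (apply Rdiv_lt_0_compat; lra).
  assert (HhL : L / INR N < h).
  { unfold h; apply Rmult_lt_compat_r; [apply Rinv_0_lt_compat, HNR|lra]. }
  assert (HKh : 2 * (INR K * h) < eps).
  { assert (EK : INR K * h = (L + 1) / INR q).
    { unfold h, K, N; rewrite !mult_INR; field; split; [lra|].
      apply not_0_INR; lia. }
    rewrite EK; apply Rmult_lt_reg_r with (INR q); [exact Hq|].
    replace (2 * ((L + 1) / INR q) * INR q) with (2 * (L + 1)) by (field; lra).
    assert (2 * (L + 1) < eps * INR q0).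
    { apply Rmult_lt_reg_r with (/ eps); [apply Rinv_0_lt_compat, He|].
      replace (eps * INR q0 * / eps) with (INR q0) by (field; lra); exact Hq0. }
    assert (INR q0 <= INR q) by (apply le_INR; unfold q; lia). nra. }
  set (pt := fun l : nat => mkC (INR (l mod K) * h) (INR (l / K) * h)).
  assert (HK : K <> O) by (unfold K, q; lia).
  assert (Hpt : forall l, (l < K * K)%nat -> E (pt l)).
  { intros l Hl; apply Hall; eapply Rle_lt_trans; [apply Cnorm_le_parts|]; simpl.
    assert (l mod K < K)%nat by (apply Nat.mod_upper_bound, HK).
    assert (l / K < K)%nat by (apply Nat.Div0.div_lt_upper_bound; lia).
    apply lt_INR in H0, H1; pose proof (pos_INR (l mod K)); pose proof (pos_INR (l / K)).
    rewrite !Rabs_right by (apply Rle_ge; nra). nra. }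
  assert (Hinj : forall l l', (l < K * K)%nat -> (l' < K * K)%nat -> lab (pt l) = lab (pt l') -> l = l').
  { intros l l' Hl Hl' Heq.
    pose proof (Hl2 _ _ (Hpt l Hl) (Hpt l' Hl') Heq) as Hd.
    assert (Hc : forall i j : nat, Rabs (INR i * h - INR j * h) < h -> i = j).
    { intros i j Hij; rewrite <- Rmult_minus_distr_r, Rabs_mult, (Rabs_right h) in Hij by lra.
      assert (Rabs (INR i - INR j) < 1) by nra.
      destruct (Nat.lt_total i j) as [Hlt|[Heq'|Hlt]]; [|exact Heq'|];
        apply le_INR in Hlt; rewrite S_INR in Hlt; apply Rabs_def2 in H0; lra. }
    assert (E1 : (l mod K = l' mod K)%nat).
    { apply Hc; pose proof (Re_le_Cnorm (pt l - pt l')) as HR; simpl in HR; unfold Rminus; lra. }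
    assert (E2 : (l / K = l' / K)%nat).
    { apply Hc; pose proof (Im_le_Cnorm (pt l - pt l')) as HR; simpl in HR; unfold Rminus; lra. }
    rewrite (Nat.div_mod_eq l K), (Nat.div_mod_eq l' K), E1, E2; reflexivity. }
  assert (Hlen : (length (map (fun l => lab (pt l)) (seq 0 (K * K))) <= length (seq 0 (M * N)))%nat).
  { apply NoDup_incl_length.
    - apply NoDup_map_NoDup_ForallPairs; [|apply seq_NoDup].
      intros l l' Hl Hl' Heq; apply in_seq in Hl, Hl'; apply Hinj; [lia|lia|exact Heq].
    - intros e Hin; apply in_map_iff in Hin; destruct Hin as (l & <- & Hl); apply in_seq in Hl.
      apply in_seq; split; [lia|]; apply Hl1, Hpt; lia. }
  rewrite length_map, !length_seq in Hlen; unfold K, N, q in Hlen; nia.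
Qed.

(** * Arcs and simple closed curves through the Cantor set *)

(** The interface between the geometric and the algebraic half, shared by the arc and the closed
    curve. [gc_hull] expresses that the origin is in the rationally convex hull of the image. *)
Record good_curve {U : Type} (dU : U -> U -> R) (A : U -> Prop) (G : U -> C3) : Prop := {
  gc_cont : continuous_on dU d3 A G;
  gc_inj : forall s t, A s -> A t -> G s = G t -> s = t;
  gc_compact : seqcompact dU A;
  gc_origin : forall t, A t -> G t <> O3;
  gc_hull : forall q, ev q O3 = C0 -> exists t, A t /\ ev q (G t) = C0;
  gc_dense : forall p eps, 0 < eps -> exists p', (forall t, A t -> ev p' (G t) <> C0) /\
    forall t, A t -> Cnorm (ev p (G t) - ev p' (G t)) <= eps
}.

Lemma ev_lipschitz p B : exists L, 0 <= L /\ forall z w, n3 z <= B -> n3 w <= B ->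
  Cnorm (ev p z - ev p w) <= L * d3 z w.
Proof.
  induction p as [c|v|p [M [HM IHp]] q [K [HK IHq]]|p [M [HM IHp]] q [K [HK IHq]]].
  - exists 0; split; [lra|]; intros; unfold ev; simpl.
    replace (c - c)%C with C0 by ring; rewrite Cnorm_0; lra.
  - exists 1; split; [lra|]; intros z w _ _; unfold d3, Cdist.
    pose proof (Cnorm_ge0 (x1 z - x1 w)); pose proof (Cnorm_ge0 (x2 z - x2 w)).
    pose proof (Cnorm_ge0 (x3 z - x3 w)).
    destruct v; unfold ev; simpl; try lra.
    replace (C0 - C0)%C with C0 by ring; rewrite Cnorm_0; lra.
  - exists (M + K); split; [lra|]; intros z w Hz Hw.
    change (Cnorm (ev p z + ev q z - (ev p w + ev q w)) <= (M + K) * d3 z w).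
    replace (ev p z + ev q z - (ev p w + ev q w))%C
      with ((ev p z - ev p w) + (ev q z - ev q w))%C by ring.
    eapply Rle_trans; [apply Cnorm_triang|]; specialize (IHp z w Hz Hw); specialize (IHq z w Hz Hw); lra.
  - destruct (ev_bounded p B) as [P [HP HPb]]; destruct (ev_bounded q B) as [Q [HQ HQb]].
    exists (P * K + M * Q); split; [nra|]; intros z w Hz Hw.
    change (Cnorm (ev p z * ev q z - ev p w * ev q w) <= (P * K + M * Q) * d3 z w).
    replace (ev p z * ev q z - ev p w * ev q w)%C
      with (ev p z * (ev q z - ev q w) + (ev p z - ev p w) * ev q w)%C by ring.
    eapply Rle_trans; [apply Cnorm_triang|].
    pose proof (Cnorm_mul_le _ _ _ _ (HPb z Hz) (IHq z w Hz Hw)).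
    pose proof (Cnorm_mul_le _ _ _ _ (IHp z w Hz Hw) (HQb w Hw)); lra.
Qed.

Lemma d3_eq0 z w : d3 z w = 0 -> z = w.
Proof.
  destruct z as [[z1 z2] z3], w as [[w1 w2] w3]; unfold d3, Cdist, x1, x2, x3; simpl; intro H.
  pose proof (Cnorm_ge0 (z1 - w1)); pose proof (Cnorm_ge0 (z2 - w2)); pose proof (Cnorm_ge0 (z3 - w3)).
  repeat f_equal; apply Csub_eq0, Cnorm_eq0; lra.
Qed.

Lemma d3_self z : d3 z z = 0.
Proof.
  unfold d3, Cdist; replace (x1 z - x1 z)%C with C0 by ring; replace (x2 z - x2 z)%C with C0 by ring.
  replace (x3 z - x3 z)%C with C0 by ring; rewrite Cnorm_0; ring.
Qed.

Lemma rho_O3 : rho O3 = 0.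
Proof. unfold rho, O3, x1, x2, x3, sqn; simpl; ring. Qed.

Definition fRe1 (z : C3) := Re (x1 z).
Definition fIm1 (z : C3) := Im (x1 z).
Definition fRe2 (z : C3) := Re (x2 z).
Definition fIm2 (z : C3) := Im (x2 z).
Definition fIm3 (z : C3) := Im (x3 z).
(** The sixth real coordinate Re x3 is left out: it is recovered from the prescribed value of
    rho. *)
Definition coord5 (f : C3 -> R) : Prop := f = fRe1 \/ f = fIm1 \/ f = fRe2 \/ f = fIm2 \/ f = fIm3.

Lemma coord5_lip f z w : coord5 f -> Rabs (f z - f w) <= d3 z w.
Proof.
  intro Hf; unfold d3, Cdist.
  pose proof (Cnorm_ge0 (x1 z - x1 w)); pose proof (Cnorm_ge0 (x2 z - x2 w)).
  pose proof (Cnorm_ge0 (x3 z - x3 w)).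
  pose proof (Re_le_Cnorm (x1 z - x1 w)); pose proof (Im_le_Cnorm (x1 z - x1 w)).
  pose proof (Re_le_Cnorm (x2 z - x2 w)); pose proof (Im_le_Cnorm (x2 z - x2 w)).
  pose proof (Im_le_Cnorm (x3 z - x3 w)); simpl in *; unfold Rminus.
  destruct Hf as [-> | [-> | [-> | [-> | ->]]]]; unfold fRe1, fIm1, fRe2, fIm2, fIm3; lra.
Qed.

Lemma coord5_bound f z : coord5 f -> Rabs (f z) <= n3 z.
Proof.
  intro Hf; unfold n3.
  pose proof (Cnorm_ge0 (x1 z)); pose proof (Cnorm_ge0 (x2 z)); pose proof (Cnorm_ge0 (x3 z)).
  pose proof (Re_le_Cnorm (x1 z)); pose proof (Im_le_Cnorm (x1 z)).
  pose proof (Re_le_Cnorm (x2 z)); pose proof (Im_le_Cnorm (x2 z)); pose proof (Im_le_Cnorm (x3 z)).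
  destruct Hf as [-> | [-> | [-> | [-> | ->]]]]; unfold fRe1, fIm1, fRe2, fIm2, fIm3; lra.
Qed.

Section Curves.
Variables (X : C3 -> Prop) (t0 : R).
Hypothesis t0_range : 0 < t0 < 2.
Hypothesis X_range : forall z, X z -> n3 z <= 60 /\ t0 <= rho z <= 2.
Hypothesis X_modulus : forall eps, 0 < eps -> exists de, 0 < de /\
     forall z w, X z -> X w -> Rabs (rho z - rho w) < de -> d3 z w < eps.
Hypothesis X_closed : forall u a, (forall n, X (u n)) -> seqcv d3 u a -> X a.
Hypothesis X_hull : forall q, ev q O3 = C0 -> exists z, X z /\ ev q z = C0.
Hypothesis X_dense : forall p B eps, 0 < eps -> exists p' c, 0 < c /\
     (forall z, X z -> c <= Cnorm (ev p' z)) /\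
     forall z, n3 z <= B -> Cnorm (ev p z - ev p' z) <= eps.

(** The parameters [a] and [b] lie strictly outside the range [t0, 2] of rho on X, with a > 0. The
    added end points sit on the Re x3 axis, where rho is the parameter and where a return branch can
    be attached. *)
Let a := t0 / 2.
Let b := 3.
Let endpt (t : R) : C3 := (C0, C0, RtoC t).
Let X' (z : C3) := X z \/ z = endpt a \/ z = endpt b.
Let T (t : R) := exists z, X' z /\ rho z = t.

Lemma rho_endpt t : rho (endpt t) = t.
Proof. unfold rho, endpt, x1, x2, x3, sqn, RtoC; simpl; ring. Qed.

Lemma X'_modulus eps : 0 < eps -> exists de, 0 < de /\
  forall z w, X' z -> X' w -> Rabs (rho z - rho w) < de -> d3 z w < eps.
Proof.
  intro He; destruct (X_modulus eps He) as [d [Hd H]].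
  (* rho separates X from the lower end point by at least [a] and from the upper one by at least 1,
     so no pair of close values mixes them. *)
  exists (Rmin d (Rmin a 1)); split; [repeat apply Rmin_glb_lt; unfold a; lra|].
  assert (M1 := Rmin_l d (Rmin a 1)); assert (M2 := Rle_trans _ _ _ (Rmin_r d (Rmin a 1)) (Rmin_l a 1)).
  assert (M3 := Rle_trans _ _ _ (Rmin_r d (Rmin a 1)) (Rmin_r a 1)).
  intros z w Hz Hw Hd'; pose proof (Rabs_def2 _ _ Hd') as Hd2.
  destruct Hz as [Hz|[->| ->]]; destruct Hw as [Hw|[->| ->]]; rewrite ?rho_endpt in *;
    try (rewrite d3_self; exact He);
    try (pose proof (X_range _ Hz)); try (pose proof (X_range _ Hw)); unfold a, b in *; try lra.
  apply H; try assumption; lra.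
Qed.

Lemma X'_inj z w : X' z -> X' w -> rho z = rho w -> z = w.
Proof.
  intros Hz Hw E; apply d3_eq0, Rle_antisym; [|apply d3_ge0].
  apply Rnot_lt_le; intro Hlt; destruct (X'_modulus _ Hlt) as [d [Hd H]].
  specialize (H z w Hz Hw); rewrite E in H; replace (rho w - rho w) with 0 in H by ring.
  rewrite Rabs_R0 in H; specialize (H Hd); lra.
Qed.

Let vz (t : R) : C3 :=
  match excluded_middle_informative (T t) with
  | left H => proj1_sig (constructive_indefinite_description _ H)
  | right _ => O3
  end.

Lemma vz_spec t : T t -> X' (vz t) /\ rho (vz t) = t.
Proof.
  intro H; unfold vz; destruct excluded_middle_informative; [|contradiction].
  destruct constructive_indefinite_description; assumption.
Qed.

Lemma vz_rho z : X' z -> vz (rho z) = z.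
Proof.
  intro Hz; assert (HT : T (rho z)) by (exists z; auto).
  destruct (vz_spec _ HT); apply X'_inj; auto.
Qed.

Lemma T_a : T a. Proof. exists (endpt a); split; [right; left; reflexivity|apply rho_endpt]. Qed.
Lemma T_b : T b. Proof. exists (endpt b); split; [right; right; reflexivity|apply rho_endpt]. Qed.

Lemma T_cases t : T t -> t0 <= t <= 2 \/ t = a \/ t = b.
Proof.
  intros [z [[Hz|[->| ->]] <-]]; rewrite ?rho_endpt; auto; left; apply X_range, Hz.
Qed.

Lemma T_ab t : T t -> a <= t <= b.
Proof. intro H; apply T_cases in H; unfold a, b in *; lra. Qed.

(** Away from the two end values, nearby points of T come from X, which is bounded and closed; a
    convergent subsequence realises the limit. *)
Lemma T_clos t : (forall eps, 0 < eps -> exists s, T s /\ Rabs (t - s) < eps) -> T t.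
Proof.
  intro H; apply NNPP; intro HT.
  assert (Ha : t <> a) by (intro E; apply HT; rewrite E; apply T_a).
  assert (Hb : t <> b) by (intro E; apply HT; rewrite E; apply T_b).
  assert (Hch : forall n, exists z, X z /\ Rabs (t - rho z) < / INR (S n)).
  { intro n.
    destruct (H (Rmin (/ INR (S n)) (Rmin (Rabs (t - a)) (Rabs (t - b))))) as [s [Hs Hts]].
    { repeat apply Rmin_glb_lt; [apply Rinv_0_lt_compat, lt_0_INR; lia| |]; apply Rabs_pos_lt; lra. }
    assert (M1 := Rlt_le_trans _ _ _ Hts (Rmin_l _ _)).
    assert (M2 := Rlt_le_trans _ _ _ Hts (Rle_trans _ _ _ (Rmin_r _ _) (Rmin_l _ _))).
    assert (M3 := Rlt_le_trans _ _ _ Hts (Rle_trans _ _ _ (Rmin_r _ _) (Rmin_r _ _))).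
    destruct Hs as [z [[Hz|[->| ->]] <-]]; rewrite ?rho_endpt in *; [exists z; auto| |]; lra. }
  set (u := fun n => proj1_sig (constructive_indefinite_description _ (Hch n))).
  assert (Hu : forall n, X (u n) /\ Rabs (t - rho (u n)) < / INR (S n)).
  { intro n; unfold u; destruct constructive_indefinite_description; assumption. }
  destruct (bolzano_weierstrass_C3 u 60) as (phi & z & Hphi & Hz); [intro n; apply X_range, Hu|].
  assert (HXz : X z) by (apply (X_closed (fun n => u (phi n))); [intro n; apply Hu|exact Hz]).
  apply HT; exists z; split; [left; exact HXz|].
  apply NNPP; intro Hne.
  assert (Hpos : 0 < Rabs (rho z - t) / 2).
  { assert (0 < Rabs (rho z - t)) by (apply Rabs_pos_lt; lra); lra. }
  destruct (continuous_seq d3 Rdist (fun _ => True) rho (fun n => u (phi n)) z (rho_continuous _) I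
    (fun _ => I) Hz _ Hpos) as [N HN].
  destruct (inv_INR_small _ Hpos) as [M HM].
  set (n := max N M); specialize (HN n ltac:(unfold n; lia)).
  assert (HM' : / INR (S (phi n)) < Rabs (rho z - t) / 2).
  { apply HM; pose proof (incr_seq_ge phi n Hphi); unfold n in *; lia. }
  destruct (Hu (phi n)) as [_ Hc]; unfold Rdist in HN.
  pose proof (Rabs_triang (rho z - rho (u (phi n))) (rho (u (phi n)) - t)) as Htr.
  replace (rho z - rho (u (phi n)) + (rho (u (phi n)) - t)) with (rho z - t) in Htr by ring.
  rewrite (Rabs_minus_sym (rho (u (phi n))) t) in Htr; lra.
Qed.

Lemma X'_n3 z : X' z -> n3 z <= 60.
Proof.
  intros [Hz|[->| ->]]; [apply X_range, Hz| |]; unfold n3, endpt, x1, x2, x3; simpl fst; simpl snd;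
    rewrite Cnorm_0, Cnorm_RtoC, Rabs_right; unfold a, b; lra.
Qed.

Let I5 (f : C3 -> R) (t : R) : R := interp T (fun s => f (vz s)) t.

Lemma I5_v_bounded f : coord5 f -> forall t, T t -> Rabs (f (vz t)) <= 60.
Proof.
  intros Hf t Ht; eapply Rle_trans; [apply coord5_bound, Hf|apply X'_n3, vz_spec, Ht].
Qed.

Lemma I5_v_unif f : coord5 f -> forall eps, 0 < eps -> exists de, 0 < de /\
  forall s s', T s -> T s' -> Rabs (s - s') < de -> Rabs (f (vz s) - f (vz s')) < eps.
Proof.
  intros Hf eps He; destruct (X'_modulus eps He) as [d [Hd H]]; exists d; split; [exact Hd|].
  intros s s' Hs Hs' Hss; eapply Rle_lt_trans; [apply coord5_lip, Hf|].
  destruct (vz_spec s Hs) as [P1 P2]; destruct (vz_spec s' Hs') as [P1' P2'].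
  apply H; [exact P1|exact P1'|rewrite P2, P2'; exact Hss].
Qed.

Lemma I5_on f t : T t -> I5 f t = f (vz t).
Proof. intro Ht; unfold I5; apply interp_on, Ht. Qed.

Lemma I5_bounded f t : coord5 f -> a <= t <= b -> Rabs (I5 f t) <= 60.
Proof.
  intros Hf Ht; apply (interp_bounded T a b T_a T_b T_clos); [apply I5_v_bounded, Hf|exact Ht].
Qed.

Lemma I5_unif f eps : coord5 f -> 0 < eps -> exists de, 0 < de /\ forall t t', a <= t <= b ->
  a <= t' <= b -> Rabs (t - t') < de -> Rabs (I5 f t - I5 f t') < eps.
Proof.
  intros Hf He; apply (interp_unif T a b T_a T_b T_clos _ 60);
    [apply I5_v_bounded, Hf|apply I5_v_unif, Hf|exact He].
Qed.

(** Five coordinates are interpolated and Re x3 is solved from rho = t. This makes the arc injective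
    whatever the interpolation does in the other coordinates. *)
Let gam (t : R) : C3 :=
  (mkC (I5 fRe1 t) (I5 fIm1 t), mkC (I5 fRe2 t) (I5 fIm2 t),
   mkC (t - sqn (mkC (I5 fRe1 t) (I5 fIm1 t)) - sqn (mkC (I5 fRe2 t) (I5 fIm2 t))) (I5 fIm3 t)).

Lemma rho_gam t : rho (gam t) = t.
Proof. unfold rho, gam, x1, x2, x3; simpl; ring. Qed.

Lemma gam_on t : T t -> gam t = vz t.
Proof.
  intro Ht; unfold gam; rewrite !I5_on by exact Ht; destruct (vz_spec t Ht) as [_ Hr].
  destruct (vz t) as [[z1 z2] z3]; unfold rho, fRe1, fIm1, fRe2, fIm2, fIm3, x1, x2, x3 in *; simpl in *.
  repeat f_equal; apply C_ext; simpl; try reflexivity; unfold sqn in *; simpl; lra.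
Qed.

(** Coordinates are bounded by 60, so each square varies by at most 120 D. Four squares enter Re x3,
    giving 480 D; the five coordinates add 5 D, and 500 rounds up. *)
Lemma gam_dist t t' D : a <= t <= b -> a <= t' <= b ->
  (forall f, coord5 f -> Rabs (I5 f t - I5 f t') <= D) -> d3 (gam t) (gam t') <= Rabs (t - t') + 500 * D.
Proof.
  intros Ht Ht' HD.
  assert (c1 : coord5 fRe1) by (left; reflexivity).
  assert (c2 : coord5 fIm1) by (right; left; reflexivity).
  assert (c3 : coord5 fRe2) by (right; right; left; reflexivity).
  assert (c4 : coord5 fIm2) by (right; right; right; left; reflexivity).
  assert (c5 : coord5 fIm3) by (right; right; right; right; reflexivity).
  assert (Hsq : forall f, coord5 f -> Rabs (I5 f t * I5 f t - I5 f t' * I5 f t') <= 120 * D).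
  { intros f Hf; replace (I5 f t * I5 f t - I5 f t' * I5 f t')
      with ((I5 f t + I5 f t') * (I5 f t - I5 f t')) by ring.
    rewrite Rabs_mult; apply Rmult_le_compat; try apply Rabs_pos; [|auto].
    eapply Rle_trans; [apply Rabs_triang|].
    pose proof (I5_bounded f t Hf Ht); pose proof (I5_bounded f t' Hf Ht'); lra. }
  pose proof (HD _ c1); pose proof (HD _ c2); pose proof (HD _ c3); pose proof (HD _ c4); pose proof (HD _ c5).
  pose proof (Hsq _ c1) as Q1; pose proof (Hsq _ c2) as Q2; pose proof (Hsq _ c3) as Q3; pose proof (Hsq _ c4) as Q4.
  assert (HD0 : 0 <= D) by (pose proof (Rabs_pos (I5 fRe1 t - I5 fRe1 t')); lra).
  unfold d3, Cdist, gam, x1, x2, x3; simpl fst; simpl snd.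
  pose proof (Cnorm_le_parts (mkC (I5 fRe1 t) (I5 fIm1 t) - mkC (I5 fRe1 t') (I5 fIm1 t'))) as N1.
  pose proof (Cnorm_le_parts (mkC (I5 fRe2 t) (I5 fIm2 t) - mkC (I5 fRe2 t') (I5 fIm2 t'))) as N2.
  set (z := mkC (t - _ - _) _); set (z' := mkC (t' - _ - _) _).
  pose proof (Cnorm_le_parts (z - z')) as N3; unfold z, z' in N3 |- *.
  unfold sqn in *; simpl in *; unfold Rminus in *.
  match type of N3 with _ <= Rabs ?e + _ => assert (N4 : Rabs e <= Rabs (t + - t') + 480 * D) end.
  { match goal with |- Rabs ?e <= _ => replace e with ((t + - t')
      + - ((I5 fRe1 t * I5 fRe1 t) + - (I5 fRe1 t' * I5 fRe1 t'))
      + - ((I5 fIm1 t * I5 fIm1 t) + - (I5 fIm1 t' * I5 fIm1 t'))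
      + - ((I5 fRe2 t * I5 fRe2 t) + - (I5 fRe2 t' * I5 fRe2 t'))
      + - ((I5 fIm2 t * I5 fIm2 t) + - (I5 fIm2 t' * I5 fIm2 t'))) by ring end.
    repeat (eapply Rle_trans; [apply Rabs_triang|]; rewrite Rabs_Ropp;
      match goal with |- ?u + ?v <= _ => apply Rle_trans with (u + 120 * D); [lra|] end;
      match goal with |- ?u + 120 * D <= ?w => enough (u <= w - 120 * D) by lra end).
    lra. }
  lra.
Qed.

Lemma gam_unif eps : 0 < eps -> exists de, 0 < de /\ forall t t', a <= t <= b -> a <= t' <= b ->
  Rabs (t - t') < de -> d3 (gam t) (gam t') < eps.
Proof.
  intro He; set (e := eps / 1001).
  assert (He' : 0 < e) by (unfold e; lra).
  destruct (I5_unif fRe1 e) as [d1 [D1 H1]]; [left; reflexivity|exact He'|].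
  destruct (I5_unif fIm1 e) as [d2 [D2 H2]]; [right; left; reflexivity|exact He'|].
  destruct (I5_unif fRe2 e) as [d3' [D3 H3]]; [right; right; left; reflexivity|exact He'|].
  destruct (I5_unif fIm2 e) as [d4 [D4 H4]]; [right; right; right; left; reflexivity|exact He'|].
  destruct (I5_unif fIm3 e) as [d5 [D5 H5]]; [right; right; right; right; reflexivity|exact He'|].
  exists (Rmin e (Rmin d1 (Rmin d2 (Rmin d3' (Rmin d4 d5))))); split; [repeat apply Rmin_glb_lt; assumption|].
  intros t t' Ht Ht' Hd.
  apply Rmin_Rgt_l in Hd; destruct Hd as [Hd0 Hd]; apply Rmin_Rgt_l in Hd; destruct Hd as [Hd1 Hd].
  apply Rmin_Rgt_l in Hd; destruct Hd as [Hd2 Hd]; apply Rmin_Rgt_l in Hd; destruct Hd as [Hd3 Hd].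
  apply Rmin_Rgt_l in Hd; destruct Hd as [Hd4 Hd5].
  eapply Rle_lt_trans; [apply (gam_dist t t' e Ht Ht')|].
  - intros f [-> | [-> | [-> | [-> | ->]]]]; left; auto.
  - unfold e in *; lra.
Qed.

Lemma gam_n3 t : a <= t <= b -> n3 (gam t) <= 20000.
Proof.
  intro Ht.
  assert (c1 : coord5 fRe1) by (left; reflexivity).
  assert (c2 : coord5 fIm1) by (right; left; reflexivity).
  assert (c3 : coord5 fRe2) by (right; right; left; reflexivity).
  assert (c4 : coord5 fIm2) by (right; right; right; left; reflexivity).
  assert (c5 : coord5 fIm3) by (right; right; right; right; reflexivity).
  pose proof (I5_bounded _ t c1 Ht) as B1; pose proof (I5_bounded _ t c2 Ht) as B2.
  pose proof (I5_bounded _ t c3 Ht) as B3; pose proof (I5_bounded _ t c4 Ht) as B4.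
  pose proof (I5_bounded _ t c5 Ht) as B5.
  assert (Hs : forall x, Rabs x <= 60 -> 0 <= x * x <= 3600).
  { intros x Hx; pose proof (Rle_abs x); pose proof (Rle_abs (- x)); rewrite Rabs_Ropp in *; nra. }
  apply Hs in B1 as S1; apply Hs in B2 as S2; apply Hs in B3 as S3; apply Hs in B4 as S4.
  unfold n3, gam, x1, x2, x3; simpl fst; simpl snd.
  eapply Rle_trans; [apply Rplus_le_compat; [apply Rplus_le_compat|]; apply Cnorm_le_parts|].
  simpl Re; simpl Im; unfold sqn; simpl Re; simpl Im.
  assert (Rabs (t - (I5 fRe1 t * I5 fRe1 t + I5 fIm1 t * I5 fIm1 t)
     - (I5 fRe2 t * I5 fRe2 t + I5 fIm2 t * I5 fIm2 t)) <= 15000).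
  { unfold a, b in Ht; apply Rabs_le; lra. }
  lra.
Qed.

(** Where |p| <= c/2 the parameter is at distance at least [d0] from those of X, because |p| >= c
    there. Two such close parameters thus share a gap of length at least [d0], on which the
    interpolation has slope at most 120/d0. Short gaps, whose slopes are uncontrolled, never
    matter. *)
Lemma thin_gam p c : 0 < c -> (forall z, X z -> c <= Cnorm (ev p z)) ->
  thin (fun e => exists t, (a <= t <= b /\ Cnorm (ev p (gam t)) <= c / 2) /\ e = ev p (gam t)).
Proof.
  intros Hc HX.
  destruct (ev_lipschitz p 20000) as [L [HL HLb]].
  destruct (gam_unif (c / (2 * (L + 1)))) as [d [Hd H]]; [apply Rdiv_lt_0_compat; lra|].
  (* The cap b - a covers a gap running between the two added end points, which are not in X. *)
  set (d0 := Rmin d (b - a)).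
  assert (Hab : a < b) by (unfold a, b; lra).
  assert (Hd0 : 0 < d0) by (apply Rmin_glb_lt; lra).
  assert (Hd0d : d0 <= d) by apply Rmin_l. assert (Hd0ab : d0 <= b - a) by apply Rmin_r.
  assert (Hfar : forall t s, a <= t <= b -> Cnorm (ev p (gam t)) <= c / 2 -> X (gam s) -> a <= s <= b ->
     d0 <= Rabs (t - s)).
  { intros t s Ht Hct Hs Hs'; apply Rnot_lt_le; intro Hlt.
    specialize (H t s Ht Hs' ltac:(lra)); specialize (HX _ Hs).
    pose proof (HLb (gam t) (gam s) (gam_n3 t Ht) (gam_n3 s Hs')).
    rewrite Cnorm_sub_sym in H0; pose proof (Cnorm_sub_ge (ev p (gam s)) (ev p (gam t))).
    assert (L * d3 (gam t) (gam s) <= L * (c / (2 * (L + 1)))) by (apply Rmult_le_compat_l; lra).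
    assert (L * (c / (2 * (L + 1))) < c / 2).
    { apply Rmult_lt_reg_r with (2 * (L + 1)); [lra|].
      replace (L * (c / (2 * (L + 1))) * (2 * (L + 1))) with (L * c) by (field; lra). nra. }
    lra. }
  set (Lg := L * (1 + 500 * (2 * 60 / d0))).
  assert (HLg0 : 0 <= 2 * 60 / d0) by (apply Rmult_le_pos; [lra|left; apply Rinv_0_lt_compat, Hd0]).
  assert (Hmain : forall t t', a <= t <= b -> a <= t' <= b -> Cnorm (ev p (gam t)) <= c / 2 ->
    Cnorm (ev p (gam t')) <= c / 2 -> t < t' -> t' - t < d0 ->
    Cnorm (ev p (gam t) - ev p (gam t')) <= Lg * Rabs (t - t')).
  { intros t t' Ht Ht' Hct Hct' Hlt Hd'.
    assert (HTX : forall s, T s -> s <> a -> s <> b -> X (gam s)).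
    { intros s Hs Hsa Hsb; rewrite gam_on by exact Hs; destruct (vz_spec s Hs) as [[P|[P|P]] Q]; [exact P| |];
        rewrite P, rho_endpt in Q; congruence. }
    destruct (gap_between T a b T_a T_b T_clos t t') as (al & be & Hg & G1 & G2); try lra.
    { intros s Hs HT; pose proof (Hfar t s Ht Hct (HTX s HT ltac:(lra) ltac:(lra)) ltac:(lra)) as Hf.
      rewrite Rabs_left in Hf; lra. }
    assert (Hlen : d0 <= be - al).
    { assert (Hg' := Hg); destruct Hg' as (K1 & K2 & K3 & _).
      pose proof (T_ab _ K1); pose proof (T_ab _ K2).
      destruct (Req_dec al a) as [Ea|Na]; destruct (Req_dec be b) as [Eb|Nb]; try lra.
      - pose proof (Hfar t' be Ht' Hct' (HTX be K2 ltac:(lra) Nb) ltac:(lra)) as Hf.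
        rewrite Rabs_left1 in Hf; lra.
      - pose proof (Hfar t al Ht Hct (HTX al K1 Na ltac:(lra)) ltac:(lra)) as Hf.
        rewrite Rabs_right in Hf; lra.
      - pose proof (Hfar t al Ht Hct (HTX al K1 Na ltac:(lra)) ltac:(lra)) as Hf.
        rewrite Rabs_right in Hf; lra. }
    eapply Rle_trans; [apply HLb; apply gam_n3; assumption|].
    unfold Lg; rewrite Rmult_assoc; apply Rmult_le_compat_l; [exact HL|].
    eapply Rle_trans; [apply (gam_dist t t' (2 * 60 / d0 * Rabs (t - t')) Ht Ht')|right; ring].
    intros f Hf; apply (interp_lipschitz_long T a T_a _ 60 (I5_v_bounded f Hf) al be); try assumption; lra. }
  apply (thin_image _ (fun t => ev p (gam t)) a b d0 Lg); try assumption.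
  - unfold Lg; nra.
  - intros t [Ht _]; exact Ht.
  - intros t t' [Ht Hct] [Ht' Hct'] Hd'.
    destruct (Rtotal_order t t') as [H1|[->|H1]].
    + apply Hmain; try assumption; rewrite Rabs_left in Hd'; lra.
    + replace (t' - t') with 0 by ring; rewrite Rabs_R0.
      replace (ev p (gam t') - ev p (gam t'))%C with C0 by ring; rewrite Cnorm_0; lra.
    + rewrite Cnorm_sub_sym, Rabs_minus_sym; apply Hmain; try assumption; rewrite Rabs_right in Hd'; lra.
Qed.

Lemma gam_hull q : ev q O3 = C0 -> exists t, a <= t <= b /\ ev q (gam t) = C0.
Proof.
  intro Hq; destruct (X_hull q Hq) as [z [Hz Hqz]].
  assert (HX : X' z) by (left; exact Hz).
  assert (HT : T (rho z)) by (exists z; auto).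
  exists (rho z); split; [apply T_ab, HT|rewrite gam_on, vz_rho by assumption; exact Hqz].
Qed.

Lemma seqcompact_unit_interval : seqcompact Rdist unit_interval.
Proof.
  intros u Hu; destruct (bolzano_weierstrass_R u 1) as (phi & l & Hphi & _ & Hl).
  { intro n; specialize (Hu n); unfold unit_interval in Hu; rewrite Rabs_right; lra. }
  exists phi, l; split; [exact Hphi|]; split; [|exact Hl].
  split; apply Rnot_lt_le; intro Hlt.
  - destruct (Hl (- l) ltac:(lra)) as [N HN]; specialize (HN N (Nat.le_refl _)); specialize (Hu (phi N)).
    unfold Rdist, unit_interval in *; apply Rabs_def2 in HN; lra.
  - destruct (Hl (l - 1) ltac:(lra)) as [N HN]; specialize (HN N (Nat.le_refl _)); specialize (Hu (phi N)).
    unfold Rdist, unit_interval in *; apply Rabs_def2 in HN; lra.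
Qed.

Lemma arc_good : exists G, good_curve Rdist unit_interval G.
Proof.
  exists (fun s => gam (a + s * (b - a))).
  assert (Hab : 0 < a < b) by (unfold a, b; lra).
  assert (Hr : forall s, unit_interval s -> a <= a + s * (b - a) <= b) by (unfold unit_interval; intros; nra).
  split.
  - intros s Hs eps He; destruct (gam_unif eps He) as [d [Hd H]].
    exists (d / (b - a)); split; [apply Rdiv_lt_0_compat; lra|]; intros s' Hs' Hss; unfold Rdist in Hss.
    apply H; try (apply Hr; assumption).
    replace (a + s * (b - a) - (a + s' * (b - a))) with ((s - s') * (b - a)) by ring.
    rewrite Rabs_mult, (Rabs_right (b - a)) by lra.
    apply Rmult_lt_reg_r with (/ (b - a)); [apply Rinv_0_lt_compat; lra|].
    rewrite Rmult_assoc, Rinv_r, Rmult_1_r by lra; exact Hss.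
  - intros s t Hs Ht E; apply (f_equal rho) in E; rewrite !rho_gam in E; nra.
  - apply seqcompact_unit_interval.
  - intros s Hs E; apply (f_equal rho) in E; rewrite rho_gam, rho_O3 in E; specialize (Hr s Hs); lra.
  - intros q Hq; destruct (gam_hull q Hq) as [t [Ht Hqt]].
    exists ((t - a) / (b - a)); split.
    + unfold unit_interval; split; [apply Rmult_le_pos; [lra|left; apply Rinv_0_lt_compat; lra]|].
      apply Rmult_le_reg_r with (b - a); [lra|].
      replace ((t - a) / (b - a) * (b - a)) with (t - a) by (field; lra); lra.
    + replace (a + (t - a) / (b - a) * (b - a)) with t by (field; lra); exact Hqt.
  - intros p eps He; destruct (X_dense p 20000 (eps/2) ltac:(lra)) as (p' & c & Hc & HX & Hpp).
    destruct (thin_avoid _ (Rmin (eps/2) (c/2)) (thin_gam p' c Hc HX)) as [e [He1 He2]];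
      [apply Rmin_glb_lt; lra|].
    pose proof (Rmin_l (eps/2) (c/2)); pose proof (Rmin_r (eps/2) (c/2)).
    (* A zero of p' - e on the arc would give p' = e there, of modulus below c/2, putting [e] into
       the thin set it was chosen to avoid. *)
    exists (Padd p' (Pconst (- e)%C)).
    assert (Hev : forall z, ev (Padd p' (Pconst (- e)%C)) z = (ev p' z - e)%C) by reflexivity.
    split; intros t Ht; rewrite Hev.
    + intro E; apply Csub_eq0 in E; apply He2; exists (a + t * (b - a)); split; [|symmetry; exact E].
      split; [apply Hr, Ht|rewrite E; lra].
    + specialize (Hpp _ (gam_n3 _ (Hr t Ht))).
      set (u := ev p _) in *; set (v := ev p' _) in *.
      replace (u - (v - e))%C with ((u - v) + e)%C by ring.
      eapply Rle_trans; [apply Cnorm_triang|]; lra.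
Qed.

(** All five coordinates vanish at the two end points, and the gaps next to them have length at
    least [a] and 1 respectively. So they grow at most linearly near the ends; farther than [e] from
    an end, the bound 60 suffices. *)
Lemma I5_ends f : coord5 f -> exists K, 0 <= K /\ forall t, a <= t <= b ->
  Rabs (I5 f t) <= K * (t - a) /\ Rabs (I5 f t) <= K * (b - t).
Proof.
  intro Hf; set (e := Rmin a 1).
  assert (He : 0 < e) by (apply Rmin_glb_lt; unfold a; lra).
  assert (Hea : e <= a) by apply Rmin_l. assert (He1 : e <= 1) by apply Rmin_r.
  exists (60 / e); split; [apply Rmult_le_pos; [lra|left; apply Rinv_0_lt_compat, He]|].
  assert (H60 : 60 = 60 / e * e) by (field; lra).
  assert (Hp : 0 < 60 / e) by (apply Rdiv_lt_0_compat; lra).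
  assert (Hend : forall t, t = a \/ t = b -> f (vz t) = 0).
  { intros t Ht; assert (E : vz t = endpt t).
    { assert (HX : X' (endpt t)) by (right; destruct Ht as [->| ->]; auto).
      rewrite <- (vz_rho _ HX), rho_endpt; reflexivity. }
    rewrite E; destruct Hf as [-> | [-> | [-> | [-> | ->]]]]; reflexivity. }
  intros t Ht.
  pose proof (I5_bounded f t Hf Ht) as HB.
  assert (Hdiv : forall x y k, 0 <= x -> e <= y -> Rabs k <= 60 -> Rabs (x / y * k) <= 60 / e * x).
  { intros x y k Hx Hy Hk; rewrite Rabs_mult, (Rabs_right (x / y)).
    2:{ apply Rle_ge, Rmult_le_pos; [lra|left; apply Rinv_0_lt_compat; lra]. }
    apply Rle_trans with (x / e * 60); [|right; field; lra].
    apply Rmult_le_compat; [apply Rmult_le_pos; [lra|left; apply Rinv_0_lt_compat; lra]|apply Rabs_pos| |exact Hk].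
    apply Rmult_le_compat_l; [lra|apply Rinv_le_contravar; lra]. }
  split.
  - destruct (Rle_dec (a + e) t) as [Hl|Hl]; [nra|].
    destruct (classic (T t)) as [HT|HT].
    + apply T_cases in HT as HT'.
      assert (t = a) by (unfold a, b in *; lra); subst t.
      rewrite I5_on, Hend, Rabs_R0 by auto; lra.
    + destruct (gap_around T a b T_a T_b T_clos t Ht HT) as (al & be & Hg & Hm).
      assert (Hg' := Hg); destruct Hg' as (K1 & K2 & _).
      assert (Ea : al = a) by (apply T_cases in K1; unfold a, b in *; lra).
      assert (Eb : e <= be - a) by (apply T_cases in K2; unfold a, b in *; lra).
      unfold I5; rewrite (interp_gap T _ al be) by (assumption || lra).
      rewrite Ea, (Hend a), Rplus_0_l, Rminus_0_r by auto.
      apply Hdiv; [lra|lra|apply I5_v_bounded; assumption].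
  - destruct (Rle_dec t (b - e)) as [Hl|Hl]; [nra|].
    destruct (classic (T t)) as [HT|HT].
    + apply T_cases in HT as HT'.
      assert (t = b) by (unfold a, b in *; lra); subst t.
      rewrite I5_on, Hend, Rabs_R0 by auto; lra.
    + destruct (gap_around T a b T_a T_b T_clos t Ht HT) as (al & be & Hg & Hm).
      assert (Hg' := Hg); destruct Hg' as (K1 & K2 & _).
      assert (Eb : be = b) by (apply T_cases in K2; unfold a, b in *; lra).
      assert (Ea : e <= b - al) by (apply T_cases in K1; unfold a, b in *; lra).
      unfold I5; rewrite (interp_gap T _ al be) by (assumption || lra).
      rewrite Eb, (Hend b) by auto.
      replace (f (vz al) + (t - al) / (b - al) * (0 - f (vz al)))
        with ((b - t) / (b - al) * f (vz al)) by (field; lra).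
      apply Hdiv; [lra|lra|apply I5_v_bounded; assumption].
Qed.
Lemma seqcompact_unit_circle : seqcompact Cdist unit_circle.
Proof.
  intros u Hu; destruct (bolzano_weierstrass_C u 1) as (phi & l & Hphi & Hl).
  { intro n; rewrite (Hu n); lra. }
  exists phi, l; split; [exact Hphi|]; split; [|exact Hl].
  unfold unit_circle; apply NNPP; intro Hne.
  destruct (Hl (Rabs (Cnorm l - 1))) as [N HN]; [apply Rabs_pos_lt; lra|].
  specialize (HN N (Nat.le_refl _)); specialize (Hu (phi N)); unfold Cdist, unit_circle in *.
  pose proof (Cnorm_sub_ge l (u (phi N))); pose proof (Cnorm_sub_ge (u (phi N)) l).
  rewrite (Cnorm_sub_sym (u (phi N))) in *; rewrite Hu in *.
  assert (Rabs (Cnorm l - 1) <= Cnorm (l - u (phi N))) by (apply Rabs_le; lra); lra.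
Qed.

(** The upper half circle carries the arc and the lower half the return branch, both with rho an
    increasing affine function of Re w. Injectivity on each half is then automatic, and across the
    halves only points over the same Re w must be told apart, by Re x1. *)
Lemma closed_curve_good : exists G, good_curve Cdist unit_circle G.
Proof.
  destruct (I5_ends fRe1) as [K0 [HK0 HK]]; [left; reflexivity|].
  set (l := (b - a) / 2); set (mid := (a + b) / 2).
  assert (Hl : 0 < l <= 3) by (unfold l, a, b; lra).
  assert (Hmid : 0 < mid <= 3) by (unfold mid, a, b; lra).
  assert (Hml : mid - l = a /\ mid + l = b) by (unfold mid, l; lra).
  assert (Ha0 : 0 < a) by (unfold a; lra).
  assert (Hab : a < b) by (unfold a, b; lra).
  (* On the arc |Re x1| <= K0 l (1 - |u|) <= K0 l (1 - u^2), strictly below K (1 - u^2) inside the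
     interval: the return branch cannot touch the arc there. *)
  set (K := K0 * l + 1).
  assert (HK1 : 1 <= K) by (unfold K; nra).
  set (tt := fun u => mid + u * l).
  (* the return branch, with the first coordinate pushed off the arc by [K (1 - u^2)] *)
  set (g2 := fun u : R => ((RtoC (K * (1 - u * u)), C0,
     RtoC (tt u - K * (1 - u * u) * (K * (1 - u * u)))) : C3)).
  assert (Hg2r : forall u, rho (g2 u) = tt u).
  { intro u; unfold rho, g2, x1, x2, x3, sqn, RtoC; simpl; ring. }
  assert (Htt : forall u, -1 <= u <= 1 -> a <= tt u <= b) by (unfold tt; intros; nra).
  set (L2 := 2 * K + 3 + 4 * K * K).
  assert (Hg2L : forall u u', -1 <= u <= 1 -> -1 <= u' <= 1 -> d3 (g2 u) (g2 u') <= L2 * Rabs (u - u')).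
  { intros u u' Hu Hu'; unfold d3, Cdist, g2, x1, x2, x3; simpl fst; simpl snd.
    assert (Hs : Rabs ((1 - u * u) - (1 - u' * u')) <= 2 * Rabs (u - u')).
    { replace ((1 - u * u) - (1 - u' * u')) with (- (u + u') * (u - u')) by ring.
      rewrite Rabs_mult; apply Rmult_le_compat_r; [apply Rabs_pos|apply Rabs_le; lra]. }
    set (A := 1 - u * u) in *; set (A' := 1 - u' * u') in *.
    assert (HA : 0 <= A <= 1) by (unfold A; nra). assert (HA' : 0 <= A' <= 1) by (unfold A'; nra).
    assert (Hr : forall x y, (RtoC x - RtoC y)%C = RtoC (x - y)) by (intros; Cext; ring).
    rewrite !Hr, !Cnorm_RtoC; replace (C0 - C0)%C with C0 by ring; rewrite Cnorm_0.
    assert (E1 : Rabs (K * A - K * A') <= 2 * K * Rabs (u - u')).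
    { replace (K * A - K * A') with (K * (A - A')) by ring; rewrite Rabs_mult, (Rabs_right K) by lra; nra. }
    assert (E2 : Rabs (tt u - K * A * (K * A) - (tt u' - K * A' * (K * A'))) <= (3 + 4 * K * K) * Rabs (u - u')).
    { replace (tt u - K * A * (K * A) - (tt u' - K * A' * (K * A')))
        with (l * (u - u') + - (K * K * ((A + A') * (A - A')))) by (unfold tt; ring).
      eapply Rle_trans; [apply Rabs_triang|].
      rewrite Rabs_Ropp, !Rabs_mult, (Rabs_right l), (Rabs_right K), (Rabs_right (A + A')) by lra.
      pose proof (Rabs_pos (u - u')); pose proof (Rabs_pos (A - A')).
      assert ((A + A') * Rabs (A - A') <= 4 * Rabs (u - u')) by nra.
      assert (K * K * ((A + A') * Rabs (A - A')) <= K * K * (4 * Rabs (u - u')))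
        by (apply Rmult_le_compat_l; nra).
      nra. }
    unfold L2; lra. }
  set (B2 := K + 10 + K * K).
  assert (Hg2n : forall u, -1 <= u <= 1 -> n3 (g2 u) <= B2).
  { intros u Hu; unfold n3, g2, x1, x2, x3; simpl fst; simpl snd; rewrite Cnorm_0, !Cnorm_RtoC.
    set (A := 1 - u * u); assert (HA : 0 <= A <= 1) by (unfold A; nra).
    assert (E0 : Rabs (K * A) <= K) by (apply Rabs_le; nra).
    assert (E2 : Rabs (tt u - K * A * (K * A)) <= 10 + K * K).
    { specialize (Htt u Hu); unfold a, b in Htt.
      assert (0 <= K * A <= K) by nra. assert (0 <= K * A * (K * A) <= K * K) by nra.
      apply Rabs_le; lra. }
    unfold B2; lra. }
  assert (Hcirc : forall w, unit_circle w -> Re w * Re w + Im w * Im w = 1 /\ -1 <= Re w <= 1).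
  { intros w Hw; assert (E : sqn w = 1) by (rewrite <- Cnorm_sqr, Hw; ring); unfold sqn in E; split; [exact E|nra]. }
  exists (fun w => if Rle_dec 0 (Im w) then gam (tt (Re w)) else g2 (Re w)).
  assert (HRe : forall w w', Rabs (Re w - Re w') <= Cnorm (w - w')) by (intros; exact (Re_le_Cnorm (w - w'))).
  assert (HIm : forall w w', Rabs (Im w - Im w') <= Cnorm (w - w')) by (intros; exact (Im_le_Cnorm (w - w'))).
  split.
  - intros w Hw eps He; destruct (Hcirc w Hw) as [Ew Rw].
    destruct (gam_unif eps He) as [d [Hd H]].
    set (e1 := d / 4); set (e2 := eps / (L2 + 1)).
    assert (HL2 : 0 < L2) by (unfold L2; nra).
    assert (He2 : 0 < e2) by (apply Rdiv_lt_0_compat; lra).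
    assert (Hg1 : forall w', unit_circle w' -> Cdist w w' < e1 -> d3 (gam (tt (Re w))) (gam (tt (Re w'))) < eps).
    { intros w' Hw' Hd'; destruct (Hcirc w' Hw') as [_ Rw']; apply H; try (apply Htt; assumption).
      replace (tt (Re w) - tt (Re w')) with (l * (Re w - Re w')) by (unfold tt; ring).
      rewrite Rabs_mult, (Rabs_right l) by lra.
      specialize (HRe w w'); unfold Cdist, e1 in *; pose proof (Rabs_pos (Re w - Re w')); nra. }
    assert (Hg2 : forall w', unit_circle w' -> Cdist w w' < e2 -> d3 (g2 (Re w)) (g2 (Re w')) < eps).
    { intros w' Hw' Hd'; destruct (Hcirc w' Hw') as [_ Rw'].
      eapply Rle_lt_trans; [apply Hg2L; assumption|].
      specialize (HRe w w'); unfold Cdist in *.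
      apply Rle_lt_trans with (L2 * e2); [apply Rmult_le_compat_l; lra|].
      unfold e2; apply Rmult_lt_reg_r with (L2 + 1); [lra|].
      replace (L2 * (eps / (L2 + 1)) * (L2 + 1)) with (L2 * eps) by (field; lra); nra. }
    assert (He1 : 0 < e1) by (unfold e1; lra).
    destruct (Rtotal_order (Im w) 0) as [Hneg|[Hzero|Hpos]].
    + exists (Rmin e2 (- Im w)); split; [apply Rmin_glb_lt; lra|]; intros w' Hw' Hd'.
      assert (M1 := Rlt_le_trans _ _ _ Hd' (Rmin_l _ _)); assert (M2 := Rlt_le_trans _ _ _ Hd' (Rmin_r _ _)).
      specialize (HIm w w'); unfold Cdist in M2; assert (M3 := Rle_lt_trans _ _ _ HIm M2); apply Rabs_def2 in M3.
      destruct (Rle_dec 0 (Im w)); [lra|]; destruct (Rle_dec 0 (Im w')); [lra|]; auto.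
    + exists (Rmin e1 e2); split; [apply Rmin_glb_lt; assumption|]; intros w' Hw' Hd'.
      assert (M1 := Rlt_le_trans _ _ _ Hd' (Rmin_l _ _)); assert (M2 := Rlt_le_trans _ _ _ Hd' (Rmin_r _ _)).
      (* Im w = 0 forces Re w to be 1 or -1, where both branches pass through the same end point. *)
      assert (Eg : gam (tt (Re w)) = g2 (Re w)).
      { rewrite Hzero in Ew; assert (Ew' : Re w * Re w = 1) by lra.
        assert (Et : tt (Re w) = a \/ tt (Re w) = b).
        { unfold tt; assert (Re w = 1 \/ Re w = -1) as [->| ->] by nra; lra. }
        assert (HX : X' (endpt (tt (Re w)))) by (right; destruct Et as [->| ->]; auto).
        assert (HT : T (tt (Re w))) by (exists (endpt (tt (Re w))); split; [exact HX|apply rho_endpt]).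
        rewrite gam_on by exact HT.
        rewrite <- (rho_endpt (tt (Re w))) at 1; rewrite vz_rho by exact HX.
        unfold g2, endpt; rewrite Ew'; replace (K * (1 - 1)) with 0 by ring.
        replace (tt (Re w) - 0 * 0) with (tt (Re w)) by ring; reflexivity. }
      destruct (Rle_dec 0 (Im w)); [|lra]; destruct (Rle_dec 0 (Im w')); [auto|rewrite Eg; auto].
    + exists (Rmin e1 (Im w)); split; [apply Rmin_glb_lt; lra|]; intros w' Hw' Hd'.
      assert (M1 := Rlt_le_trans _ _ _ Hd' (Rmin_l _ _)); assert (M2 := Rlt_le_trans _ _ _ Hd' (Rmin_r _ _)).
      specialize (HIm w w'); unfold Cdist in M2; assert (M3 := Rle_lt_trans _ _ _ HIm M2); apply Rabs_def2 in M3.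
      destruct (Rle_dec 0 (Im w)); [|lra]; destruct (Rle_dec 0 (Im w')); [|lra]; auto.
  - assert (Hmix : forall w w', unit_circle w -> unit_circle w' -> 0 <= Im w -> ~ 0 <= Im w' ->
      gam (tt (Re w)) <> g2 (Re w')).
    { intros w w' Hw Hw' Hp Hn E; destruct (Hcirc w Hw) as [Ew Rw]; destruct (Hcirc w' Hw') as [Ew' Rw'].
      assert (Et := f_equal rho E); rewrite rho_gam, Hg2r in Et.
      assert (Er : Re w = Re w') by (unfold tt in Et; nra).
      apply (f_equal fRe1) in E; unfold fRe1, gam, g2, x1, RtoC in E; simpl in E.
      rewrite <- Er in E, Ew'.
      destruct (HK (tt (Re w)) (Htt _ Rw)) as [E1 E2].
      set (v2 := 1 - Re w * Re w) in *.
      assert (Hv2 : 0 < v2) by (unfold v2; nra).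
      assert (E3 : K * v2 <= K0 * (l * (1 + Re w))).
      { rewrite <- E; eapply Rle_trans; [apply Rle_abs|]; eapply Rle_trans; [exact E1|].
        right; unfold tt; replace a with (mid - l) by lra; ring. }
      assert (E4 : K * v2 <= K0 * (l * (1 - Re w))).
      { rewrite <- E; eapply Rle_trans; [apply Rle_abs|]; eapply Rle_trans; [exact E2|].
        right; unfold tt; replace b with (mid + l) by lra; ring. }
      assert (Hmin : 1 + Re w <= v2 \/ 1 - Re w <= v2).
      { unfold v2; destruct (Rle_dec 0 (Re w)); [right|left]; nra. }
      assert (0 <= K0 * l) by nra.
      unfold K in E3, E4; destruct Hmin as [Hm|Hm].
      - assert (K0 * l * (1 + Re w) <= K0 * l * v2) by (apply Rmult_le_compat_l; lra); lra.
      - assert (K0 * l * (1 - Re w) <= K0 * l * v2) by (apply Rmult_le_compat_l; lra); lra. }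
    intros w w' Hw Hw' E; destruct (Hcirc w Hw) as [Ew Rw]; destruct (Hcirc w' Hw') as [Ew' Rw'].
    assert (Hsame : tt (Re w) = tt (Re w') -> 0 <= Im w * Im w' -> w = w').
    { intros Et Hs; assert (Er : Re w = Re w') by (unfold tt in Et; nra).
      apply C_ext; [exact Er|]; rewrite Er in Ew.
      destruct (Req_dec (Im w) (- Im w')) as [Eo|Ne]; nra. }
    destruct (Rle_dec 0 (Im w)) as [Hp|Hn]; destruct (Rle_dec 0 (Im w')) as [Hp'|Hn'].
    + apply Hsame; [apply (f_equal rho) in E; rewrite !rho_gam in E; exact E|nra].
    + exfalso; exact (Hmix w w' Hw Hw' Hp Hn' E).
    + exfalso; exact (Hmix w' w Hw' Hw Hp' Hn (eq_sym E)).
    + apply Hsame; [apply (f_equal rho) in E; rewrite !Hg2r in E; exact E|nra].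
  - apply seqcompact_unit_circle.
  - intros w Hw E; destruct (Hcirc w Hw) as [_ Rw]; specialize (Htt _ Rw).
    apply (f_equal rho) in E; rewrite rho_O3 in E.
    destruct (Rle_dec 0 (Im w)); rewrite ?rho_gam, ?Hg2r in E; lra.
  - intros q Hq; destruct (gam_hull q Hq) as [t [Ht Hqt]].
    set (u := (t - mid) / l).
    assert (Hu : -1 <= u <= 1).
    { unfold u; split; apply Rmult_le_reg_r with l; try lra;
        replace ((t - mid) / l * l) with (t - mid) by (field; lra); lra. }
    exists (mkC u (sqrt (1 - u * u))); split.
    + unfold unit_circle, Cnorm; simpl; rewrite sqrt_sqrt by nra.
      replace (u * u + (1 - u * u)) with 1 by ring; apply sqrt_1.
    + simpl; destruct (Rle_dec 0 (sqrt (1 - u * u))) as [_|Hn]; [|exfalso; apply Hn, sqrt_pos].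
      replace (tt u) with t by (unfold tt, u; field; lra); exact Hqt.
  - intros p eps He; set (B := 20000 + B2).
    assert (HB2 : 0 <= B2) by (unfold B2; nra).
    destruct (X_dense p B (eps/2) ltac:(lra)) as (p' & c & Hc & HX & Hpp).
    destruct (ev_lipschitz p' B) as [L [HL HLb]].
    (* The return branch is Lipschitz as a whole, so all its values under p' are thin, without a
       cutoff by [c]. *)
    assert (Hthin2 : thin (fun e => exists u, -1 <= u <= 1 /\ e = ev p' (g2 u))).
    { apply (thin_image (fun u => -1 <= u <= 1) (fun u => ev p' (g2 u)) (-1) 1 1 (L * L2)); try lra.
      - assert (0 <= L2) by (unfold L2; nra); nra.
      - auto.
      - intros u u' Hu Hu' _; eapply Rle_trans; [apply HLb|].
        + specialize (Hg2n u Hu); unfold B; lra.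
        + specialize (Hg2n u' Hu'); unfold B; lra.
        + rewrite Rmult_assoc; apply Rmult_le_compat_l; [exact HL|apply Hg2L; assumption]. }
    destruct (thin_avoid _ (Rmin (eps/2) (c/2)) (thin_union _ _ (thin_gam p' c Hc HX) Hthin2)) as [e [He1 He2]];
      [apply Rmin_glb_lt; lra|].
    pose proof (Rmin_l (eps/2) (c/2)); pose proof (Rmin_r (eps/2) (c/2)).
    exists (Padd p' (Pconst (- e)%C)).
    assert (Hev : forall z, ev (Padd p' (Pconst (- e)%C)) z = (ev p' z - e)%C) by reflexivity.
    split; intros w Hw; rewrite Hev; destruct (Hcirc w Hw) as [_ Rw].
    + intro E; apply Csub_eq0 in E; apply He2; destruct (Rle_dec 0 (Im w)).
      * left; exists (tt (Re w)); split; [|symmetry; exact E]; split; [apply Htt, Rw|rewrite E; lra].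
      * right; exists (Re w); split; [exact Rw|symmetry; exact E].
    + set (z := if Rle_dec 0 (Im w) then gam (tt (Re w)) else g2 (Re w)).
      assert (Hz : n3 z <= B).
      { unfold z, B; destruct (Rle_dec 0 (Im w)).
        - pose proof (gam_n3 _ (Htt _ Rw)); lra.
        - specialize (Hg2n _ Rw); lra. }
      specialize (Hpp z Hz).
      replace (ev p z - (ev p' z - e))%C with ((ev p z - ev p' z) + e)%C by ring.
      eapply Rle_trans; [apply Cnorm_triang|]; lra.
Qed.
End Curves.

(** * Adjoining a fourth coordinate that generates the inverses *)

Definition d4 (z w : C4) : R :=
  Cdist (c1 z) (c1 w) + Cdist (c2 z) (c2 w) + Cdist (c3 z) (c3 w) + Cdist (c4 z) (c4 w).

Lemma C4norm_sqr z : C4norm z * C4norm z = sqn (c1 z) + sqn (c2 z) + sqn (c3 z) + sqn (c4 z).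
Proof.
  unfold C4norm, Rsqr; rewrite sqrt_sqrt; [rewrite !Cnorm_sqr; reflexivity|].
  rewrite !Cnorm_sqr; pose proof (sqn_ge0 (c1 z)); pose proof (sqn_ge0 (c2 z)).
  pose proof (sqn_ge0 (c3 z)); pose proof (sqn_ge0 (c4 z)); lra.
Qed.

Lemma C4norm_coord v z : Cnorm (coord v z) <= C4norm z.
Proof.
  apply sqr_le_inv; [apply sqrt_pos|]; rewrite C4norm_sqr, Cnorm_sqr.
  pose proof (sqn_ge0 (c1 z)); pose proof (sqn_ge0 (c2 z)).
  pose proof (sqn_ge0 (c3 z)); pose proof (sqn_ge0 (c4 z)); destruct v; simpl; lra.
Qed.

Lemma C4norm_le_sum z : C4norm z <= Cnorm (c1 z) + Cnorm (c2 z) + Cnorm (c3 z) + Cnorm (c4 z).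
Proof.
  pose proof (Cnorm_ge0 (c1 z)); pose proof (Cnorm_ge0 (c2 z)).
  pose proof (Cnorm_ge0 (c3 z)); pose proof (Cnorm_ge0 (c4 z)).
  apply sqr_le_inv; [lra|]; rewrite C4norm_sqr, <- !Cnorm_sqr; nra.
Qed.

Lemma C4dist_le_d4 z w : C4dist z w <= d4 z w.
Proof. exact (C4norm_le_sum (C4sub z w)). Qed.

Lemma d4_le_C4dist z w : d4 z w <= 4 * C4dist z w.
Proof.
  unfold C4dist, d4, Cdist.
  pose proof (C4norm_coord V1 (C4sub z w)); pose proof (C4norm_coord V2 (C4sub z w)).
  pose proof (C4norm_coord V3 (C4sub z w)); pose proof (C4norm_coord V4 (C4sub z w)).
  simpl in *; lra.
Qed.

Lemma d4_sym z w : d4 z w = d4 w z.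
Proof.
  unfold d4, Cdist; rewrite (Cnorm_sub_sym (c1 z)), (Cnorm_sub_sym (c2 z)), (Cnorm_sub_sym (c3 z)),
    (Cnorm_sub_sym (c4 z)); reflexivity.
Qed.

Lemma d4_triang z w u : d4 z u <= d4 z w + d4 w u.
Proof.
  unfold d4, Cdist; pose proof (Cnorm_sub_triang (c1 z) (c1 w) (c1 u)).
  pose proof (Cnorm_sub_triang (c2 z) (c2 w) (c2 u)); pose proof (Cnorm_sub_triang (c3 z) (c3 w) (c3 u)).
  pose proof (Cnorm_sub_triang (c4 z) (c4 w) (c4 u)); lra.
Qed.

Lemma d4_ge0 z w : 0 <= d4 z w.
Proof.
  unfold d4, Cdist; pose proof (Cnorm_ge0 (c1 z - c1 w)); pose proof (Cnorm_ge0 (c2 z - c2 w)).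
  pose proof (Cnorm_ge0 (c3 z - c3 w)); pose proof (Cnorm_ge0 (c4 z - c4 w)); lra.
Qed.

Lemma d4_eq0 z w : d4 z w = 0 -> z = w.
Proof.
  destruct z as [z1 z2 z3 z4], w as [w1 w2 w3 w4]; unfold d4, Cdist; simpl; intro H.
  pose proof (Cnorm_ge0 (z1 - w1)); pose proof (Cnorm_ge0 (z2 - w2)).
  pose proof (Cnorm_ge0 (z3 - w3)); pose proof (Cnorm_ge0 (z4 - w4)).
  f_equal; apply Csub_eq0, Cnorm_eq0; lra.
Qed.

Lemma compact_embedding {U} (dU : U -> U -> R) A (F : U -> C4) (t0 : U) :
  seqcompact dU A -> A t0 -> (forall s t, A s -> A t -> F s = F t -> s = t) ->
  continuous_on dU d4 A F ->
  homeomorphic dU C4dist A (fun w => exists t, A t /\ w = F t).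
Proof.
  intros Hc Ht0 Hinj HF.
  set (g := fun w => match excluded_middle_informative (exists t, A t /\ w = F t) with
     | left H => proj1_sig (constructive_indefinite_description _ H) | right _ => t0 end).
  assert (Hg : forall w, (exists t, A t /\ w = F t) -> A (g w) /\ w = F (g w)).
  { intros w Hw; unfold g; destruct excluded_middle_informative; [|contradiction].
    destruct constructive_indefinite_description; assumption. }
  assert (HgF : forall t, A t -> g (F t) = t).
  { intros t Ht; destruct (Hg (F t)) as [H1 H2]; [exists t; auto|]; symmetry; apply Hinj; auto. }
  exists F, g; split; [intros t Ht; exists t; auto|]; split; [intros w Hw; apply Hg, Hw|].
  split; [exact HgF|]; split; [intros w Hw; symmetry; apply Hg, Hw|]; split.
  - intros t Ht eps He; destruct (HF t Ht eps He) as [d [Hd H]]; exists d; split; [exact Hd|].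
    intros s Hs Hts; eapply Rle_lt_trans; [apply C4dist_le_d4|auto].
  - intros w [t [Ht ->]] eps He; rewrite HgF by exact Ht; apply NNPP; intro Hno.
    assert (Hch : forall n, exists s, A s /\ C4dist (F t) (F s) < / INR (S n) /\ eps <= dU t s).
    { intro n; apply NNPP; intro Hn; apply Hno; exists (/ INR (S n)); split.
      { apply Rinv_0_lt_compat, lt_0_INR; lia. }
      intros w' [s [Hs ->]] Hd; rewrite HgF by exact Hs; apply Rnot_le_lt; intro Hle.
      apply Hn; exists s; auto. }
    set (u := fun n => proj1_sig (constructive_indefinite_description _ (Hch n))).
    assert (Hu : forall n, A (u n) /\ C4dist (F t) (F (u n)) < / INR (S n) /\ eps <= dU t (u n)).
    { intro n; unfold u; destruct constructive_indefinite_description; assumption. }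
    destruct (Hc u (fun n => proj1 (Hu n))) as (phi & s & Hphi & Hs & Hcv).
    pose proof (continuous_seq _ _ _ F _ s HF Hs (fun n => proj1 (Hu (phi n))) Hcv) as HcF.
    assert (E : s = t).
    { apply Hinj; try assumption; apply d4_eq0, Rle_antisym; [|apply d4_ge0].
      apply Rnot_lt_le; intro Hlt.
      destruct (HcF (d4 (F s) (F t) / 2) ltac:(lra)) as [N HN].
      destruct (inv_INR_small (d4 (F s) (F t) / 8) ltac:(lra)) as [M HM].
      set (n := max N M); specialize (HN n ltac:(unfold n; lia)).
      assert (HM' := HM (phi n) ltac:(pose proof (incr_seq_ge phi n Hphi); unfold n in *; lia)).
      destruct (Hu (phi n)) as (_ & H1 & _); pose proof (d4_le_C4dist (F t) (F (u (phi n)))) as H2.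
      pose proof (d4_triang (F s) (F (u (phi n))) (F t)); rewrite (d4_sym (F (u (phi n))) (F t)) in *; lra. }
    subst s; destruct (Hcv eps He) as [N HN]; specialize (HN N (Nat.le_refl _)).
    destruct (Hu (phi N)) as (_ & _ & H); lra.
Qed.

Definition n4 (z : C4) : R := Cnorm (c1 z) + Cnorm (c2 z) + Cnorm (c3 z) + Cnorm (c4 z).

Lemma n4_coord v z : Cnorm (coord v z) <= n4 z.
Proof.
  unfold n4; pose proof (Cnorm_ge0 (c1 z)); pose proof (Cnorm_ge0 (c2 z)).
  pose proof (Cnorm_ge0 (c3 z)); pose proof (Cnorm_ge0 (c4 z)); destruct v; simpl; lra.
Qed.

Lemma peval_bounded Q B : exists M, 0 <= M /\ forall z, n4 z <= B -> Cnorm (peval Q z) <= M.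
Proof.
  induction Q as [c|v|p [M [HM IHp]] q [K [HK IHq]]|p [M [HM IHp]] q [K [HK IHq]]].
  - exists (Cnorm c); split; [apply Cnorm_ge0|intros; simpl; lra].
  - exists (Rabs B); split; [apply Rabs_pos|]; intros z Hz; pose proof (Rle_abs B).
    pose proof (n4_coord v z); simpl; lra.
  - exists (M + K); split; [lra|]; intros z Hz; specialize (IHp z Hz); specialize (IHq z Hz); simpl.
    eapply Rle_trans; [apply Cnorm_triang|lra].
  - exists (M * K); split; [nra|]; intros z Hz; simpl; apply Cnorm_mul_le; auto.
Qed.

Lemma peval_lipschitz Q B : exists L, 0 <= L /\ forall z w, n4 z <= B -> n4 w <= B ->
  Cnorm (peval Q z - peval Q w) <= L * d4 z w.
Proof.
  induction Q as [c|v|p [M [HM IHp]] q [K [HK IHq]]|p [M [HM IHp]] q [K [HK IHq]]].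
  - exists 0; split; [lra|]; intros; simpl; replace (c - c)%C with C0 by ring; rewrite Cnorm_0; lra.
  - exists 1; split; [lra|]; intros z w _ _; unfold d4, Cdist.
    pose proof (Cnorm_ge0 (c1 z - c1 w)); pose proof (Cnorm_ge0 (c2 z - c2 w)).
    pose proof (Cnorm_ge0 (c3 z - c3 w)); pose proof (Cnorm_ge0 (c4 z - c4 w)); destruct v; simpl; lra.
  - exists (M + K); split; [lra|]; intros z w Hz Hw; simpl.
    replace (peval p z + peval q z - (peval p w + peval q w))%C
      with ((peval p z - peval p w) + (peval q z - peval q w))%C by ring.
    eapply Rle_trans; [apply Cnorm_triang|]; specialize (IHp z w Hz Hw); specialize (IHq z w Hz Hw); lra.
  - destruct (peval_bounded p B) as [P [HP HPb]]; destruct (peval_bounded q B) as [Q [HQ HQb]].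
    exists (P * K + M * Q); split; [nra|]; intros z w Hz Hw; simpl.
    replace (peval p z * peval q z - peval p w * peval q w)%C
      with (peval p z * (peval q z - peval q w) + (peval p z - peval p w) * peval q w)%C by ring.
    eapply Rle_trans; [apply Cnorm_triang|].
    pose proof (Cnorm_mul_le _ _ _ _ (HPb z Hz) (IHq z w Hz Hw)).
    pose proof (Cnorm_mul_le _ _ _ _ (IHp z w Hz Hw) (HQb w Hw)); lra.
Qed.

Definition ext4 (z : C3) (w : C) : C4 := mkC4 (x1 z) (x2 z) (x3 z) w.

(** Putting a rational function in the fourth variable leaves a power of one fixed denominator, a
    form to which the value-attaining property of the origin applies. *)
Lemma clear_denominators (N D Q : poly4) : exists R d, forall z, ev D z <> C0 ->
  peval Q (ext4 z (ev N z / ev D z)) = (ev R z / ev D z ^ d)%C.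
Proof.
  assert (H3 : forall v, v <> V4 -> forall z w, peval (Pvar v) (ext4 z w) = ev (Pvar v) z).
  { intros [| | |] Hv; try reflexivity; congruence. }
  induction Q as [c|v|p (R & d & IHp) q (R' & d' & IHq)|p (R & d & IHp) q (R' & d' & IHq)].
  - exists (Pconst c), O; intros z _; unfold ev; simpl; field; exact C1_neq_C0.
  - destruct (classic (v = V4)) as [->|Hv].
    + exists N, 1%nat; intros z Hz; simpl; field; exact Hz.
    + exists (Pvar v), O; intros z _; rewrite H3 by exact Hv; simpl; field; exact C1_neq_C0.
  - exists (Padd (Pmul R (Ppow D d')) (Pmul R' (Ppow D d))), (d + d')%nat; intros z Hz.
    change (ev (Padd (Pmul R (Ppow D d')) (Pmul R' (Ppow D d))) z)
      with (ev R z * ev (Ppow D d') z + ev R' z * ev (Ppow D d) z)%C.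
    rewrite !ev_pow; simpl; rewrite IHp, IHq, Cpow_add by exact Hz.
    field; split; apply Cpow_neq0, Hz.
  - exists (Pmul R R'), (d + d')%nat; intros z Hz.
    change (ev (Pmul R R') z) with (ev R z * ev R' z)%C.
    simpl; rewrite IHp, IHq, Cpow_add by exact Hz; field; split; apply Cpow_neq0, Hz.
Qed.

(** [ev] reads the fourth variable as 0. Substituting that constant gives a polynomial on C^4 that
    ignores the fourth coordinate. *)
Fixpoint drop4 (p : poly4) : poly4 :=
  match p with
  | Pconst c => Pconst c
  | Pvar V4 => Pconst C0
  | Pvar v => Pvar v
  | Padd p q => Padd (drop4 p) (drop4 q)
  | Pmul p q => Pmul (drop4 p) (drop4 q)
  end.

Lemma peval_drop4 p z w : peval (drop4 p) (ext4 z w) = ev p z.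
Proof.
  induction p as [c|[| | |]|p IHp q IHq|p IHp q IHq]; try reflexivity;
    simpl; rewrite IHp, IHq; reflexivity.
Qed.

(** * Products and inverses in the algebra P(X) of a bounded set *)

Section PX.
Variables (X : C4 -> Prop) (B : R).
Hypothesis X_bounded : forall x, X x -> n4 x <= B.

Lemma in_PX_bounded f : in_PX X f -> exists M, 0 <= M /\ forall x, X x -> Cnorm (f x) <= M.
Proof.
  intro Hf; destruct (Hf 1 Rlt_0_1) as [p Hp]; destruct (peval_bounded p B) as [M [HM HMb]].
  exists (1 + M); split; [lra|]; intros x Hx; specialize (Hp x Hx); specialize (HMb x (X_bounded x Hx)).
  replace (f x) with ((f x - peval p x) + peval p x)%C by ring.
  eapply Rle_trans; [apply Cnorm_triang|]; lra.
Qed.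

Lemma in_PX_poly p : in_PX X (peval p).
Proof.
  intros eps He; exists p; intros; replace (peval p x - peval p x)%C with C0 by ring; rewrite Cnorm_0; lra.
Qed.

Lemma in_PX_mul f g : in_PX X f -> in_PX X g -> in_PX X (fun x => f x * g x)%C.
Proof.
  intros Hf Hg eps He.
  destruct (in_PX_bounded f Hf) as [P [HP HPb]]; destruct (in_PX_bounded g Hg) as [Q [HQ HQb]].
  destruct (Hg (Rmin 1 (eps / (2 * (P + 1))))) as [q Hq].
  { apply Rmin_glb_lt; [lra|apply Rdiv_lt_0_compat; lra]. }
  destruct (Hf (eps / (2 * (Q + 1)))) as [p Hp]; [apply Rdiv_lt_0_compat; lra|].
  exists (Pmul p q); intros x Hx; simpl.
  specialize (Hp x Hx); specialize (Hq x Hx); specialize (HPb x Hx); specialize (HQb x Hx).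
  assert (H1 := Rlt_le_trans _ _ _ Hq (Rmin_l _ _)); assert (H2 := Rlt_le_trans _ _ _ Hq (Rmin_r _ _)).
  assert (H3 : Cnorm (peval q x) <= Q + 1).
  { replace (peval q x) with (g x - (g x - peval q x))%C by ring.
    eapply Rle_trans; [apply Cnorm_sub_le|]; lra. }
  replace (f x * g x - peval p x * peval q x)%C
    with (f x * (g x - peval q x) + (f x - peval p x) * peval q x)%C by ring.
  eapply Rle_lt_trans; [apply Cnorm_triang|]; rewrite !Cnorm_mul.
  assert (Cnorm (f x) * Cnorm (g x - peval q x) < (P + 1) * (eps / (2 * (P + 1))))
    by (apply Rmult_le_0_lt_compat; try apply Cnorm_ge0; lra).
  assert (Cnorm (f x - peval p x) * Cnorm (peval q x) <= (eps / (2 * (Q + 1))) * (Q + 1))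
    by (apply Rmult_le_compat; try apply Cnorm_ge0; lra).
  replace ((P + 1) * (eps / (2 * (P + 1)))) with (eps/2) in * by (field; lra).
  replace ((eps / (2 * (Q + 1))) * (Q + 1)) with (eps/2) in * by (field; lra).
  lra.
Qed.

Lemma invertible_mul f g : invertible_in_PX X f -> invertible_in_PX X g ->
  invertible_in_PX X (fun x => f x * g x)%C.
Proof.
  intros [Hf [f' [Hf' Ef]]] [Hg [g' [Hg' Eg]]]; split; [apply in_PX_mul; assumption|].
  exists (fun x => f' x * g' x)%C; split; [apply in_PX_mul; assumption|]; intros x Hx.
  replace (f x * g x * (f' x * g' x))%C with ((f x * f' x) * (g x * g' x))%C by ring.
  rewrite Ef, Eg by exact Hx; ring.
Qed.

Lemma invertible_one : invertible_in_PX X (fun _ => C1).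
Proof.
  assert (H : in_PX X (fun _ => C1)) by exact (in_PX_poly (Pconst C1)).
  split; [exact H|]; exists (fun _ => C1); split; [exact H|intros; ring].
Qed.

Lemma in_PX_ext f g : (forall x, X x -> f x = g x) -> in_PX X f -> in_PX X g.
Proof.
  intros E Hf eps He; destruct (Hf eps He) as [p Hp]; exists p; intros x Hx; rewrite <- E; auto.
Qed.

Lemma invertible_inv f : invertible_in_PX X f -> invertible_in_PX X (fun x => Cinv (f x)).
Proof.
  intros [Hf [h [Hh Eh]]].
  assert (Hnz : forall x, X x -> f x <> C0).
  { intros x Hx E; specialize (Eh x Hx); rewrite E in Eh; apply C1_neq_C0; rewrite <- Eh; ring. }
  split.
  - apply (in_PX_ext h); [|exact Hh]; intros x Hx.
    transitivity (Cinv (f x) * (f x * h x))%C; [field; auto|rewrite Eh by exact Hx; ring].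
  - exists f; split; [exact Hf|]; intros x Hx; field; auto.
Qed.

(* Neumann series *)
Lemma invertible_near_one p u : (forall x, X x -> Cnorm (peval u x * peval p x - C1) <= /2) ->
  invertible_in_PX X (peval p).
Proof.
  intro H.
  assert (Hup : forall x, X x -> peval p x <> C0).
  { intros x Hx E; specialize (H x Hx); rewrite E in H.
    replace (peval u x * C0 - C1)%C with (- C1)%C in H by ring; rewrite Cnorm_opp, Cnorm_1 in H; lra. }
  split; [apply in_PX_poly|]; exists (fun x => Cinv (peval p x)); split; [|intros x Hx; field; auto].
  intros eps He; destruct (peval_bounded u B) as [M [HM HMb]].
  (* The remainder is (1 - u p)^n / p, and |u p| >= 1/2 gives 1/|p| <= 2 |u| <= 2M. *)
  destruct (half_pow_small (eps / (2 * M + 1))) as [n Hn]; [apply Rdiv_lt_0_compat; lra|].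
  specialize (Hn n (Nat.le_refl _)).
  set (e := Padd (Pconst C1) (Pmul (Pconst (- C1)%C) (Pmul u p))).
  assert (Ee : forall x, peval e x = (C1 - peval u x * peval p x)%C) by (intro; simpl; ring).
  assert (Hsum : forall k, exists s, forall x, peval s x = Csum k (fun i => peval e x ^ i)%C).
  { induction k as [|k [s Hs]]; [exists (Pconst C0); reflexivity|].
    exists (Padd s (Ppow e k)); intro x; cbn [peval Csum]; rewrite Hs; f_equal.
    clear; induction k as [|k IH]; [reflexivity|cbn [Ppow peval Cpow]; rewrite IH; reflexivity]. }
  destruct (Hsum n) as [s Hs]; exists (Pmul u s); intros x Hx.
  cbn [peval]; rewrite Hs; specialize (H x Hx); specialize (HMb x (X_bounded x Hx)).
  pose proof (Csum_geometric (peval e x) n) as Hg; rewrite Ee in Hg |- *.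
  set (p' := peval p x) in *; set (u' := peval u x) in *.
  assert (Hp0 : p' <> C0) by (apply Hup, Hx).
  set (SS := Csum n _) in *.
  replace (C1 - (C1 - u' * p'))%C with (u' * p')%C in Hg by ring.
  assert (E : (Cinv p' - u' * SS)%C = (Cinv p' * (C1 - u' * p') ^ n)%C).
  { transitivity (Cinv p' * (C1 - u' * p' * SS))%C; [field; exact Hp0|]; rewrite Hg; ring. }
  rewrite E, Cnorm_mul, Cnorm_pow, Cnorm_inv by exact Hp0.
  assert (H' : Cnorm (C1 - u' * p') <= /2) by (rewrite Cnorm_sub_sym; exact H).
  assert (Hlow : /2 <= Cnorm u' * Cnorm p').
  { rewrite <- Cnorm_mul; replace (u' * p')%C with (C1 - (C1 - u' * p'))%C by ring.
    pose proof (Cnorm_sub_ge C1 (C1 - u' * p')) as HH; rewrite Cnorm_1 in HH; lra. }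
  pose proof (Cnorm_pos _ Hp0) as Hpp.
  assert (Hinv : / Cnorm p' <= 2 * M).
  { apply Rmult_le_reg_r with (Cnorm p'); [exact Hpp|]; rewrite Rinv_l by lra.
    assert (Cnorm u' * Cnorm p' <= M * Cnorm p') by (apply Rmult_le_compat_r; lra); lra. }
  assert (Cnorm (C1 - u' * p') ^ n <= (/2)^n) by (apply pow_incr; split; [apply Cnorm_ge0|exact H']).
  assert (0 <= Cnorm (C1 - u' * p') ^ n) by (apply pow_le, Cnorm_ge0).
  assert (0 < / Cnorm p') by (apply Rinv_0_lt_compat, Hpp).
  apply Rmult_lt_compat_r with (r := 2 * M + 1) in Hn; [|lra].
  replace (eps / (2 * M + 1) * (2 * M + 1)) with eps in Hn by (field; lra).
  assert (0 < (/2)^n) by (apply pow_lt; lra).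
  nra.
Qed.
End PX.

(** * The graph over the curve of a series of reciprocals *)

Section Adjoin.
Context {U : Type} (dU : U -> U -> R) (A : U -> Prop) (G : U -> C3).
Hypothesis HG : good_curve dU A G.

Lemma A_inhabited : exists t, A t.
Proof.
  destruct (gc_hull dU A G HG (Pconst C0)) as [t [Ht _]]; [reflexivity|exists t; exact Ht].
Qed.

Lemma cont_bounded f : continuous_on dU Cdist A f -> exists M, 1 <= M /\ forall t, A t -> Cnorm (f t) <= M.
Proof.
  intro Hf; destruct A_inhabited as [t0 Ht0].
  destruct (seqcompact_max dU A (fun t => sqn (f t)) t0 (gc_compact _ _ _ HG) Ht0) as [a [Ha Hmax]].
  { apply cont_sqn, Hf. }
  exists (1 + Cnorm (f a)); pose proof (Cnorm_ge0 (f a)); split; [lra|]; intros t Ht.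
  apply Rle_trans with (Cnorm (f a)); [|lra]; apply sqr_le_inv; [lra|]; rewrite !Cnorm_sqr; auto.
Qed.

Lemma cont_ev p : continuous_on dU Cdist A (fun t => ev p (G t)).
Proof.
  intros t Ht eps He; destruct (ev_continuous p (fun _ => True) (G t) I eps He) as [d [Hd H]].
  destruct (gc_cont _ _ _ HG t Ht d Hd) as [d' [Hd' H']]; exists d'; split; [exact Hd'|].
  intros s Hs Hts; apply H; auto.
Qed.

Lemma curve_bounded : exists B, forall t, A t -> n3 (G t) <= B.
Proof.
  destruct (cont_bounded _ (cont_ev (Pvar V1))) as [M1 [_ H1]].
  destruct (cont_bounded _ (cont_ev (Pvar V2))) as [M2 [_ H2]].
  destruct (cont_bounded _ (cont_ev (Pvar V3))) as [M3 [_ H3]].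
  exists (M1 + M2 + M3); intros t Ht; unfold n3.
  specialize (H1 t Ht); specialize (H2 t Ht); specialize (H3 t Ht); unfold ev in *; simpl in *; lra.
Qed.

(** The index codes a pair (i, k): a zero-free polynomial within 1/(k+1) of the i-th one of the
    enumeration. *)
Lemma dense_units : exists P : nat -> poly4, (forall n t, A t -> ev (P n) (G t) <> C0) /\
  forall R eps, 0 < eps -> exists n, forall t, A t -> Cnorm (ev R (G t) - ev (P n) (G t)) <= eps.
Proof.
  destruct curve_bounded as [B HB].
  assert (Hch : forall n, exists p', (forall t, A t -> ev p' (G t) <> C0) /\
    forall t, A t -> Cnorm (ev (polyenum (fst (Cantor.of_nat n))) (G t) - ev p' (G t))
       <= / INR (S (snd (Cantor.of_nat n)))).
  { intro n; apply (gc_dense _ _ _ HG), Rinv_0_lt_compat, lt_0_INR; lia. }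
  set (P := fun n => proj1_sig (constructive_indefinite_description _ (Hch n))).
  assert (HP : forall n, (forall t, A t -> ev (P n) (G t) <> C0) /\
    forall t, A t -> Cnorm (ev (polyenum (fst (Cantor.of_nat n))) (G t) - ev (P n) (G t))
       <= / INR (S (snd (Cantor.of_nat n)))).
  { intro n; unfold P; destruct constructive_indefinite_description; assumption. }
  exists P; split; [intros n; apply HP|]; intros R eps He.
  destruct (polyenum_dense R B (eps/2) ltac:(lra)) as [i Hi].
  destruct (inv_INR_small (eps/2) ltac:(lra)) as [k Hk]; specialize (Hk k (Nat.le_refl _)).
  exists (Cantor.to_nat (i, k)); intros t Ht; destruct (HP (Cantor.to_nat (i, k))) as [_ H].
  specialize (H t Ht); rewrite Cantor.cancel_of_to in H; simpl fst in H; simpl snd in H.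
  specialize (Hi _ (HB t Ht)).
  eapply Rle_trans; [apply (Cnorm_sub_triang _ (ev (polyenum i) (G t)))|]; lra.
Qed.

Theorem adjoin_inverses : exists (X : C4 -> Prop) (B : R),
  (forall x, X x -> n4 x <= B) /\ homeomorphic dU C4dist A X /\
  (exists z, poly_hull X z /\ ~ X z) /\ PX_dense_invertibles X.
Proof.
  destruct dense_units as (P & HPnz & HPd); destruct curve_bounded as [BG HBG].
  set (Pi := fix Pi n := match n with O => Pconst C1 | S k => Pmul (Pi k) (P k) end).
  assert (EPi : forall n z, ev (Pi (S n)) z = (ev (Pi n) z * ev (P n) z)%C) by reflexivity.
  assert (HPinz : forall n t, A t -> ev (Pi n) (G t) <> C0).
  { induction n as [|n IH]; intros t Ht; [exact C1_neq_C0|rewrite EPi; apply Cmul_neq0; auto]. }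
  assert (Hch : forall n, exists ab : R * R, 1 <= fst ab /\ 1 <= snd ab /\ forall t, A t ->
     Cnorm (ev (Pi n) (G t)) <= fst ab /\ Cnorm (Cinv (ev (Pi n) (G t))) <= snd ab).
  { intro n; destruct (cont_bounded _ (cont_ev (Pi n))) as [M [HM HMb]].
    destruct (cont_bounded (fun t => Cinv (ev (Pi n) (G t)))) as [K [HK HKb]].
    { apply cont_inv; [apply cont_ev|apply HPinz]. }
    exists (M, K); simpl; auto. }
  set (ab := fun n => proj1_sig (constructive_indefinite_description _ (Hch n))).
  assert (Hab : forall n, 1 <= fst (ab n) /\ 1 <= snd (ab n) /\ forall t, A t ->
     Cnorm (ev (Pi n) (G t)) <= fst (ab n) /\ Cnorm (Cinv (ev (Pi n) (G t))) <= snd (ab n)).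
  { intro n; unfold ab; destruct constructive_indefinite_description; assumption. }
  set (al := fun n => fst (ab n)); set (be := fun n => snd (ab n)).
  assert (Hal : forall n, 1 <= al n) by (intro; apply Hab).
  assert (Hbe : forall n, 1 <= be n) by (intro; apply Hab).
  (* [q n] bounds the n-th term of the series. The recursion gives q (n+1) = e n / (4 al (n+1)),
     hence geometric decay with ratio 1/4, and a tail that stays below e n / 3 after multiplication
     by [Pi (S n)]. *)
  set (e := fix e n := match n with O => / be 1%nat
     | S j => e j / (4 * al (S j) * be (S (S j))) end).
  set (q := fun n => e n * be (S n)).
  assert (He : forall n, 0 < e n).
  { induction n as [|n IH]; simpl; [apply Rinv_0_lt_compat; specialize (Hbe 1%nat); lra|].
    apply Rdiv_lt_0_compat; [exact IH|]; specialize (Hal (S n)); specialize (Hbe (S (S n))); nra. }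
  assert (HqS : forall n, q (S n) = e n / (4 * al (S n))).
  { intro n; unfold q; change (e (S n)) with (e n / (4 * al (S n) * be (S (S n)))).
    specialize (Hal (S n)); specialize (Hbe (S (S n))); field; lra. }
  assert (Heq : forall n, e n <= q n) by (intro n; unfold q; specialize (He n); specialize (Hbe (S n)); nra).
  assert (Hq0 : forall n, 0 < q n) by (intro n; specialize (He n); specialize (Heq n); lra).
  assert (HqS' : forall n, q (S n) <= q n / 4).
  { intro n; rewrite HqS; specialize (Hal (S n)); specialize (He n); specialize (Heq n).
    apply Rle_trans with (e n / 4); [|lra]; unfold Rdiv; apply Rmult_le_compat_l; [lra|].
    apply Rinv_le_contravar; lra. }
  assert (Hqpow : forall n, q n <= (/2)^n).
  { induction n as [|n IH].
    - unfold q; simpl; specialize (Hbe 1%nat); rewrite Rinv_l; lra.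
    - specialize (HqS' n); specialize (Hq0 n); simpl; lra. }
  (* The series has to converge at the origin too, since its sum there is the last coordinate of the
     hull point. *)
  set (Y := fun z => z = O3 \/ exists t, A t /\ z = G t).
  (* The value v of R / Pi^d at the origin is attained on the curve: R - v Pi^d vanishes at the
     origin, hence somewhere on the curve. *)
  assert (Hattain : forall n, ev (Pi n) O3 <> C0 /\
    forall R d, exists t, A t /\ (ev R O3 / ev (Pi n) O3 ^ d = ev R (G t) / ev (Pi n) (G t) ^ d)%C).
  { intro n.
    assert (Hnz : ev (Pi n) O3 <> C0).
    { intro E; destruct (gc_hull _ _ _ HG _ E) as [t [Ht Et]]; exact (HPinz n t Ht Et). }
    split; [exact Hnz|]; intros R d.
    set (v := (ev R O3 / ev (Pi n) O3 ^ d)%C).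
    assert (Hv : forall z, ev (Padd R (Pmul (Pconst (- v)%C) (Ppow (Pi n) d))) z
       = (ev R z - v * ev (Pi n) z ^ d)%C).
    { intro z; rewrite <- ev_pow; change (ev R z + (- v) * ev (Ppow (Pi n) d) z =
        ev R z - v * ev (Ppow (Pi n) d) z)%C; ring. }
    destruct (gc_hull _ _ _ HG (Padd R (Pmul (Pconst (- v)%C) (Ppow (Pi n) d)))) as [t [Ht Et]].
    { rewrite Hv; unfold v; field; apply Cpow_neq0, Hnz. }
    rewrite Hv in Et; apply Csub_eq0 in Et; exists t; split; [exact Ht|].
    rewrite Et; field; apply Cpow_neq0, HPinz, Ht. }
  assert (HYnz : forall n z, Y z -> ev (Pi n) z <> C0).
  { intros n z [->|[t [Ht ->]]]; [apply Hattain|apply HPinz, Ht]. }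
  (* The bound on 1/Pi extends from the curve to the origin because its value there is attained on
     the curve. *)
  assert (HYbe : forall n z, Y z -> Cnorm (Cinv (ev (Pi n) z)) <= be n).
  { intros n z [->|[t [Ht ->]]]; [|apply Hab, Ht].
    destruct (proj2 (Hattain n) (Pconst C1) 1%nat) as [t [Ht Et]].
    assert (Hone : forall z, ev (Pi n) z <> C0 -> (ev (Pconst C1) z / ev (Pi n) z ^ 1)%C = Cinv (ev (Pi n) z)).
    { intros z Hz; change (ev (Pconst C1) z) with C1; simpl; field; exact Hz. }
    rewrite !Hone in Et by (try apply Hattain; apply HPinz, Ht); rewrite Et; apply Hab, Ht. }
  (* Numerators of the partial sums over the common denominator [Pi n]. *)
  set (Nn := fix Nn n := match n with O => Pconst C0
     | S k => Padd (Pmul (Nn k) (P k)) (Pconst (RtoC (e k))) end).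
  set (g := fun n z => (ev (Nn n) z / ev (Pi n) z)%C).
  assert (HgS : forall n z, Y z -> g (S n) z = (g n z + RtoC (e n) * Cinv (ev (Pi (S n)) z))%C).
  { intros n z Hz; unfold g; change (ev (Nn (S n)) z) with (ev (Nn n) z * ev (P n) z + RtoC (e n))%C.
    assert (H1 := HYnz n z Hz); assert (H2 := HYnz (S n) z Hz); rewrite EPi in *.
    field; split; [|exact H1]; intro E; apply H2; rewrite E; ring. }
  assert (Hgstep : forall n z, Y z -> Cnorm (g (S n) z - g n z) <= q n).
  { intros n z Hz; rewrite HgS by exact Hz.
    replace (g n z + RtoC (e n) * Cinv (ev (Pi (S n)) z) - g n z)%C
      with (RtoC (e n) * Cinv (ev (Pi (S n)) z))%C by ring.
    rewrite Cnorm_mul, Cnorm_RtoC, Rabs_right by (specialize (He n); lra).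
    unfold q; apply Rmult_le_compat_l; [specialize (He n); lra|apply HYbe, Hz]. }
  assert (Hgtail : forall n k z, Y z -> Cnorm (g (n + k)%nat z - g n z) <= 4/3 * q n - 4/3 * q (n + k)%nat).
  { intros n k z Hz; induction k as [|k IH].
    - rewrite Nat.add_0_r; replace (g n z - g n z)%C with C0 by ring; rewrite Cnorm_0; lra.
    - replace (n + S k)%nat with (S (n + k)) by lia.
      eapply Rle_trans; [apply (Cnorm_sub_triang _ (g (n + k)%nat z))|].
      specialize (Hgstep (n + k)%nat z Hz); specialize (HqS' (n + k)%nat); lra. }
  assert (Hlim : forall z, Y z -> exists w, forall n, Cnorm (w - g n z) <= 4/3 * q n).
  { intros z Hz; destruct (geometric_cauchy_C (fun n => g n z) 1) as [w Hw].
    { intro n; specialize (Hgstep n z Hz); specialize (Hqpow n); lra. }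
    exists w; intro n; apply Rnot_lt_le; intro Hlt.
    destruct (half_pow_small ((Cnorm (w - g n z) - 4/3 * q n) / 4)) as [k Hk]; [lra|].
    specialize (Hk (n + k)%nat ltac:(lia)); specialize (Hw (n + k)%nat).
    specialize (Hgtail n k z Hz); specialize (Hq0 (n + k)%nat).
    rewrite Cnorm_sub_sym in Hw; pose proof (Cnorm_sub_triang w (g (n + k)%nat z) (g n z)); lra. }
  set (f := fun z => match excluded_middle_informative (Y z) with
     | left H => proj1_sig (constructive_indefinite_description _ (Hlim z H)) | right _ => C0 end).
  assert (Hf : forall z n, Y z -> Cnorm (f z - g n z) <= 4/3 * q n).
  { intros z n Hz; unfold f; destruct excluded_middle_informative; [|contradiction].
    destruct constructive_indefinite_description; auto. }
  assert (HYG : forall t, A t -> Y (G t)) by (intros t Ht; right; exists t; auto).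
  assert (HYO : Y O3) by (left; reflexivity).
  assert (Hg0 : forall z, Y z -> g O z = C0).
  { intros z Hz; unfold g; change (ev (Nn O) z) with C0; field; apply HYnz, Hz. }
  assert (Hq1 : q O <= 1) by (specialize (Hqpow O); simpl in Hqpow; lra).
  assert (Hgb : forall n z, Y z -> Cnorm (g n z) <= 4).
  { intros n z Hz; pose proof (Hgtail O n z Hz) as H; simpl in H; rewrite (Hg0 z Hz) in H.
    replace (g n z - C0)%C with (g n z) in H by ring; specialize (Hq0 n); lra. }
  assert (Hfb : forall z, Y z -> Cnorm (f z) <= 4).
  { intros z Hz; pose proof (Hf z O Hz) as H; rewrite (Hg0 z Hz) in H.
    replace (f z - C0)%C with (f z) in H by ring; lra. }
  set (B := Rabs BG + 4).
  assert (HYB : forall z w, Y z -> Cnorm w <= 4 -> n4 (ext4 z w) <= B).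
  { intros z w Hz Hw; assert (n3 z <= Rabs BG).
    { destruct Hz as [->|[t [Ht ->]]].
      - unfold n3, O3, x1, x2, x3; simpl; rewrite Cnorm_0; pose proof (Rabs_pos BG); lra.
      - pose proof (HBG t Ht); pose proof (Rle_abs BG); lra. }
    unfold n4, ext4, n3, B in *; simpl; lra. }
  assert (Hd4 : forall z w w', d4 (ext4 z w) (ext4 z w') = Cnorm (w - w')).
  { intros z w w'; unfold d4, ext4, Cdist; simpl.
    replace (x1 z - x1 z)%C with C0 by ring; replace (x2 z - x2 z)%C with C0 by ring.
    replace (x3 z - x3 z)%C with C0 by ring; rewrite Cnorm_0; ring. }
  assert (Hclose : forall Q eps, 0 < eps -> exists n, forall z, Y z ->
     Cnorm (peval Q (ext4 z (f z)) - peval Q (ext4 z (g n z))) <= eps).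
  { intros Q eps Heps; destruct (peval_lipschitz Q B) as [L [HL HLb]].
    destruct (half_pow_small (eps / (2 * (L + 1)))) as [n Hn]; [apply Rdiv_lt_0_compat; lra|].
    specialize (Hn n (Nat.le_refl _)); exists n; intros z Hz.
    eapply Rle_trans; [apply HLb; apply HYB; auto|]; rewrite Hd4.
    specialize (Hf z n Hz); specialize (Hqpow n).
    apply Rle_trans with (L * (2 * (/2)^n)); [apply Rmult_le_compat_l; [exact HL|]; specialize (Hq0 n); lra|].
    apply Rmult_lt_compat_r with (r := 2 * (L + 1)) in Hn; [|lra].
    replace (eps / (2 * (L + 1)) * (2 * (L + 1))) with eps in Hn by (field; lra).
    assert (0 < (/2)^n) by (apply pow_lt; lra); nra. }
  set (X := fun w => exists t, A t /\ w = ext4 (G t) (f (G t))).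
  assert (HXB : forall x, X x -> n4 x <= B).
  { intros x [t [Ht ->]]; apply HYB; auto. }
  exists X, B; split; [exact HXB|]; split; [|split].
  - destruct A_inhabited as [t0 Ht0].
    apply (compact_embedding dU A (fun t => ext4 (G t) (f (G t))) t0 (gc_compact _ _ _ HG) Ht0).
    + intros s t Hs Ht E; apply (gc_inj _ _ _ HG); auto.
      unfold ext4 in E; injection E; intros _ E3 E2 E1.
      destruct (G s) as [[? ?] ?], (G t) as [[? ?] ?]; unfold x1, x2, x3 in *; simpl in *; congruence.
    + intros t Ht eps Heps.
      destruct (gc_cont _ _ _ HG t Ht (eps/4) ltac:(lra)) as [d1 [Hd1 H1]].
      destruct (half_pow_small (eps/8)) as [n Hn]; [lra|]; specialize (Hn n (Nat.le_refl _)).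
      assert (Hcg : continuous_on dU Cdist A (fun t => g n (G t))).
      { apply (cont_mul dU A (fun t => ev (Nn n) (G t)) (fun t => Cinv (ev (Pi n) (G t)))); [apply cont_ev|].
        apply cont_inv; [apply cont_ev|apply HPinz]. }
      destruct (Hcg t Ht (eps/4) ltac:(lra)) as [d2 [Hd2 H2]].
      exists (Rmin d1 d2); split; [apply Rmin_glb_lt; assumption|]; intros s Hs Hts.
      specialize (H1 s Hs (Rlt_le_trans _ _ _ Hts (Rmin_l _ _))).
      specialize (H2 s Hs (Rlt_le_trans _ _ _ Hts (Rmin_r _ _))).
      assert (Hff : Cnorm (f (G t) - f (G s)) < 3 * eps / 4).
      { pose proof (Hf (G t) n (HYG t Ht)) as F1; pose proof (Hf (G s) n (HYG s Hs)) as F2.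
        rewrite Cnorm_sub_sym in F2; specialize (Hqpow n); unfold Cdist in H2.
        pose proof (Cnorm_sub_triang (f (G t)) (g n (G t)) (f (G s))).
        pose proof (Cnorm_sub_triang (g n (G t)) (g n (G s)) (f (G s))); lra. }
      unfold d4, ext4; simpl; unfold d3, Cdist in *; lra.
  - exists (ext4 O3 (f O3)); split.
    + intros Q M HM; apply Rnot_lt_le; intro Hlt.
      set (eps := (Cnorm (peval Q (ext4 O3 (f O3))) - M) / 3).
      assert (Heps : 0 < eps) by (unfold eps; lra).
      destruct (Hclose Q eps Heps) as [n Hn].
      (* With f replaced by a partial sum, Q becomes R / Pi^d, whose value at the origin recurs on
         the curve; [eps] is a third of the supposed excess, and the two replacements use two
         thirds. *)
      destruct (clear_denominators (Nn n) (Pi n) Q) as (R & d & HR).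
      destruct (proj2 (Hattain n) R d) as [t [Ht Et]].
      assert (Ev : peval Q (ext4 O3 (g n O3)) = peval Q (ext4 (G t) (g n (G t)))).
      { unfold g; rewrite !HR by (apply HYnz; auto); exact Et. }
      pose proof (Hn O3 HYO) as E1; pose proof (Hn (G t) (HYG t Ht)) as E2.
      specialize (HM (ext4 (G t) (f (G t))) (ex_intro _ t (conj Ht eq_refl))).
      rewrite Ev in E1; rewrite Cnorm_sub_sym in E2.
      pose proof (Cnorm_sub_ge (peval Q (ext4 O3 (f O3))) (peval Q (ext4 (G t) (g n (G t))))).
      pose proof (Cnorm_sub_ge (peval Q (ext4 (G t) (g n (G t)))) (peval Q (ext4 (G t) (f (G t))))).
      unfold eps in *; lra.
    + intros [t [Ht E]]; apply (gc_origin _ _ _ HG t Ht).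
      unfold ext4 in E; injection E; intros _ E3 E2 E1.
      destruct (G t) as [[? ?] ?]; unfold O3, x1, x2, x3 in *; simpl in *; congruence.
  (* (Pi_n f - N_n) / e_n is an approximate inverse of P_n: the product is 1 + Pi_(n+1) (f -
     g_(n+1)) / e_n, and the tail estimate makes the error at most 1/3. *)
  - assert (Hunit : forall n, invertible_in_PX X (peval (drop4 (P n)))).
    { intro n; apply (invertible_near_one X B HXB _
        (Pmul (Pconst (RtoC (/ e n)))
          (Padd (Pmul (drop4 (Pi n)) (Pvar V4)) (Pmul (Pconst (- C1)%C) (drop4 (Nn n)))))).
      intros x [t [Ht ->]]; cbn [peval]; rewrite !peval_drop4; simpl coord.
      set (z := G t); assert (Hz : Y z) by (apply HYG, Ht).
      assert (HP0 : ev (P n) z <> C0) by (apply HPnz, Ht).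
      assert (HPi0 : ev (Pi n) z <> C0) by (apply HYnz, Hz).
      specialize (He n).
      assert (HeC : (RtoC (/ e n) * RtoC (e n))%C = C1) by (Cext; field; lra).
      assert (E : (RtoC (/ e n) * (ev (Pi n) z * f z + - C1 * ev (Nn n) z) * ev (P n) z - C1)%C
        = (RtoC (/ e n) * (ev (Pi (S n)) z * (f z - g (S n) z)))%C).
      { rewrite HgS by exact Hz; rewrite EPi; unfold g.
        replace (RtoC (/ e n) * (ev (Pi n) z * ev (P n) z * (f z - (ev (Nn n) z / ev (Pi n) z
            + RtoC (e n) * Cinv (ev (Pi n) z * ev (P n) z)))))%C
          with (RtoC (/ e n) * (ev (Pi n) z * f z + - C1 * ev (Nn n) z) * ev (P n) z
            - RtoC (/ e n) * RtoC (e n))%C; [rewrite HeC; reflexivity|].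
        field; split; assumption. }
      rewrite E, !Cnorm_mul, Cnorm_RtoC, Rabs_right by (left; apply Rinv_0_lt_compat, He).
      pose proof (Hf z (S n) Hz) as HF; rewrite HqS in HF.
      assert (HA : Cnorm (ev (Pi (S n)) z) <= al (S n)) by (apply Hab, Ht).
      specialize (Hal (S n)).
      pose proof (Cnorm_ge0 (ev (Pi (S n)) z)); pose proof (Cnorm_ge0 (f z - g (S n) z)).
      assert (Cnorm (ev (Pi (S n)) z) * Cnorm (f z - g (S n) z) <= al (S n) * (4 / 3 * (e n / (4 * al (S n)))))
        by (apply Rmult_le_compat; assumption).
      replace (al (S n) * (4 / 3 * (e n / (4 * al (S n))))) with (e n / 3) in H1 by (field; lra).
      apply Rmult_le_reg_l with (e n); [exact He|].
      rewrite <- Rmult_assoc, Rinv_r, Rmult_1_l by lra; lra. }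
    assert (HPiunit : forall n, invertible_in_PX X (peval (drop4 (Pi n)))).
    { induction n as [|n IH]; [apply invertible_one|].
      apply (invertible_mul X B HXB (peval (drop4 (Pi n))) (peval (drop4 (P n)))); auto. }
    assert (Hpowunit : forall n d, invertible_in_PX X (fun x => Cinv (peval (drop4 (Pi n)) x) ^ d)%C).
    { intros n d; induction d as [|d IH]; [apply invertible_one|].
      apply (invertible_mul X B HXB (fun x => Cinv (peval (drop4 (Pi n)) x))
         (fun x => Cinv (peval (drop4 (Pi n)) x) ^ d)%C); [apply invertible_inv, HPiunit|exact IH]. }
    (* F is replaced successively by a polynomial Q, by R / Pi^d, and by P_m / Pi^d, a product of
       units. P_m approximates R within eps / (4 be^d), to pay for the division by Pi^d. *)
    intros F HF eps Heps; destruct (HF (eps/4) ltac:(lra)) as [Q HQ].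
    destruct (Hclose Q (eps/4) ltac:(lra)) as [n Hn].
    destruct (clear_denominators (Nn n) (Pi n) Q) as (R & d & HR).
    assert (Hbd : 0 < be n ^ d) by (apply pow_lt; specialize (Hbe n); lra).
    destruct (HPd R (eps / 4 / be n ^ d)) as [m Hm]; [apply Rdiv_lt_0_compat; lra|].
    exists (fun x => peval (drop4 (P m)) x * Cinv (peval (drop4 (Pi n)) x) ^ d)%C; split.
    + apply (invertible_mul X B HXB (peval (drop4 (P m)))
        (fun x => Cinv (peval (drop4 (Pi n)) x) ^ d)%C); auto.
    + intros x Hx; specialize (HQ x Hx); destruct Hx as [t [Ht ->]]; rewrite !peval_drop4.
      specialize (Hn (G t) (HYG t Ht)); specialize (Hm t Ht).
      unfold g in Hn; rewrite HR in Hn by (apply HPinz, Ht).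
      set (z := G t) in *; set (D := ev (Pi n) z) in *.
      assert (HD : D <> C0) by (apply HPinz, Ht).
      assert (E : (ev R z / D ^ d)%C = (ev R z * Cinv D ^ d)%C).
      { unfold Cdiv; f_equal; clear -HD; induction d as [|d IH]; simpl; [field; exact C1_neq_C0|].
        rewrite <- IH; field; split; [apply Cpow_neq0|]; exact HD. }
      rewrite E in Hn.
      assert (H3 : Cnorm (ev R z * Cinv D ^ d - ev (P m) z * Cinv D ^ d) <= eps/4).
      { replace (ev R z * Cinv D ^ d - ev (P m) z * Cinv D ^ d)%C
          with ((ev R z - ev (P m) z) * Cinv D ^ d)%C by ring.
        replace (eps/4) with (eps / 4 / be n ^ d * be n ^ d) by (field; lra).
        apply Cnorm_mul_le; [exact Hm|]; rewrite Cnorm_pow; apply pow_incr.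
        split; [apply Cnorm_ge0|apply Hab, Ht]. }
      set (c := peval Q _) in *.
      pose proof (Cnorm_sub_triang (F (ext4 z (f z))) c (ev (P m) z * Cinv D ^ d)).
      pose proof (Cnorm_sub_triang c (ev R z * Cinv D ^ d) (ev (P m) z * Cinv D ^ d)); lra.
Qed.
End Adjoin.

(** * Dense invertibles exclude analytic discs *)

Section Crossings.
Variables (n : nat) (F : nat -> nat -> C) (m : R).
Hypothesis m_pos : 0 < m.
Hypothesis F_low : forall i j, (i <= n)%nat -> (j <= n)%nat -> m <= Cnorm (F i j).
Hypothesis F_var : forall i j i' j', (i <= n)%nat -> (j <= n)%nat -> (i' <= n)%nat -> (j' <= n)%nat ->
  (i' <= S i)%nat -> (i <= S i')%nat -> (j' <= S j)%nat -> (j <= S j')%nat ->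
  Cnorm (F i j - F i' j') < m / 4.

Let s (i j : nat) : bool := if Rle_dec 0 (Im (F i j)) then true else false.
Let neg (i j : nat) : bool := if Rlt_dec (Re (F i j)) 0 then true else false.
Let cross (i j i' j' : nat) : bool := xorb (s i j) (s i' j') && neg i j.

(** A sign change of Im between neighbours forces |Im| < m/4, hence |Re| > 3m/4 by the lower bound
    m. Neighbouring values differ by less than m/4, so Re keeps its sign. *)
Lemma crossing_side i j i' j' k l : (i <= n)%nat -> (j <= n)%nat -> (i' <= n)%nat -> (j' <= n)%nat ->
  (k <= n)%nat -> (l <= n)%nat ->
  (i' <= S i)%nat -> (i <= S i')%nat -> (j' <= S j)%nat -> (j <= S j')%nat ->
  (k <= S i)%nat -> (i <= S k)%nat -> (l <= S j)%nat -> (j <= S l)%nat ->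
  s i j <> s i' j' -> neg i j = neg k l.
Proof.
  intros Li Lj Li' Lj' Lk Ll D1 D2 D3 D4 D5 D6 D7 D8 Hs.
  pose proof (F_low i j ltac:(assumption) ltac:(assumption)) as H1.
  assert (H2 : Cnorm (F i j - F i' j') < m / 4) by (apply F_var; assumption).
  assert (H3 : Cnorm (F i j - F k l) < m / 4) by (apply F_var; assumption).
  pose proof (Im_le_Cnorm (F i j - F i' j')) as H4; pose proof (Re_le_Cnorm (F i j - F k l)) as H5.
  pose proof (Cnorm_le_parts (F i j)) as H6; simpl in H4, H5.
  assert (H7 := Rle_lt_trans _ _ _ H4 H2); assert (H8 := Rle_lt_trans _ _ _ H5 H3).
  apply Rabs_def2 in H7; apply Rabs_def2 in H8.
  assert (HI : Rabs (Im (F i j)) < m / 4).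
  { unfold s in *; destruct (Rle_dec 0 (Im (F i j))); destruct (Rle_dec 0 (Im (F i' j'))); try congruence;
      apply Rabs_def1; lra. }
  assert (HR : 3 * m / 4 < Rabs (Re (F i j))) by lra.
  unfold neg; destruct (Rlt_dec (Re (F i j)) 0); destruct (Rlt_dec (Re (F k l)) 0); try reflexivity.
  - rewrite Rabs_left in HR; lra.
  - rewrite Rabs_right in HR; lra.
Qed.

(** The boundary of a cell crosses the negative axis an even number of times: either Im has one sign
    on the four corners, or [neg] agrees at the base points of all four edges and the sign changes
    cancel around the loop. *)
Lemma cell_parity i j : (i < n)%nat -> (j < n)%nat ->
  xorb (xorb (cross i j (S i) j) (cross i (S j) (S i) (S j)))
       (xorb (cross i j i (S j)) (cross (S i) j (S i) (S j))) = false.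
Proof.
  intros Hi Hj; unfold cross.
  assert (Hall : s i j = s (S i) j /\ s i j = s i (S j) /\ s i j = s (S i) (S j) \/
     neg i j = neg (S i) j /\ neg i j = neg i (S j)).
  { destruct (bool_dec (s i j) (s (S i) j)) as [E1|N1].
    2:{ right; split; apply (crossing_side i j (S i) j); auto; lia. }
    destruct (bool_dec (s i j) (s i (S j))) as [E2|N2].
    2:{ right; split; apply (crossing_side i j i (S j)); auto; lia. }
    destruct (bool_dec (s i j) (s (S i) (S j))) as [E3|N3].
    2:{ right; split; apply (crossing_side i j (S i) (S j)); auto; lia. }
    left; auto. }
  destruct Hall as [(E1 & E2 & E3)|(E1 & E2)].
  - rewrite <- E1, <- E2, <- E3, !xorb_nilpotent; reflexivity.
  - rewrite <- E1, <- E2.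
    destruct (s i j), (s (S i) j), (s i (S j)), (s (S i) (S j)), (neg i j); reflexivity.
Qed.

Fixpoint column (i J : nat) : bool :=
  match J with O => false | S j => xorb (column i j) (cross i j i (S j)) end.

(** Sum of [cell_parity] over the cells between two adjacent columns; inner horizontal edges
    cancel. *)
Lemma column_step i J : (i < n)%nat -> (J <= n)%nat ->
  xorb (column i J) (column (S i) J) = xorb (cross i 0 (S i) 0) (cross i J (S i) J).
Proof.
  intros Hi; induction J as [|j IH]; intro HJ.
  - simpl; rewrite xorb_nilpotent; reflexivity.
  - specialize (IH ltac:(lia)); pose proof (cell_parity i j Hi ltac:(lia)) as Hc; cbn [column].
    destruct (column i j), (column (S i) j), (cross i 0 (S i) 0), (cross i j (S i) j),
      (cross i (S j) (S i) (S j)), (cross i j i (S j)), (cross (S i) j (S i) (S j)); simpl in *; congruence.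
Qed.

(** No sign change occurs along the bottom or the top, so full columns all have the same parity. The
    right column has parity 0, as Re > 0 there; on the left Re < 0, every sign change counts, and Im
    goes from negative to positive, so the parity is 1. *)
Lemma no_grid_map :
  (forall i, (i <= n)%nat -> Im (F i O) < 0) -> (forall i, (i <= n)%nat -> 0 < Im (F i n)) ->
  (forall j, (j <= n)%nat -> Re (F O j) < 0) -> (forall j, (j <= n)%nat -> 0 < Re (F n j)) -> False.
Proof.
  intros Hbot Htop Hleft Hright.
  assert (Sb : forall i, (i <= n)%nat -> s i O = false).
  { intros i Hi; specialize (Hbot i Hi); unfold s; destruct Rle_dec; [lra|reflexivity]. }
  assert (St : forall i, (i <= n)%nat -> s i n = true).
  { intros i Hi; specialize (Htop i Hi); unfold s; destruct Rle_dec; [reflexivity|lra]. }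
  assert (Hcols : forall i, (i <= n)%nat -> column i n = column 0 n).
  { induction i as [|i IH]; intro Hi; [reflexivity|].
    pose proof (column_step i n ltac:(lia) (Nat.le_refl _)) as H; unfold cross in H.
    rewrite !Sb, !St in H by lia; simpl in H; rewrite (IH ltac:(lia)) in H.
    apply xorb_eq in H; symmetry; exact H. }
  assert (Hr : forall J, (J <= n)%nat -> column n J = false).
  { induction J as [|j IH]; intro HJ; [reflexivity|]; cbn [column]; rewrite IH by lia; unfold cross, neg.
    specialize (Hright j ltac:(lia)); destruct Rlt_dec; [lra|]; rewrite andb_false_r; reflexivity. }
  assert (Hl : forall J, (J <= n)%nat -> column 0 J = xorb (s 0 0) (s 0 J)).
  { induction J as [|j IH]; intro HJ; [simpl; rewrite xorb_nilpotent; reflexivity|].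
    cbn [column]; rewrite IH by lia; unfold cross, neg; specialize (Hleft j ltac:(lia)).
    destruct Rlt_dec; [|lra]; rewrite andb_true_r.
    destruct (s 0 0), (s 0 j), (s 0 (S j)); reflexivity. }
  pose proof (Hcols n (Nat.le_refl _)) as H; rewrite Hr, Hl in H by lia.
  rewrite Sb, St in H by lia; discriminate.
Qed.
End Crossings.

(** * Perturbations of the identity on a square *)

Definition square (z : C) : Prop := -1 <= Re z <= 1 /\ -1 <= Im z <= 1.

Lemma square_norm z : square z -> Cnorm z <= 2.
Proof.
  intros [H1 H2]; eapply Rle_trans; [apply Cnorm_le_parts|].
  assert (Rabs (Re z) <= 1) by (apply Rabs_le; lra); assert (Rabs (Im z) <= 1) by (apply Rabs_le; lra); lra.
Qed.

Lemma seqcompact_square : seqcompact Cdist square.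
Proof.
  intros u Hu; destruct (bolzano_weierstrass_C u 2) as (phi & l & Hphi & Hl).
  { intro k; apply square_norm, Hu. }
  exists phi, l; split; [exact Hphi|]; split; [|exact Hl].
  assert (Hc : forall eps, 0 < eps -> exists k, Rabs (Re l - Re (u (phi k))) < eps /\ Rabs (Im l - Im (u (phi k))) < eps).
  { intros eps He; destruct (Hl eps He) as [N HN]; specialize (HN N (Nat.le_refl _)); exists N; unfold Cdist in HN.
    pose proof (Re_le_Cnorm (l - u (phi N))); pose proof (Im_le_Cnorm (l - u (phi N))).
    simpl in *; unfold Rminus; lra. }
  split; split; apply Rnot_lt_le; intro Hlt.
  - destruct (Hc (-1 - Re l) ltac:(lra)) as [k [H1 _]]; destruct (Hu (phi k)); apply Rabs_def2 in H1; lra.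
  - destruct (Hc (Re l - 1) ltac:(lra)) as [k [H1 _]]; destruct (Hu (phi k)); apply Rabs_def2 in H1; lra.
  - destruct (Hc (-1 - Im l) ltac:(lra)) as [k [_ H1]]; destruct (Hu (phi k)); apply Rabs_def2 in H1; lra.
  - destruct (Hc (Im l - 1) ltac:(lra)) as [k [_ H1]]; destruct (Hu (phi k)); apply Rabs_def2 in H1; lra.
Qed.

Lemma heine_square (H : C -> C) : continuous_on Cdist Cdist square H -> forall eps, 0 < eps ->
  exists de, 0 < de /\ forall z w, square z -> square w -> Cnorm (z - w) < de -> Cnorm (H z - H w) < eps.
Proof.
  intros HH eps He; apply NNPP; intro Hno.
  assert (Hch : forall k, exists zw : C * C, square (fst zw) /\ square (snd zw) /\
     Cnorm (fst zw - snd zw) < / INR (S k) /\ eps <= Cnorm (H (fst zw) - H (snd zw))).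
  { intro k; apply NNPP; intro Hn; apply Hno; exists (/ INR (S k)); split.
    { apply Rinv_0_lt_compat, lt_0_INR; lia. }
    intros z w Hz Hw Hd; apply Rnot_le_lt; intro Hle; apply Hn; exists (z, w); auto. }
  set (u := fun k => proj1_sig (constructive_indefinite_description _ (Hch k))).
  assert (Hu : forall k, square (fst (u k)) /\ square (snd (u k)) /\
     Cnorm (fst (u k) - snd (u k)) < / INR (S k) /\ eps <= Cnorm (H (fst (u k)) - H (snd (u k)))).
  { intro k; unfold u; destruct constructive_indefinite_description; assumption. }
  destruct (seqcompact_square (fun k => fst (u k)) (fun k => proj1 (Hu k))) as (phi & a & Hphi & Ha & Hcv).
  destruct (HH a Ha (eps/2) ltac:(lra)) as [d [Hd Hc]].
  destruct (Hcv (d/2) ltac:(lra)) as [N HN]; destruct (inv_INR_small (d/2) ltac:(lra)) as [M HM].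
  set (k := max N M); specialize (HN k ltac:(unfold k; lia)).
  assert (HM' := HM (phi k) ltac:(pose proof (incr_seq_ge phi k Hphi); unfold k in *; lia)).
  destruct (Hu (phi k)) as (U1 & U2 & U3 & U4); unfold Cdist in *.
  pose proof (Hc _ U1 ltac:(lra)) as C1'.
  pose proof (Cnorm_sub_triang a (fst (u (phi k))) (snd (u (phi k)))).
  pose proof (Hc _ U2 ltac:(lra)) as C2'.
  rewrite Cnorm_sub_sym in C1'.
  pose proof (Cnorm_sub_triang (H (fst (u (phi k)))) (H a) (H (snd (u (phi k))))); lra.
Qed.

(* A parity count of the crossings of the negative real axis along a fine grid
   replaces the winding number. *)
Lemma square_map_has_zero (H : C -> C) : continuous_on Cdist Cdist square H ->
  (forall z, square z -> Cnorm (H z - z) <= /2) -> exists z, square z /\ H z = C0.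
Proof.
  intros HH Hid; apply NNPP; intro Hno.
  assert (Hnz : forall z, square z -> H z <> C0) by (intros z Hz E; apply Hno; exists z; auto).
  assert (Hsq0 : square C0) by (unfold square; simpl; lra).
  (* A positive minimum of |H|, read off from the maximum of 1/|H|^2. *)
  destruct (seqcompact_max Cdist square (fun z => sqn (Cinv (H z))) C0 seqcompact_square Hsq0)
    as [a [Ha Hmax]].
  { apply cont_sqn, cont_inv; [exact HH|exact Hnz]. }
  set (m := Cnorm (H a)); assert (Hm : 0 < m) by (apply Cnorm_pos, Hnz, Ha).
  assert (Hlow : forall z, square z -> m <= Cnorm (H z)).
  { intros z Hz; specialize (Hmax z Hz); assert (Hz' := Cnorm_pos _ (Hnz z Hz)).
    assert (Hi : / Cnorm (H z) <= / m).
    { unfold m; rewrite <- !Cnorm_inv by auto; apply sqr_le_inv; [apply Cnorm_ge0|]; rewrite !Cnorm_sqr; exact Hmax. }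
    apply Rinv_le_contravar in Hi; [|apply Rinv_0_lt_compat, Hz'].
    rewrite !Rinv_inv in Hi; exact Hi. }
  destruct (heine_square H HH (m/4) ltac:(lra)) as [d [Hd Hunif]].
  (* The mesh is 2/n in each coordinate, so neighbouring nodes, diagonal ones included, are at most
     4/n < d apart. *)
  destruct (inv_INR_small (d/8) ltac:(lra)) as [k Hk]; specialize (Hk k (Nat.le_refl _)).
  set (n := S k) in *; assert (Hn : 0 < INR n) by (apply lt_0_INR; unfold n; lia).
  set (x := fun i : nat => -1 + 2 * INR i / INR n).
  assert (Hx : forall i, (i <= n)%nat -> -1 <= x i <= 1).
  { intros i Hi; apply le_INR in Hi; pose proof (pos_INR i); unfold x.
    assert (0 <= INR i / INR n <= 1).
    { split; [apply Rmult_le_pos; [lra|left; apply Rinv_0_lt_compat, Hn]|].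
      apply Rmult_le_reg_r with (INR n); [exact Hn|]; replace (INR i / INR n * INR n) with (INR i) by (field; lra); lra. }
    unfold Rdiv in *; lra. }
  assert (Hxd : forall i i', (i' <= S i)%nat -> (i <= S i')%nat -> Rabs (x i - x i') <= 2 * / INR n).
  { intros i i' H1 H2; apply le_INR in H1, H2; rewrite S_INR in H1, H2.
    unfold x; replace (-1 + 2 * INR i / INR n - (-1 + 2 * INR i' / INR n))
      with (2 * / INR n * (INR i - INR i')) by (field; lra).
    assert (0 < / INR n) by (apply Rinv_0_lt_compat, Hn).
    rewrite Rabs_mult, (Rabs_right (2 * / INR n)) by lra.
    assert (Rabs (INR i - INR i') <= 1) by (apply Rabs_le; lra); nra. }
  set (v := fun i j => mkC (x i) (x j)).
  assert (Hv : forall i j, (i <= n)%nat -> (j <= n)%nat -> square (v i j)).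
  { intros i j Hi Hj; split; simpl; apply Hx; assumption. }
  assert (Ex0 : x O = -1) by (unfold x; change (INR 0) with 0; unfold Rdiv; ring).
  assert (Exn : x n = 1) by (unfold x; field; lra).
  assert (HRe : forall z, square z -> Rabs (Re (H z) - Re z) <= /2).
  { intros z Hz; eapply Rle_trans; [|apply (Hid z Hz)]; exact (Re_le_Cnorm (H z - z)). }
  assert (HIm : forall z, square z -> Rabs (Im (H z) - Im z) <= /2).
  { intros z Hz; eapply Rle_trans; [|apply (Hid z Hz)]; exact (Im_le_Cnorm (H z - z)). }
  assert (Habs : forall r t, Rabs (r - t) <= /2 -> t - /2 <= r <= t + /2).
  { intros r t Hr; pose proof (Rle_abs (r - t)); pose proof (Rle_abs (- (r - t))); rewrite Rabs_Ropp in *; lra. }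
  apply (no_grid_map n (fun i j => H (v i j)) m Hm).
  - intros i j Hi Hj; apply Hlow, Hv; assumption.
  - intros i j i' j' Hi Hj Hi' Hj' D1 D2 D3 D4; apply Hunif; try (apply Hv; assumption).
    eapply Rle_lt_trans; [apply Cnorm_le_parts|]; simpl.
    pose proof (Hxd i i' D1 D2); pose proof (Hxd j j' D3 D4); unfold Rminus in *; lra.
  - intros i Hi; pose proof (Habs _ _ (HIm _ (Hv i O Hi ltac:(lia)))) as E; simpl Im in E; rewrite Ex0 in E; lra.
  - intros i Hi; pose proof (Habs _ _ (HIm _ (Hv i n Hi (Nat.le_refl _)))) as E; simpl Im in E; rewrite Exn in E; lra.
  - intros j Hj; pose proof (Habs _ _ (HRe _ (Hv O j ltac:(lia) Hj))) as E; simpl Re in E; rewrite Ex0 in E; lra.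
  - intros j Hj; pose proof (Habs _ _ (HRe _ (Hv n j (Nat.le_refl _) Hj))) as E; simpl Re in E; rewrite Exn in E; lra.
Qed.

(** * Derivatives of analytic discs and the exclusion of discs from the hull *)

Lemma coord_derivative sigma w L : (forall eps, eps > 0 -> exists delta, delta > 0 /\
    forall h : C, 0 < Cnorm h < delta ->
      C4norm (C4sub (C4sub (sigma (Cadd w h)) (sigma w)) (C4scal h L)) <= eps * Cnorm h) ->
  forall v eps, 0 < eps -> exists delta, 0 < delta /\ forall h, Cnorm h < delta ->
    Cnorm (coord v (sigma (w + h)%C) - coord v (sigma w) - h * coord v L) <= eps * Cnorm h.
Proof.
  intros HL v eps He; destruct (HL eps He) as [d [Hd H]]; exists d; split; [exact Hd|]; intros h Hh.
  destruct (Cnorm_ge0 h) as [Hp|Hz].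
  - eapply Rle_trans; [|apply H; lra].
    eapply Rle_trans; [|apply (C4norm_coord v)]; right; destruct v; reflexivity.
  - symmetry in Hz; apply Cnorm_eq0 in Hz; subst h.
    replace (w + C0)%C with w by ring.
    replace (coord v (sigma w) - coord v (sigma w) - C0 * coord v L)%C with C0 by ring.
    rewrite Cnorm_0; lra.
Qed.

(** If every coordinate derivative vanished on the disc, the mean value theorem on the real segment
    from 0 to 1/2, applied to real and imaginary parts, would make sigma constant there, against
    injectivity. *)
Lemma analytic_disc_regular_point sigma : analytic_disc sigma ->
  exists w v la, open_unit_disc w /\ la <> C0 /\
   forall eps, 0 < eps -> exists delta, 0 < delta /\ forall h, Cnorm h < delta ->
    Cnorm (coord v (sigma (w + h)%C) - coord v (sigma w) - h * la) <= eps * Cnorm h.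
Proof.
  intros [Hhol Hinj]; apply NNPP; intro Hno.
  assert (Hder : forall w, open_unit_disc w -> forall v eps, 0 < eps -> exists delta, 0 < delta /\
    forall h, Cnorm h < delta -> Cnorm (coord v (sigma (w + h)%C) - coord v (sigma w)) <= eps * Cnorm h).
  { intros w Hw v eps He; destruct (Hhol w Hw) as [L HL].
    pose proof (coord_derivative sigma w L HL v) as Hd.
    assert (E : coord v L = C0).
    { apply NNPP; intro Hne; apply Hno; exists w, v, (coord v L); auto. }
    destruct (Hd eps He) as [d [Hd0 H]]; exists d; split; [exact Hd0|]; intros h Hh.
    specialize (H h Hh); rewrite E in H.
    replace (coord v (sigma (w + h)%C) - coord v (sigma w) - h * C0)%C
      with (coord v (sigma (w + h)%C) - coord v (sigma w))%C in H by ring; exact H. }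
  assert (Hdisc : forall t, 0 <= t <= /2 -> open_unit_disc (RtoC t)).
  { intros t Ht; unfold open_unit_disc; rewrite Cnorm_RtoC, Rabs_right; lra. }
  assert (Hconst : forall P : C -> R, (forall z w, Rabs (P z - P w) <= Cnorm (z - w)) ->
     forall v, P (coord v (sigma (RtoC (/2)))) = P (coord v (sigma (RtoC 0)))).
  { intros P HP v.
    destruct (MVT_cor2 (fun t => P (coord v (sigma (RtoC t)))) (fun _ => 0) 0 (/2)) as [c [Hc _]]; [lra| |lra].
    intros t Ht eps He; destruct (Hder (RtoC t) (Hdisc t Ht) v (eps/2) ltac:(lra)) as [d [Hd H]].
    exists (mkposreal d Hd); intros h Hh0 Hh; simpl in Hh.
    specialize (H (RtoC h) ltac:(rewrite Cnorm_RtoC; exact Hh)).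
    replace (RtoC t + RtoC h)%C with (RtoC (t + h)) in H by (Cext; ring).
    rewrite Cnorm_RtoC in H; rewrite Rminus_0_r.
    assert (Hhp : 0 < Rabs h) by (apply Rabs_pos_lt, Hh0).
    unfold Rdiv; rewrite Rabs_mult, Rabs_inv.
    apply Rmult_lt_reg_r with (Rabs h); [exact Hhp|]; rewrite Rmult_assoc, Rinv_l, Rmult_1_r by lra.
    eapply Rle_lt_trans; [apply HP|]; eapply Rle_lt_trans; [exact H|]; nra. }
  assert (E : RtoC (/2) = RtoC 0).
  { apply Hinj; [apply Hdisc; lra|apply Hdisc; lra|].
    assert (Hc : forall v, coord v (sigma (RtoC (/2))) = coord v (sigma (RtoC 0))).
    { intro v; apply C_ext.
      - apply (Hconst Re); intros; exact (Re_le_Cnorm (z - w)).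
      - apply (Hconst Im); intros; exact (Im_le_Cnorm (z - w)). }
    pose proof (Hc V1); pose proof (Hc V2); pose proof (Hc V3); pose proof (Hc V4).
    destruct (sigma (RtoC (/2))), (sigma (RtoC 0)); simpl in *; congruence. }
  apply (f_equal Re) in E; simpl in E; lra.
Qed.

Theorem dense_invertibles_no_disc X B : (forall x, X x -> n4 x <= B) -> PX_dense_invertibles X ->
  contains_no_analytic_disc (poly_hull X).
Proof.
  intros HXB HD [sigma [Hs Hin]].
  destruct (analytic_disc_regular_point sigma Hs) as (w & v & la & Hw & Hla & Hder).
  assert (Hlp := Cnorm_pos la Hla); set (l := Cnorm la) in *.
  destruct (Hder (l/16) ltac:(lra)) as [d [Hd Hd']].
  unfold open_unit_disc in Hw.
  (* Points of the square have modulus at most 2, so displacements reach 2r: still within [d] and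
     inside the unit disc. *)
  set (r := Rmin (d/4) ((1 - Cnorm w)/4)).
  assert (Hr : 0 < r) by (apply Rmin_glb_lt; lra).
  assert (Hr1 : r <= d/4) by apply Rmin_l. assert (Hr2 : r <= (1 - Cnorm w)/4) by apply Rmin_r.
  clearbody r.
  set (a := coord v (sigma w)).
  set (Q0 := Padd (Pvar v) (Pconst (- a)%C)).
  assert (He1 : 0 < r * l / 16) by (apply Rdiv_lt_0_compat; [nra|lra]).
  destruct (HD (peval Q0) (in_PX_poly X Q0) (r * l / 16) He1) as [g [[Hg [h [Hh Egh]]] Hgd]].
  destruct (in_PX_bounded X B HXB g Hg) as [Mg [HMg HMgb]].
  destruct (in_PX_bounded X B HXB h Hh) as [Mh [HMh HMhb]].
  destruct (Hh (Rmin 1 (/ (4 * (Mg + 1))))) as [q Hq].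
  { apply Rmin_glb_lt; [lra|apply Rinv_0_lt_compat; lra]. }
  destruct (Hg (Rmin (r * l / 16) (/ (4 * (Mh + 1))))) as [p Hp].
  { apply Rmin_glb_lt; [exact He1|apply Rinv_0_lt_compat; lra]. }
  (* The inverse of [g] lives on X only. Polynomials p near g and q near its inverse carry p q ~ 1
     over to the hull, so p cannot vanish on the hull. *)
  assert (H1 : forall z, poly_hull X z -> Cnorm (peval p z * peval q z - C1) <= /2).
  { intros z Hz; apply (Hz (Padd (Pmul p q) (Pconst (- C1)%C))); intros x Hx.
    change (Cnorm (peval p x * peval q x - C1) <= /2).
    specialize (Hq x Hx); specialize (Hp x Hx); specialize (HMgb x Hx); specialize (HMhb x Hx).
    assert (Q1 := Rlt_le_trans _ _ _ Hq (Rmin_l _ _)); assert (Q2 := Rlt_le_trans _ _ _ Hq (Rmin_r _ _)).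
    assert (P2 := Rlt_le_trans _ _ _ Hp (Rmin_r _ _)).
    assert (Hqb : Cnorm (peval q x) <= Mh + 1).
    { replace (peval q x) with (h x - (h x - peval q x))%C by ring.
      eapply Rle_trans; [apply Cnorm_sub_le|]; lra. }
    replace (peval p x * peval q x - C1)%C
      with (- ((g x - peval p x) * peval q x + g x * (h x - peval q x)))%C
      by (rewrite <- (Egh x Hx); ring).
    rewrite Cnorm_opp; eapply Rle_trans; [apply Cnorm_triang|].
    assert (Cnorm ((g x - peval p x) * peval q x) <= / (4 * (Mh + 1)) * (Mh + 1)) by (apply Cnorm_mul_le; lra).
    assert (Cnorm (g x * (h x - peval q x)) <= (Mg + 1) * / (4 * (Mg + 1))) by (apply Cnorm_mul_le; lra).
    replace (/ (4 * (Mh + 1)) * (Mh + 1)) with (/4) in * by (field; lra).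
    replace ((Mg + 1) * / (4 * (Mg + 1))) with (/4) in * by (field; lra). lra. }
  assert (H2 : forall z, poly_hull X z -> Cnorm (peval p z - peval Q0 z) <= r * l / 8).
  { intros z Hz; replace (peval p z - peval Q0 z)%C
      with (peval (Padd p (Pmul (Pconst (- C1)%C) Q0)) z) by (cbn [peval]; ring).
    apply Hz; intros x Hx; replace (peval (Padd p (Pmul (Pconst (- C1)%C) Q0)) x)
      with (peval p x - peval Q0 x)%C by (cbn [peval]; ring).
    specialize (Hp x Hx); specialize (Hgd x Hx); assert (P1 := Rlt_le_trans _ _ _ Hp (Rmin_l _ _)).
    rewrite Cnorm_sub_sym; pose proof (Cnorm_sub_triang (peval Q0 x) (g x) (peval p x)); lra. }
  assert (Hwin : forall z, square z -> open_unit_disc (w + RtoC r * z)%C).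
  { intros z Hz; unfold open_unit_disc; pose proof (square_norm z Hz).
    eapply Rle_lt_trans; [apply Cnorm_triang|]; rewrite Cnorm_mul, Cnorm_RtoC, Rabs_right by lra.
    assert (r * Cnorm z <= r * 2) by (apply Rmult_le_compat_l; lra); lra. }
  assert (HrC : RtoC r <> C0) by (apply RtoC_neq0; lra).
  (* Rescaled p along the disc. The errors r l / 8 from p and (l/16) 2r from the derivative add up
     to r l / 4, so H is within 1/4 of the identity and must have a zero. *)
  set (H := fun z => (Cinv (RtoC r * la) * peval p (sigma (w + RtoC r * z)))%C).
  destruct (square_map_has_zero H) as [z [Hz Ez]].
  - apply (cont_mul Cdist square (fun _ => Cinv (RtoC r * la)) (fun z => peval p (sigma (w + RtoC r * z)%C)));
      [apply cont_const|].
    clear - Hs Hwin Hr; induction p as [c|u|p IHp q IHq|p IHp q IHq]; cbn [peval].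
    + apply cont_const.
    + intros z Hz eps He; destruct (proj1 Hs _ (Hwin z Hz)) as [L HL].
      destruct (coord_derivative _ _ L HL u 1 Rlt_0_1) as [d [Hd H]].
      pose proof (Cnorm_ge0 (coord u L)).
      set (k := r * (1 + Cnorm (coord u L))).
      assert (Hk : 0 < k) by (unfold k; nra).
      exists (Rmin (d / r) (eps / k)); split; [apply Rmin_glb_lt; apply Rdiv_lt_0_compat; lra|].
      intros z' Hz' Hd'; unfold Cdist in *.
      assert (M1 := Rlt_le_trans _ _ _ Hd' (Rmin_l _ _)); assert (M2 := Rlt_le_trans _ _ _ Hd' (Rmin_r _ _)).
      set (h := (RtoC r * (z' - z))%C).
      assert (Nh : Cnorm h = r * Cnorm (z - z')).
      { unfold h; rewrite Cnorm_mul, Cnorm_RtoC, Rabs_right, (Cnorm_sub_sym z') by lra; reflexivity. }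
      assert (Nd : Cnorm h < d).
      { rewrite Nh; apply Rmult_lt_compat_l with (r := r) in M1; [|lra].
        replace (r * (d / r)) with d in M1 by (field; lra); exact M1. }
      specialize (H h Nd); replace (w + RtoC r * z + h)%C with (w + RtoC r * z')%C in H by (unfold h; ring).
      rewrite Cnorm_sub_sym.
      set (A := coord u (sigma (w + RtoC r * z')%C)) in *; set (A' := coord u (sigma (w + RtoC r * z)%C)) in *.
      replace (A - A')%C with ((A - A' - h * coord u L) + h * coord u L)%C by ring.
      eapply Rle_lt_trans; [apply Cnorm_triang|]; rewrite (Cnorm_mul h).
      apply Rmult_lt_compat_l with (r := k) in M2; [|exact Hk].
      replace (k * (eps / k)) with eps in M2 by (field; lra); unfold k in M2; rewrite Nh in *; lra.
    + apply (cont_add Cdist square (fun z => peval p (sigma (w + RtoC r * z)%C))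
        (fun z => peval q (sigma (w + RtoC r * z)%C))); assumption.
    + apply (cont_mul Cdist square (fun z => peval p (sigma (w + RtoC r * z)%C))
        (fun z => peval q (sigma (w + RtoC r * z)%C))); assumption.
  - intros z Hz; pose proof (square_norm z Hz).
    specialize (H2 _ (Hin _ (Hwin z Hz))).
    assert (Nz : Cnorm (RtoC r * z) <= 2 * r).
    { rewrite Cnorm_mul, Cnorm_RtoC, Rabs_right by lra; nra. }
    specialize (Hd' (RtoC r * z)%C ltac:(lra)); fold a in Hd'.
    set (P := peval p _) in *.
    assert (Hq0 : peval Q0 (sigma (w + RtoC r * z)%C) = (coord v (sigma (w + RtoC r * z)%C) - a)%C) by reflexivity.
    rewrite Hq0 in H2.
    set (D := (coord v (sigma (w + RtoC r * z)%C) - a)%C) in *.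
    assert (Hbound : Cnorm (P - RtoC r * z * la) <= r * l / 4).
    { eapply Rle_trans; [apply (Cnorm_sub_triang _ D)|].
      assert (l / 16 * Cnorm (RtoC r * z) <= l / 16 * (2 * r)) by (apply Rmult_le_compat_l; lra). lra. }
    assert (EH : (H z - z)%C = (Cinv (RtoC r * la) * (P - RtoC r * z * la))%C).
    { unfold H; fold P; field; split; assumption. }
    rewrite EH, Cnorm_mul, Cnorm_inv, Cnorm_mul, Cnorm_RtoC, Rabs_right by (try lra; apply Cmul_neq0; assumption).
    fold l; apply Rmult_le_reg_l with (r * l); [nra|].
    rewrite <- Rmult_assoc, Rinv_r, Rmult_1_l by nra. nra.
  - specialize (H1 _ (Hin _ (Hwin z Hz))).
    assert (Ep : peval p (sigma (w + RtoC r * z)%C) = C0).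
    { apply NNPP; intro Hne; apply (Cmul_neq0 (Cinv (RtoC r * la)) (peval p (sigma (w + RtoC r * z)%C))); try assumption.
      intro E; assert (HN : Cnorm (Cinv (RtoC r * la)) = 0) by (rewrite E; apply Cnorm_0).
      assert (Hrl := Cmul_neq0 _ _ HrC Hla).
      rewrite Cnorm_inv in HN by exact Hrl; pose proof (Cnorm_pos _ Hrl) as Hpos.
      apply Rinv_0_lt_compat in Hpos; lra. }
    rewrite Ep in H1; replace (C0 * peval q (sigma (w + RtoC r * z)%C) - C1)%C with (- C1)%C in H1 by ring.
    rewrite Cnorm_opp, Cnorm_1 in H1; lra.
Qed.

Theorem theorem1p7 :
  (exists X : C4 -> Prop,
     is_arc X /\
     (exists z, poly_hull X z /\ ~ X z) /\
     contains_no_analytic_disc (poly_hull X) /\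
     PX_dense_invertibles X) /\
  (exists X : C4 -> Prop,
     is_simple_closed_curve X /\
     (exists z, poly_hull X z /\ ~ X z) /\
     contains_no_analytic_disc (poly_hull X) /\
     PX_dense_invertibles X).
Proof.
  destruct hull_set_exists as (X & t0 & Ht0 & X1 & X2 & X3 & X4 & X5).
  split.
  - destruct (arc_good X t0 Ht0 X1 X2 X3 X4 X5) as [G HG].
    destruct (adjoin_inverses _ _ _ HG) as (Y & B & HB & Hh & Hz & Hd).
    exists Y; repeat split; try assumption; exact (dense_invertibles_no_disc Y B HB Hd).
  - destruct (closed_curve_good X t0 Ht0 X1 X2 X3 X4 X5) as [G HG].
    destruct (adjoin_inverses _ _ _ HG) as (Y & B & HB & Hh & Hz & Hd).
    exists Y; repeat split; try assumption; exact (dense_invertibles_no_disc Y B HB Hd).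
Qed.
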